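(* Let $V$ be the Sierpinski gasket in $\mathbb{R}^{N-1}$ ($N\ge 2$) with intrinsic boundary $V_0=\{p_1,\dots,p_N\}$, let $W$ be its energy, and let $\mu$ be a nonzero, finite Borel measure on $V$ such that every nonempty relatively open subset of $V$ has strictly positive $\mu$-measure and $\mu(V_0)=0$. Let $S$ and $S_\infty$ be the semigroups on $L^2_\mu(V)$ generated by $W$ (extended by $\infty$ outside $H^1(V)$) and by $W_\infty$, respectively. Let $\tilde S$ be a strongly continuous, order preserving semigroup of (possibly nonlinear) contractions on $L^2_\mu(V)$. Assume that $\tilde S$ is generated by a convex, proper, lower semicontinuous, local function $\tilde W:L^2_\mu(V)\to[0,\infty]$ such that $\tilde W(0)=0$, where local means that $\tilde W(u+v)=\tilde W(u)+\tilde W(v)$ for all $u,v\in L^2_\mu(V)$ with $|u|\wedge|v|=0$. Assume that $$S_\infty\stackrel{t}{\preccurlyeq}\tilde S\stackrel{t}{\preccurlyeq}S .$$ Then there exist lower semicontinuous, bi-monotone, normalised functions $B_1,\dots,B_N:\mathbb{R}\to[0,\infty]$ such that, for every $u\in L^2_\mu(V)$, $$\tilde W(u)=\begin{cases}W(u)+\sum_{i=1}^N B_i(u(p_i)) & \text{if } u\in H^1(V),\\ \infty & \text{else.}\end{cases}$$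
   Context: Sierpinski gasket. Fix $N\ge 2$ and points $p_1,\dots,p_N\in\mathbb{R}^{N-1}$ with $|p_i-p_j|=1$ for $i\ne j$. Let $F_i(x)=\frac12x+\frac12p_i$. $V$ is the unique nonempty compact subset of $\mathbb{R}^{N-1}$ with $V=\bigcup_{i=1}^N F_i(V)$, with the Euclidean relative topology. Put $V_0=\{p_1,\dots,p_N\}$ (the intrinsic boundary), $V_m=\bigcup_{i=1}^N F_i(V_{m-1})$ for $m\ge1$; $V$ is the closure of $\bigcup_m V_m$. Energy. For $m\ge 1$, a cell of level $m$ is a set $F_{w_1}\circ\dots\circ F_{w_m}(V)$ with $w\in\{1,\dots,N\}^m$; $V_0$ is the $0$-cell. For $x,y\in V_m$ write $x\underset{m}{\sim}y$ if some cell of level $m$ contains both. For $u\in C(V)$ (real-valued continuous functions) let $W_m(u)=\frac12\left(\frac{N+2}{N}\right)^m\sum_{x,y\in V_m,\,x\underset{m}{\sim}y}(u(x)-u(y))^2$. The sequence $(W_m(u))_m$ is increasing; $W(u):=\lim_{m\to\infty}W_m(u)\in[0,\infty]$. $H^1(V):=\{u\in C(V): W(u)<\infty\}$ and $H^1_0(V):=\{u\in H^1(V):u|_{V_0}=0\}$. Since $\mu$ has full support, $C(V)$ and $H^1(V)$ are regarded as subspaces of $L^2_\mu(V)$. $W$ is extended to $L^2_\mu(V)$ by $W(u)=\infty$ for $u\notin H^1(V)$. $W_\infty:L^2_\mu(V)\to[0,\infty]$ is $W_\infty(u)=W(u)$ if $u\in H^1_0(V)$ and $W_\infty(u)=\infty$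 otherwise. Both $W$ and $W_\infty$ are convex, lower semicontinuous, with dense effective domain. Functions. $B:\mathbb{R}\to[0,\infty]$ is normalised if $B(0)=0$, and bi-monotone if it is decreasing (non-increasing) on $(-\infty,0]$ and increasing (non-decreasing) on $[0,\infty)$. Locality. A functional $\tilde W:L^2_\mu(V)\to[0,\infty]$ is local if, for every $u,v\in L^2_\mu(V)$, $\tilde W(u+v)=\tilde W(u)+\tilde W(v)$ whenever $|u|\wedge|v|=0$ ($\wedge$ denotes pointwise minimum). Generated semigroups. Let $H$ be a real Hilbert space and $\tilde W:H\to[0,\infty]$ proper, convex, lower semicontinuous, with effective domain $\mathrm{dom}\,\tilde W=\{\tilde W<\infty\}$. The subgradient at $u\in\mathrm{dom}\,\tilde W$ is $\partial\tilde W(u)=\{f\in H:\tilde W(u+v)-\tilde W(u)\ge\langle f,v\rangle\ \forall v\in H\}$. For every $u_0\in\overline{\mathrm{dom}\,\tilde W}$ there is a unique $u\in C([0,\infty);H)\cap H^1_{loc}((0,\infty);H)$ with $\dot u+\partial\tilde W(u)\ni0$ a.e. on $(0,\infty)$ and $u(0)=u_0$. The semigroup generated by $\tilde W$ is $S(t)u_0:=u(t)$; it is a strongly continuous semigroup of (possibly nonlinear) contractions on $\overline{\mathrm{dom}\,\tilde W}$. Properties of semigroups on $L^2=L^2_\mu(V)$ (inequalities are $\mu$-a.e.). $S$ is order preserving if $S(t)u\le S(t)v$ for all $t\ge0$ and all $u,v\in L^2$ with $u\le v$. $S_1\preccurlyeq S_2$ (domination) means: $S_2$ is order preserving and $|S_1(t)u|\le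 S_2(t)v$ for all $t\ge0$ and all $u,v\in L^2$ with $|u|\le v$. $S_1\stackrel{t}{\preccurlyeq}S_2$ (total domination) means $S_1\preccurlyeq S_2$ and $S_1\preccurlyeq -S_2(-\,\cdot)$, where $-S_2(-\,\cdot)$ is the semigroup $u\mapsto -S_2(t)(-u)$. *)

(* Defs.v *)
From HB Require Import structures.
From mathcomp Require Import all_boot all_order all_algebra.
From mathcomp Require Import ring_quotient.
From mathcomp Require Import all_classical all_reals all_analysis.
From mathcomp Require Import measurable_realfun.

Set Implicit Arguments.
Unset Strict Implicit.
Unset Printing Implicit Defensive.

Import Order.TTheory GRing.Theory Num.Theory.
Import numFieldNormedType.Exports.

Local Open Scope classical_set_scope.
Local Open Scope ring_scope.

(* L^2(mu) is the quotient of the square-integrable measurable functions by   *)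
(* the mu-a.e. null ones, normed by the L^2 norm. The library's LspaceType2   *)
(* carries no algebraic or topological structure.                             *)
Section L2.
Context d (T : measurableType d) (R : realType).
Variable mu : {measure set T -> \bar R}.

Notation Lfun2 := (LfunType mu (lee1n 2)).

Definition ae_null : {pred Lfun2} :=
  fun f => `[< {ae mu, forall x, (f : T -> R) x = 0} >].

Let LfunB (f g : Lfun2) x : (f - g : Lfun2) x = f x - g x. Proof. by []. Qed.

Let LfunZ a (f : Lfun2) x : (a *: f : Lfun2) x = a * f x. Proof. by []. Qed.

Lemma ae_null_zmod_closed : zmod_closed ae_null.
Proof.
split=> [|f g]; first by apply/asboolP; apply: nearW.
move=> /asboolP f0 /asboolP g0; apply/asboolP.
by apply: filterS2 f0 g0 => x fx gx; rewrite LfunB fx gx subrr.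
Qed.

HB.instance Definition _ :=
  GRing.isZmodClosed.Build Lfun2 ae_null ae_null_zmod_closed.

Local Open Scope quotient_scope.

Definition L2 : Type := Quotient.quot ae_null.
HB.instance Definition _ := GRing.Zmodule.on L2.
HB.instance Definition _ := EqQuotient.on L2.

Definition L2_fun (u : L2) : T -> R := (repr u : Lfun2).
Coercion L2_fun : L2 >-> Funclass.

Definition L2_class (f : Lfun2) : L2 := \pi_L2 f.

Lemma L2_classP (f g : Lfun2) :
  L2_class f = L2_class g <-> {ae mu, forall x, (f : T -> R) x = g x}.
Proof.
split=> [/eqP|fg].
  rewrite /L2_class -(Quotient.idealrBE ae_null) => /asboolP; apply: filterS => x /eqP.
  by rewrite LfunB subr_eq0 => /eqP.
apply/eqP; rewrite /L2_class -(Quotient.idealrBE ae_null); apply/asboolP.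
by apply: filterS fg => x fgx; rewrite LfunB fgx subrr.
Qed.

Lemma L2_funK (f : Lfun2) : {ae mu, forall x, L2_class f x = f x}.
Proof. by apply/L2_classP; rewrite /L2_class /L2_fun reprK. Qed.

Definition L2_scale (a : R) (u : L2) : L2 := L2_class (a *: (repr u : Lfun2)).

Lemma L2_scale_class a (f : Lfun2) : L2_scale a (L2_class f) = L2_class (a *: f).
Proof.
by apply/L2_classP; apply: filterS (L2_funK f) => x fx; rewrite !LfunZ -fx.
Qed.

Lemma L2_ind (P : L2 -> Prop) : (forall f, P (L2_class f)) -> forall u, P u.
Proof. by move=> H u; rewrite -(reprK u). Qed.

Lemma L2_classD (f g : Lfun2) : L2_class (f + g) = L2_class f + L2_class g.
Proof. exact: (pi_addr (f : Lfun2) g). Qed.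

Lemma L2_scaleA a b (u : L2) : L2_scale a (L2_scale b u) = L2_scale (a * b) u.
Proof. by elim/L2_ind: u => f; rewrite !L2_scale_class scalerA. Qed.

Lemma L2_scale1 : left_id 1 L2_scale.
Proof. by elim/L2_ind => f; rewrite L2_scale_class scale1r. Qed.

Lemma L2_scaleDr : right_distributive L2_scale +%R.
Proof.
move=> a; elim/L2_ind => f; elim/L2_ind => g.
by rewrite -L2_classD !L2_scale_class scalerDr L2_classD.
Qed.

Lemma L2_scaleDl u : {morph L2_scale^~ u : a b / a + b}.
Proof.
elim/L2_ind: u => f a b.
by rewrite /= !L2_scale_class scalerDl L2_classD.
Qed.

HB.instance Definition _ := GRing.Zmodule_isLmodule.Build R L2
  L2_scaleA L2_scale1 L2_scaleDr L2_scaleDl.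

Definition L2_norm (u : L2) : R := fine ('N[mu]_2[EFin \o u]).

Lemma ae_eq_Lnorm2 (f g : T -> R) :
  measurable_fun [set: T] f -> measurable_fun [set: T] g ->
  {ae mu, forall x, f x = g x} ->
  ('N[mu]_2[EFin \o f] = 'N[mu]_2[EFin \o g])%E.
Proof.
move=> mf mg fg.
have mpow (h : T -> R) : measurable_fun [set: T] h -> measurable_fun [set: T]
    (@poweR R ^~ 2 \o (abse \o (EFin \o h))).
  move=> mh; apply: measurableT_comp; first exact: measurable_poweR.
  by apply: measurableT_comp => //; exact/measurable_EFinP.
have E : (\int[mu]_x (`|(EFin \o f) x| `^ 2) =
          \int[mu]_x (`|(EFin \o g) x| `^ 2))%E.
  apply: ae_eq_integral; [exact: measurableT|exact: mpow|exact: mpow|].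
  by apply: filterS fg => x /= fgx _; rewrite fgx.
by rewrite Lnorm.unlock /= E.
Qed.

Lemma L2_norm_class (f : Lfun2) :
  L2_norm (L2_class f) = fine ('N[mu]_2[EFin \o (f : T -> R)]).
Proof.
by rewrite /L2_norm (@ae_eq_Lnorm2 (L2_class f) f)//; exact: L2_funK.
Qed.

Lemma L2_ler_normD u v : L2_norm (u + v) <= L2_norm u + L2_norm v.
Proof.
elim/L2_ind: u => f; elim/L2_ind: v => g.
by rewrite -L2_classD !L2_norm_class; exact: ler_LnormD.
Qed.

Lemma L2_normZ a u : L2_norm (a *: u) = `|a| * L2_norm u.
Proof.
elim/L2_ind: u => f.
rewrite [a *: _]L2_scale_class !L2_norm_class.
by rewrite LnormZ fineM// ge0_fin_numE ?Lnorm_ge0//; exact: Lfunction_finite.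
Qed.

Lemma L2_norm_eq0 u : L2_norm u = 0 -> u = 0.
Proof.
elim/L2_ind: u => f; rewrite L2_norm_class => /fine_Lnormr_eq0 f0.
have <- : L2_class 0 = 0 by exact: (@pi_zeror _ _ _ _ _ (Quotient.quot ae_null)).
by apply/L2_classP; apply: filterS f0 => x /(_ I).
Qed.

HB.instance Definition _ := Lmodule_isNormed.Build R L2
  L2_ler_normD L2_normZ L2_norm_eq0.

Definition L2_dot (u v : L2) : R := \int[mu]_x (u x * v x).

Lemma L2_norm_dot (u : L2) : `|u| ^+ 2 = L2_dot u u.
Proof.
rewrite /L2_dot /Rintegral -[`|u|]/(L2_norm u) /L2_norm.
rewrite -powR_mulrn ?fine_ge0 ?Lnorm_ge0//.
rewrite -[LHS]/(fine ((fine 'N[mu]_2[EFin \o u] `^ 2)%:E)) -poweR_EFin.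
rewrite finite_norm_fine poweR_Lnorm//; congr fine.
apply: eq_integral => x _ /=.
by rewrite powR_mulrn// real_normK ?num_real// expr2.
Qed.
End L2.

Arguments L2_dot {d T R} mu u v.

Section order_L2.
Context d (T : measurableType d) (R : realType).
Variable mu : {measure set T -> \bar R}.
Implicit Types S : R -> L2 mu -> L2 mu.

Definition L2_le (u v : L2 mu) := {ae mu, forall x, u x <= v x}.

Definition L2_abs_le (u v : L2 mu) := {ae mu, forall x, `|u x| <= v x}.

Definition order_preserving S :=
  forall t u v, 0 <= t -> L2_le u v -> L2_le (S t u) (S t v).

Definition dominated S1 S2 := order_preserving S2 /\
  forall t u v, 0 <= t -> L2_abs_le u v -> L2_abs_le (S1 t u) (S2 t v).

Definition neg_semigroup S : R -> L2 mu -> L2 mu := fun t u => - S t (- u).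

Definition totally_dominated S1 S2 :=
  dominated S1 S2 /\ dominated S1 (neg_semigroup S2).

Definition local_functional (W : L2 mu -> \bar R) := forall u v : L2 mu,
  {ae mu, forall x, Num.min `|u x| `|v x| = 0} ->
  W (u + v) = (W u + W v)%E.

End order_L2.

Section bochner.
Context {R : realType} {H : normedModType R}.
Local Notation leb := (@lebesgue_measure R).

Definition simple_map (s : R -> H) :=
  finite_set (range s) /\ forall h, measurable (s @^-1` [set h]).

Definition simple_integral (D : set R) (s : R -> H) : H :=
  \sum_(h \in range s) fine (leb (D `&` s @^-1` [set h])) *: h.

(* g is Bochner integrable on D, a set of finite measure, with integral x *)
Definition is_bochner_integral (D : set R) (g : R -> H) (x : H) :=
  exists s : nat -> R -> H,
    [/\ forall n, simple_map (s n),
        {ae leb, forall t, D t -> s n t @[n --> \oo] --> g t},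
        (\int[leb]_(t in D) `|s n t - g t|%:E)%E @[n --> \oo] --> 0%E &
        simple_integral D (s n) @[n --> \oo] --> x].

(* u is the continuous representative of an element of H^1_loc((0,oo); H) and *)
(* g is its weak derivative: g is in L^2_loc((0,oo); H) and u is a primitive  *)
(* of g.                                                                      *)
Definition H1loc_derivative (u g : R -> H) := forall a b, 0 < a -> a <= b ->
  (\int[leb]_(t in `[a, b]) (`|g t| ^+ 2)%:E < +oo)%E /\
  is_bochner_integral `[a, b] g (u b - u a).

End bochner.

Section gradient_flow.
Context {R : realType} {H : normedModType R}.
Variable dot : H -> H -> R.
Implicit Types (W : H -> \bar R) (S : R -> H -> H).

Definition edom W : set H := [set u | (W u < +oo)%E].

Definition eproper W := edom W !=set0.

Definition econvex W := forall (u v : H) (t : R), 0 <= t <= 1 ->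
  (W (t *: u + (1 - t) *: v)%R <= t%:E * W u + (1 - t)%R%:E * W v)%E.

Definition subgradient W (u : H) : set H :=
  [set f | edom W u /\ forall v, ((dot f v)%:E <= W (u + v)%R - W u)%E].

Definition gradient_flow W (u0 : H) (u : R -> H) :=
  [/\ u 0 = u0, {within `[0, +oo[, continuous u} &
      exists2 g, H1loc_derivative u g &
        {ae (@lebesgue_measure R), forall t, 0 < t ->
          subgradient W (u t) (- g t)}].

(* The semigroup generated by W lives on the closure of edom W; S is defined  *)
(* on all of H, so that generates W S contains the density of edom W.         *)
Definition generates W S := forall u0, gradient_flow W u0 (S ^~ u0).

Definition contraction_semigroup S :=
  [/\ forall u, S 0 u = u,
      forall s t u, 0 <= s -> 0 <= t -> S (s + t) u = S s (S t u),
      forall u, {within `[0, +oo[, continuous (S ^~ u)} &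
      forall t u v, 0 <= t -> `|S t u - S t v| <= `|u - v|].

End gradient_flow.

Section gasket.
Context {R : realType} {N : nat}.
Local Notation E := 'rV[R]_N.-1.
Variable p : 'I_N -> E.

(* The norm of 'rV[R]_n in the library is the sup norm: same topology, other  *)
(* distances.                                                                 *)
Definition euclidean_norm n (x : 'rV[R]_n) : R :=
  Num.sqrt (\sum_k x 0 k ^+ 2).

Definition half_map (i : 'I_N) (x : E) : E := 2^-1 *: x + 2^-1 *: p i.

(* The three conditions determine V, by uniqueness of the attractor of        *)
(* (half_map i)_i.                                                            *)
Definition is_gasket (V : set E) :=
  [/\ V !=set0, compact V & V = \bigcup_i (half_map i @` V)].

Fixpoint level (m : nat) : set E :=
  if m is m'.+1 then \bigcup_i (half_map i @` level m') else range p.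

Definition cell (V : set E) (w : seq 'I_N) : set E :=
  foldr (fun i A => half_map i @` A) V w.

Definition same_cell (V : set E) (m : nat) (x y : E) :=
  exists w : m.-tuple 'I_N, cell V w x /\ cell V w y.

Lemma gasket_vertex_subproof V : is_gasket V -> forall i, V (p i).
Proof.
move=> [[x Vx] cV VE] i.
have Vn n : V (2^-1 ^+ n *: (x - p i) + p i).
  elim: n => [|n IH]; first by rewrite expr0 scale1r subrK.
  rewrite VE; exists i => //; exists (2^-1 ^+ n *: (x - p i) + p i) => //.
  rewrite /half_map scalerDr scalerA -exprS -addrA -scalerDl.
  by rewrite -[2^-1]mul1r -splitr scale1r.
have cl : closed V by apply: compact_closed => //; exact: norm_hausdorff.
have : 2^-1 ^+ n *: (x - p i) + p i @[n --> \oo] --> 0 *: (x - p i) + p i.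
  apply: cvgD; last exact: cvg_cst.
  apply: cvgZr_tmp; apply: cvg_expr.
  by rewrite gtr0_norm// invf_lt1// ltr1n.
rewrite scale0r add0r; apply: (closed_cvg _ cl).
exact: nearW.
Qed.

Variable V : set E.

Definition gasket_space (hV : is_gasket V) : Type := set_type V.

Hypothesis hV : is_gasket V.

HB.instance Definition _ := Choice.on (gasket_space hV).
HB.instance Definition _ := PseudoMetric.copy (gasket_space hV) (set_type V).

Definition vertex (i : 'I_N) : gasket_space hV :=
  exist _ (p i) (mem_set (gasket_vertex_subproof hV i)).

Lemma gasket_space_inhabited : exists x : gasket_space hV, True.
Proof. by have [[x Vx] _ _] := hV; exists (exist _ x (mem_set Vx)). Qed.

Definition gasket_point : gasket_space hV := sval (cid gasket_space_inhabited).

HB.instance Definition _ := isPointed.Build (gasket_space hV) gasket_point.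

Definition borel_gasket := g_sigma_algebraType (@open (gasket_space hV)).

Definition energy_level (m : nat) (u : gasket_space hV -> R) : R :=
  2^-1 * ((N + 2)%:R / N%:R) ^+ m *
  \sum_(xy \in [set xy : gasket_space hV * gasket_space hV |
      [/\ level m (val xy.1), level m (val xy.2) &
          same_cell V m (val xy.1) (val xy.2)]])
    (u xy.1 - u xy.2) ^+ 2.

Definition energy_cont (u : gasket_space hV -> R) : \bar R :=
  limn (fun m => (energy_level m u)%:E).

End gasket.

Section gasket_energy.
Context {R : realType} {N : nat} {p : 'I_N -> 'rV[R]_N.-1}.
Context {V : set 'rV[R]_N.-1} {hV : is_gasket p V}.
Variable mu : {measure set (borel_gasket hV) -> \bar R}.
Implicit Types u : L2 mu.

Definition cont_rep u : set (gasket_space hV -> R) :=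
  [set w | continuous w /\ {ae mu, forall x, u x = w x}].

(* H^1(V) as a subspace of L^2(mu) *)
Definition H1_L2 : set (L2 mu) :=
  [set u | exists2 w, cont_rep u w & (energy_cont w < +oo)%E].

(* The continuous representative of u (0 if there is none); it is unique when *)
(* mu has full support.                                                       *)
Definition crep u : gasket_space hV -> R := xget (cst 0) (cont_rep u).

Definition H10_L2 : set (L2 mu) :=
  [set u | H1_L2 u /\ forall i, crep u (vertex hV i) = 0].

Definition energy u : \bar R := if u \in H1_L2 then energy_cont (crep u) else +oo%E.

Definition energy_infty u : \bar R := if u \in H10_L2 then energy u else +oo%E.

End gasket_energy.

Arguments H1_L2 {R N p V hV} mu.
Arguments energy {R N p V hV} mu u.
Arguments energy_infty {R N p V hV} mu u.

Definition bimonotone (R : realType) (B : R -> \bar R) :=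
  (forall x y, x <= y -> y <= 0 -> (B y <= B x)%E) /\
  (forall x y, 0 <= x -> x <= y -> (B x <= B y)%E).

Definition normalised (R : realType) (B : R -> \bar R) := B 0 = 0%E.

(* Main.v *)
Require Import Defs.
From mathcomp Require Import all_boot all_order all_algebra.
From mathcomp Require Import all_classical all_reals all_analysis.
From mathcomp Require Import perm measurable_realfun finmap ring lra.

Set Implicit Arguments.
Unset Strict Implicit.
Unset Printing Implicit Defensive.

Import Order.TTheory GRing.Theory Num.Theory.
Import numFieldNormedType.Exports.

Local Open Scope classical_set_scope.
Local Open Scope ring_scope.

(** Let D be the difference between Wt and the energy. Both dominations enter
    only through static inequalities between the functionals, and these force
    D to be a functional of the boundary values.

    From semigroups to functionals. If S1 is dominated by S2, the product flow
    preserves the closed convex set of the pairs (a, b) with |a| <= b. For u,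
    v >= 0 the projection of (u, v) on it is (u - w/2, v + w/2) with w = (u -
    v)^+. A flow that starts at the projection stays in the set, so it never
    gets closer to (u, v) than its starting point. A gradient flow that does
    not approach a target starts at a point where its functional is at most
    the value at the target: integrate the evolution inequality over a short
    time and use lower semicontinuity ([evolution_inequality],
    [flow_comparison]). The result is [half_step]: Phi1 (u - w/2) + Phi2 (v +
    w/2) <= Phi1 u + Phi2 v. The comparison with the reflected semigroup - S2
    (- .) gives the same with a sign in the second slot.

    From half steps to monotonicity. The energy is a quadratic form. Go from x
    to x + b in n half steps of length 1/n: the first order terms cancel, so
    the excess D grows by O(1/n^2) at each step, and by O(1/n) on the whole
    path ([excess_path]). With lower semicontinuity the excess does not grow
    at all. The domination by S then shows that D decreases when a positive
    function is lowered ([excess_antitone_step]). The domination of Sinfty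
    shows that D does not grow when v is replaced by the maximum of v and a
    function that vanishes on the boundary ([excess_join]). If x <= v on the
    boundary, then z = (x - v)^+ vanishes there, and the maximum of v and a
    large multiple of z dominates v + z up to a low truncation of z, which has
    small energy. Hence D x <= D v ([excess_boundary]): on the positive cone D
    is a monotone functional of the boundary values, and D >= 0 since D 0 = 0.

    Locality. The energy and Wt are additive on functions with disjoint
    supports. There are finite energy bumps psi_i with disjoint supports,
    equal to 1 at the vertex i and to 0 at the others ([H1_bumps]). Replacing
    a positive f by the sum of the f(p_i) psi_i does not change its boundary
    values, so D f is the sum of the D (f(p_i) psi_i). The positive and the
    negative part of a function have disjoint supports as well, and B_i s
    collects the two signs.

    The analysis on the gasket rests on one estimate: the oscillation of a
    function of finite energy on a cell decays geometrically with the level of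
    the cell ([oscillation_cell]). It gives boundedness, equicontinuity, hence
    the lower semicontinuity of the energy on L^2, and strong locality. That
    there are enough functions of finite energy for the bumps follows from the
    density of the domain of the energy, which is contained in the assumption
    that the energy generates a semigroup on all of L^2. *)

(** * Gradient flows in Hilbert space *)

(** For nonnegative functions the integral is a supremum over the simple
    functions below, so that it is monotone without any measurability. This
    matters because the integrands attached to a weak derivative need not be
    measurable. *)
Lemma lower_integral_le d (T : measurableType d) (R : realType)
    (mu : {measure set T -> \bar R}) (D : set T) (f g : T -> \bar R) :
  (forall x, D x -> 0 <= f x)%E -> (forall x, D x -> f x <= g x)%E ->
  (\int[mu]_(x in D) f x <= \int[mu]_(x in D) g x)%E.
Proof.
move=> f0 fg; rewrite !ge0_integralE//; last first.
  by move=> x Dx; exact: le_trans (f0 _ Dx) (fg _ Dx).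
apply: le_ereal_sup => _ [h hf <-]; exists h => // x; apply: le_trans (hf x) _.
by rewrite /patch; case: ifPn => // /set_mem; exact: fg.
Qed.

(** The supremum of the s up to which f stays below its initial value cannot
    be smaller than b, since the local monotonicity pushes it further. *)
Lemma locally_nonincreasing (R : realType) (a b : R) (f : R -> R) : a <= b ->
  (forall s, a <= s <= b -> exists2 e, 0 < e & forall c d,
     a <= c -> c <= d -> d <= b -> s - e < c -> d < s + e -> f d <= f c) ->
  f b <= f a.
Proof.
move=> ab loc.
(* The supremum m of A is attained, and m < b would let A extend beyond m. *)
set A := [set s | a <= s <= b /\ f s <= f a].
have Aa : A a by rewrite /A/= lexx ab lexx.
have ubA : ubound A b by move=> s [/andP[]].
have hsA : has_sup A by split; [exists a | exists b].
set m := sup A.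
have am : a <= m by apply: ub_le_sup => //; exists b.
have mb : m <= b by apply: ge_sup => //; exists a.
have [e e0 he] : exists2 e, 0 < e & forall c d,
    a <= c -> c <= d -> d <= b -> m - e < c -> d < m + e -> f d <= f c.
  by apply: loc; rewrite am mb.
have [s As sm] := sup_adherent e0 hsA; rewrite -/m in sm.
have sm' : s <= m by apply: ub_le_sup => //; exists b.
have [/andP[as_ sb] fs] := As.
have Am : f m <= f a by apply: le_trans (fs); apply: he => //; rewrite ltrDl.
have [bm|bm] := leP b m; first by have -> : b = m by apply/eqP; rewrite eq_le bm mb.
set t := Num.min b (m + e / 2).
have mt : m < t by rewrite /t lt_min bm/= ltrDl divr_gt0.
have tb : t <= b by rewrite /t ge_min lexx.
have te : t < m + e.
  by rewrite /t gt_min; apply/orP; right; rewrite ltrD2l ltr_pdivrMr// ltr_pMr// ltr1n.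
have : t <= m.
  apply: ub_le_sup; first by exists b.
  split; first by rewrite (le_trans am (ltW mt)) tb.
  by apply: le_trans (Am); apply: he => //; [exact: ltW | rewrite gtrBl].
by rewrite leNgt mt.
Qed.

Section inner_product.
Context {R : realType} {H : normedModType R}.

(** An inner product is carried as a predicate on a bilinear form, because the
    flows live on a normed space whose norm is only known to come from it. *)
Record is_dot (dot : H -> H -> R) : Prop := IsDot {
  dotC : forall u v, dot u v = dot v u;
  dotDl : forall u v w, dot (u + v) w = dot u w + dot v w;
  dotZl : forall a u v, dot (a *: u) v = a * dot u v;
  dotvv : forall u, dot u u = `|u| ^+ 2 }.

Variable dot : H -> H -> R.
Hypothesis hd : is_dot dot.

Lemma dotDr u v w : dot u (v + w) = dot u v + dot u w.
Proof. by rewrite (dotC hd) (dotDl hd) !(dotC hd _ u). Qed.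
Lemma dotZr a u v : dot u (a *: v) = a * dot u v.
Proof. by rewrite (dotC hd) (dotZl hd) (dotC hd v). Qed.
Lemma dotNl u v : dot (- u) v = - dot u v.
Proof. by rewrite -scaleN1r (dotZl hd) mulN1r. Qed.
Lemma dotNr u v : dot u (- v) = - dot u v.
Proof. by rewrite (dotC hd) dotNl (dotC hd v). Qed.
Lemma dotBl u v w : dot (u - v) w = dot u w - dot v w.
Proof. by rewrite (dotDl hd) dotNl. Qed.
Lemma dotBr u v w : dot u (v - w) = dot u v - dot u w.
Proof. by rewrite dotDr dotNr. Qed.
Lemma dot0l u : dot 0 u = 0.
Proof. by rewrite -(subrr 0) dotBl subrr. Qed.

Lemma dot_cauchy_schwarz u v : `|dot u v| <= `|u| * `|v|.
Proof.
have [->|v0] := eqVneq v 0; first by rewrite (dotC hd) dot0l !normr0 mulr0.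
have nv0 : 0 < `|v| by rewrite normr_gt0.
rewrite -ler_sqr ?nnegrE ?mulr_ge0// real_normK ?num_real//.
have : 0 <= dot (`|v| ^+ 2 *: u - dot u v *: v) (`|v| ^+ 2 *: u - dot u v *: v).
  by rewrite (dotvv hd) exprn_ge0.
rewrite !dotBl !dotBr !(dotZl hd) !dotZr !(dotvv hd) (dotC hd v u).
set x := dot u v; set y := `|v|; set z := `|u| => h.
have : 0 <= y ^+ 2 * ((z * y) ^+ 2 - x ^+ 2).
  by apply: le_trans h _; rewrite le_eqVlt; apply/orP; left; apply/eqP; ring.
by rewrite pmulr_rge0 ?exprn_gt0// subr_ge0.
Qed.

(** The derivative of half the squared distance to h along a segment is the
    pairing of the increment with its midpoint: an exact discrete form of the
    chain rule. *)
Lemma sqr_norm_diff (x y h : H) :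
  `|y - h| ^+ 2 - `|x - h| ^+ 2 = 2 * dot (y - x) (2^-1 *: (x + y) - h).
Proof.
rewrite -!(dotvv hd) !dotBl !dotBr dotZr dotZr !dotDr.
by rewrite (dotC hd x y) (dotC hd h x) (dotC hd h y); field.
Qed.

End inner_product.

Section simple_maps.
Context d (T : measurableType d) {R : realType} {H : normedModType R}.
Variable mu : {measure set T -> \bar R}.
Variable s : T -> H.
Hypothesis fs : finite_set (range s).
Hypothesis ms : forall h, measurable (s @^-1` [set h]).

Lemma simple_comp_measurable (phi : H -> R) : measurable_fun setT (phi \o s).
Proof.
move=> _ A mA; rewrite setTI.
rewrite (_ : _ @^-1` A = \bigcup_(h in range s `&` phi @^-1` A) (s @^-1` [set h])).
  apply: fin_bigcup_measurable; last by move=> h _; exact: ms.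
  by apply: sub_finite_set fs; exact: subIsetl.
apply/seteqP; split=> [t /= At|t [h [_ Ah] /= sth]]; last by rewrite /= sth.
by exists (s t) => //; split=> //; exists t.
Qed.

Let st t : s t \in fset_set (range s).
Proof. by rewrite in_fset_set//; apply/mem_set; exists t. Qed.

Lemma simple_comp_bounded (phi : H -> R) : exists M, forall t, `|phi (s t)| <= M.
Proof.
exists (\sum_(h <- fset_set (range s)) `|phi h|) => t.
by rewrite (big_rem _ (st t))/= lerDl sumr_ge0.
Qed.

Lemma bounded_integrable (D : set T) (f : T -> R) M : measurable D ->
  (mu D < +oo)%E -> measurable_fun D f -> (forall t, D t -> `|f t| <= M) ->
  mu.-integrable D (EFin \o f).
Proof.
move=> mD fD mf fM.
apply: (@le_integrable _ _ _ mu D mD _ (EFin \o cst M)) => //.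
- exact/measurable_EFinP.
- by move=> t Dt /=; rewrite lee_fin (le_trans (fM _ Dt))// ler_norm.
- apply/integrableP; split; first exact/measurable_EFinP.
  by rewrite /= integral_cst//= lte_mul_pinfty.
Qed.

Lemma simple_integral_map (D : set T) (phi : H -> R) :
  measurable D -> (mu D < +oo)%E ->
  (forall u v, phi (u + v) = phi u + phi v) ->
  (forall a u, phi (a *: u) = a * phi u) ->
  phi (\sum_(h \in range s) fine (mu (D `&` s @^-1` [set h])) *: h) =
  \int[mu]_(t in D) phi (s t).
Proof.
move=> mD fD pD pZ.
have p0 : phi 0 = 0 by rewrite -(scale0r 0) pZ mul0r.
rewrite fsbig_finite//= (big_morph phi pD p0).
transitivity (\int[mu]_(t in D)
    \sum_(h <- fset_set (range s)) (phi h * \1_(s @^-1` [set h]) t)); last first.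
  apply: eq_Rintegral => t _.
  rewrite (big_fsetD1 (s t))//= indicE mem_set//= mulr1 big1_fset ?addr0// => h.
  by rewrite !inE => /andP[/eqP hs _] _; rewrite indicE memNset ?mulr0//= => /esym.
have ii h : mu.-integrable D (EFin \o (\1_(s @^-1` [set h]) : T -> R)).
  apply: (@bounded_integrable _ _ 1) => // t _.
  by rewrite indicE; case: (_ \in _); rewrite ?normr1 ?normr0.
have iZ h : mu.-integrable D (fun t => (phi h * \1_(s @^-1` [set h]) t)%:E).
  exact: (integrableZl mD (phi h) (ii h)).
rewrite /Rintegral.
under [X in _ = fine X]eq_integral do rewrite -sumEFin.
rewrite integral_sum// -sum_fine; last first.
  by move=> h _; exact: integrable_fin_num (iZ h).
apply: eq_bigr => h _; rewrite pZ mulrC.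
by have := RintegralZl (phi h) mD (ii h); rewrite /Rintegral => ->;
  rewrite integral_indic// setIC.
Qed.

End simple_maps.

Lemma lipschitz_cvg (R : realType) (H : normedModType R) (phi : H -> R) (K : R)
    (u : nat -> H) (l : H) :
  (forall x y, `|phi x - phi y| <= K * `|x - y|) ->
  u n @[n --> \oo] --> l -> phi (u n) @[n --> \oo] --> phi l.
Proof.
move=> lip ul; apply/cvgrPdist_lt => e e0.
have K0 : 0 < `|K| + 1 by rewrite ltr_wpDl.
move/cvgrPdist_lt : ul => /(_ (e / (`|K| + 1))); rewrite divr_gt0// => /(_ isT).
apply: filterS => n; rewrite ltr_pdivlMr// => h; apply: le_lt_trans (lip _ _) _.
apply: le_lt_trans h; rewrite mulrC ler_wpM2l//.
by rewrite (le_trans (ler_norm K))// lerDl.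
Qed.

Section pairing.
Context d (T : measurableType d) {R : realType} {H : normedModType R}.
Variable mu : {measure set T -> \bar R}.
Variable dot : H -> H -> R.
Hypothesis hd : is_dot dot.

(** A continuous linear form commutes with the Bochner integral: it does so on
    simple maps, and passes to the limit because the approximation is in L^1.
    As g is only an almost everywhere limit of simple maps, its norm and its
    pairings are replaced by measurable versions. *)
Lemma bochner_pairing (D : set T) (g : T -> H) (s : nat -> T -> H) (x : H) :
  measurable D -> (mu D < +oo)%E ->
  (forall n, finite_set (range (s n))) ->
  (forall n h, measurable (s n @^-1` [set h])) ->
  {ae mu, forall t, D t -> s n t @[n --> \oo] --> g t} ->
  (\int[mu]_(t in D) `|s n t - g t|%:E)%E @[n --> \oo] --> 0%E ->
  \sum_(h \in range (s n)) fine (mu (D `&` s n @^-1` [set h])) *: h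
    @[n --> \oo] --> x ->
  (\int[mu]_(t in D) (`|g t| ^+ 2)%:E < +oo)%E ->
  (exists gam, [/\ mu.-integrable D (EFin \o gam), forall t, 0 <= gam t &
     {ae mu, forall t, D t -> gam t = `|g t|}]) /\
  forall h, exists F, [/\ mu.-integrable D (EFin \o F),
     {ae mu, forall t, D t -> F t = dot (g t) h} &
     \int[mu]_(t in D) F t = dot x h].
Proof.
move=> mD fD fs ms [Z [mZ Z0 hZ]] sg sx g2.
have sgZ t : D t -> ~ Z t -> s n t @[n --> \oo] --> g t.
  by move=> Dt nZt; apply: contrapT => ns; apply: nZt; apply: hZ => /= /(_ Dt).
(* Outside the null set Z the simple maps converge to g; cutting off on Z
   makes every Lipschitz function of g measurable. *)
pose ind : T -> R := \1_(~` Z).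
have indZ t : Z t -> ind t = 0 by move=> Zt; rewrite /ind indicE memNset//=; apply.
have indN t : ~ Z t -> ind t = 1 by move=> Zt; rewrite /ind indicE mem_set.
have mind : measurable_fun D ind by apply: measurable_indic; exact: measurableC.
have aeZ : {ae mu, forall t, ~ Z t} by exists Z; split=> // t /= /contrapT.
have mlip (phi : H -> R) K : (forall u v, `|phi u - phi v| <= K * `|u - v|) ->
    measurable_fun D (fun t => ind t * phi (g t)).
  move=> lip; apply: (@measurable_fun_cvg _ _ _ _ (fun n t => ind t * phi (s n t))).
    move=> n; apply: measurable_funM => //.
    apply: measurable_funTS.
    exact: (@simple_comp_measurable _ _ _ _ (s n) (fs n) (ms n) phi).
  move=> t Dt; have [Zt|nZt] := pselect (Z t).
    by rewrite indZ// mul0r; under eq_fun do rewrite mul0r; exact: cvg_cst.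
  by apply: cvgMr; apply: lipschitz_cvg lip _; exact: sgZ.
pose gam t := ind t * `|g t|.
have mgam : measurable_fun D gam.
  by apply: (mlip _ 1) => u v; rewrite mul1r ler_dist_dist.
have ind0 t : 0 <= ind t by rewrite /ind indicE ler0n.
have gam0 t : 0 <= gam t by rewrite mulr_ge0.
have igam2 : mu.-integrable D (EFin \o (fun t => gam t ^+ 2)).
  apply/integrableP; split; first exact/measurable_EFinP/measurable_funX.
  apply: le_lt_trans g2; apply: lower_integral_le => t Dt //=.
  rewrite lee_fin ger0_norm ?exprn_ge0// ler_sqr ?nnegrE//.
  by rewrite /gam; have [/indZ|/indN] := pselect (Z t) => ->; rewrite ?mul0r ?mul1r.
have i1 : mu.-integrable D (EFin \o cst (1 : R)).
  by apply: (@bounded_integrable _ _ _ _ _ _ 1) => // t _; rewrite normr1.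
have igam : mu.-integrable D (EFin \o gam).
  apply: (le_integrable mD _ _ (integrableD mD i1 igam2)).
    exact/measurable_EFinP.
  (* On a set of finite measure gam <= 1 + gam^2 turns square integrability into
     integrability. *)
  move=> t Dt /=; rewrite lee_fin !ger0_norm ?addr_ge0 ?exprn_ge0//.
  by have := gam0 t; set y := gam t; nra.
split.
  exists gam; split => //; apply: filterS aeZ => t nZt Dt.
  by rewrite /gam indN// mul1r.
move=> h; pose F t := ind t * dot (g t) h.
have lip u v : `|dot u h - dot v h| <= `|h| * `|u - v|.
  by rewrite -(dotBl hd) mulrC; exact: dot_cauchy_schwarz.
have iF : mu.-integrable D (EFin \o F).
  apply: (le_integrable mD _ _ (integrableZl mD `|h| igam)).
    exact/measurable_EFinP/(mlip (dot^~ h) _ lip).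
  move=> t Dt /=; rewrite lee_fin /F /gam !normrM !normr_id (ger0_norm (ind0 t)).
  by rewrite mulrCA ler_wpM2l// mulrC dot_cauchy_schwarz.
exists F; split => //.
  by apply: filterS aeZ => t nZt Dt; rewrite /F indN// mul1r.
pose G n t := ind t * dot (s n t) h.
have mdot n : measurable_fun D (fun t => dot (s n t) h).
  apply: measurable_funTS.
  exact: (@simple_comp_measurable _ _ _ _ (s n) (fs n) (ms n) (dot^~ h)).
have mG n : measurable_fun D (G n) by exact: measurable_funM.
have iG n : mu.-integrable D (EFin \o G n).
  have [M hM] := simple_comp_bounded (fs n) (dot^~ h).
  apply: (@bounded_integrable _ _ _ _ _ _ M) => // t _.
  apply: le_trans (hM t); rewrite /G.
  by have [/indZ|/indN] := pselect (Z t) => ->; rewrite ?mul0r ?mul1r ?normr0.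
have GE n : \int[mu]_(t in D) G n t =
    dot (\sum_(h \in range (s n)) fine (mu (D `&` s n @^-1` [set h])) *: h) h.
  rewrite (simple_integral_map (fs n) (ms n) mD fD (phi := dot^~ h)).
  - congr fine; apply: ae_eq_integral => //; try exact/measurable_EFinP.
    by apply: filterS aeZ => t nZt Dt; rewrite /G indN// mul1r.
  - by move=> u v; exact: (dotDl hd).
  - by move=> a u; exact: (dotZl hd).
have Gx : \int[mu]_(t in D) G n t @[n --> \oo] --> dot x h.
  under eq_fun do rewrite GE.
  exact: (lipschitz_cvg (phi := dot^~ h) lip).
apply: cvg_unique Gx => //.
pose K := `|h| + 1; have K0 : 0 < K by rewrite ltr_wpDl.
have GF n : mu.-integrable D (EFin \o (fun t => `|G n t - F t|)).
  exact: (integrable_abse (integrableB mD (iG n) iF)).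
have iGF n : mu.-integrable D (EFin \o (fun t => K^-1 * `|G n t - F t|)).
  exact: (integrableZl mD K^-1 (GF n)).
have bnd n : `|\int[mu]_(t in D) G n t - \int[mu]_(t in D) F t| <=
    K * \int[mu]_(t in D) (K^-1 * `|G n t - F t|).
  rewrite RintegralZl// mulrA divff ?gt_eqF// mul1r -RintegralB//.
  by apply: le_normr_Rintegral => //; exact: (integrableB mD (iG n) iF).
have lowb n : (\int[mu]_(t in D) (K^-1 * `|G n t - F t|)%:E <=
    \int[mu]_(t in D) `|s n t - g t|%:E)%E.
  apply: lower_integral_le => t Dt; rewrite lee_fin.
    by rewrite mulr_ge0// invr_ge0 ltW.
  rewrite mulrC ler_pdivrMr// /G /F -mulrBr -(dotBl hd) normrM (ger0_norm (ind0 t)).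
  have : ind t <= 1 by have [/indZ|/indN] := pselect (Z t) => ->.
  move=> /(ler_wpM2r (normr_ge0 (dot (s n t - g t) h))); rewrite mul1r => /le_trans; apply.
  by apply: le_trans (dot_cauchy_schwarz hd _ _) _; rewrite ler_wpM2l// lerDl.
move/fine_cvgP : sg => [fin sg0].
apply/cvgrPdist_lt => e e0.
move/cvgrPdist_lt : sg0 => /(_ (e / K)); rewrite divr_gt0// => /(_ isT) sgn.
near=> n; rewrite distrC; apply: le_lt_trans (bnd n) _.
have : `|0 - fine (\int[mu]_(t in D) `|s n t - g t|%:E)%E| < e / K.
  by near: n.
rewrite sub0r normrN ger0_norm ?fine_ge0 ?integral_ge0// ltr_pdivlMr// mulrC.
apply: le_lt_trans; rewrite ler_pM2l// /Rintegral fine_le//.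
- exact: integrable_fin_num (iGF n).
- by near: n.
Unshelve. all: by end_near. Qed.

End pairing.

Lemma within_continuous_delta (R : realType) (H : normedModType R) (y : R -> H) s0 :
  {within `[0, +oo[, continuous y} -> 0 <= s0 -> forall e, 0 < e ->
  exists2 dl, 0 < dl & forall s, 0 <= s -> `|s0 - s| < dl -> `|y s0 - y s| < e.
Proof.
move=> /subspace_continuousP cy s00 e e0.
have /cvgrPdist_lt/(_ e e0) : y @ within `[0, +oo[ (nbhs s0) --> y s0.
  by apply: cy; rewrite /= in_itv/= s00.
move=> h0.
have /nbhs_ballP[dl dl0 h] : nbhs s0 [set s | `[0, +oo[%classic s -> `|y s0 - y s| < e].
  exact: h0.
by exists dl => // s s0' sd; apply: h => //=; rewrite in_itv/= s0'.
Qed.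

Lemma ae_le_Rintegral d (T : measurableType d) (R : realType)
    (mu : {measure set T -> \bar R}) (D : set T) (f g : T -> R) :
  measurable D -> mu.-integrable D (EFin \o f) -> mu.-integrable D (EFin \o g) ->
  {ae mu, forall t, D t -> f t <= g t} ->
  \int[mu]_(t in D) f t <= \int[mu]_(t in D) g t.
Proof.
move=> mD fi gi fg.
have mf : measurable_fun D f by exact/measurable_EFinP/(measurable_int mu).
have mg : measurable_fun D g by exact/measurable_EFinP/(measurable_int mu).
have mm : measurable_fun D (fun t => Num.min (f t) (g t)).
  exact: measurable_minr.
have mi : mu.-integrable D (EFin \o (fun t => Num.min (f t) (g t))).
  apply: (le_integrable mD _ _ (integrableD mD (integrable_abse fi) (integrable_abse gi))).
    exact/measurable_EFinP.
  move=> t _ /=; rewrite lee_fin (ger0_norm (addr_ge0 _ _))//.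
  by case: (leP (f t) (g t)) => _; rewrite ?lerDl ?lerDr.
rewrite (_ : \int[mu]_(t in D) f t = \int[mu]_(t in D) Num.min (f t) (g t)).
  by apply: le_Rintegral => // t _; rewrite ge_min lexx orbT.
congr fine; apply: ae_eq_integral => //; try exact/measurable_EFinP.
by apply: filterS fg => t h Dt /=; rewrite min_l// h.
Qed.

Section evolution_inequality.
Context {R : realType} {H : normedModType R}.
Variable dot : H -> H -> R.
Hypothesis hd : is_dot dot.
Local Notation leb := (@lebesgue_measure R).
Variables (y g : R -> H) (u : H) (k T : R).
Hypothesis cy : {within `[0, +oo[, continuous y}.
Hypothesis yg : H1loc_derivative y g.
Hypothesis gk : {ae leb, forall s, 0 < s -> s <= T -> dot (g s) (y s - u) <= k}.

Let lebesgue_itvE (a b : R) : a <= b -> lebesgue_measure `[a, b] = (b - a)%:E.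
Proof.
move=> ab; rewrite lebesgue_measure_itv/= lte_fin.
by case: ltP => // ba; congr EFin; lra.
Qed.

Let lebesgue_itv_lty (a b : R) : (lebesgue_measure `[a, b] < +oo)%E.
Proof.
by rewrite lebesgue_measure_itv/=; case: ifP => // _; rewrite -EFinB ltry.
Qed.

Let pairing (a b : R) : 0 < a -> a <= b ->
  (exists gam : measurableTypeR R -> R, [/\ leb.-integrable `[a, b] (EFin \o gam),
      forall t, 0 <= gam t &
     {ae leb, forall t, `[a, b]%classic t -> gam t = `|g t|}]) /\
  forall h, exists F : measurableTypeR R -> R, [/\ leb.-integrable `[a, b] (EFin \o F),
     {ae leb, forall t, `[a, b]%classic t -> F t = dot (g t) h} &
     \int[leb]_(t in `[a, b]) F t = dot (y b - y a) h].
Proof.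
move=> a0 ab; have [g2 [s [ss sg isg sx]]] := yg a0 ab.
apply: (@bochner_pairing _ _ _ _ leb dot hd _ g s) => //.
- exact: lebesgue_itv_lty.
- by move=> n; case: (ss n).
- by move=> n; case: (ss n).
Qed.

(** Formally, d/ds of |y s - u|^2 is 2 dot (g s) (y s - u) <= 2 k. Instead of
    differentiating, the function below is shown to be locally nonincreasing:
    on a short interval [c, d] the increment of the squared distance is a
    pairing with the midpoint of y c and y d, and y is within eta of this
    midpoint there. The error eta |g| is absorbed by the primitive of |g|, and
    eta tends to 0. *)
Lemma evolution_inequality_pos a : 0 < a -> a <= T ->
  `|y T - u| ^+ 2 - `|y a - u| ^+ 2 <= 2 * k * (T - a).
Proof.
move=> a0 aT.
have [[gam [igam gam0 gamE]] _] := pairing a0 aT.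
pose Gam s := \int[leb]_(t in `[a, s]) gam t.
have Gam0 : 0 <= Gam T by apply: Rintegral_ge0.
(* For the given e, eta = e / (2 (Gam T + 1)) makes the correction 2 eta Gam T
   at most e. *)
suff main eta : 0 < eta ->
    `|y T - u| ^+ 2 - `|y a - u| ^+ 2 <= 2 * k * (T - a) + 2 * eta * Gam T.
  apply/ler_addgt0Pr => e e0; have G2 : 0 < 2 * (Gam T + 1) by lra.
  have q0 : 0 < e / (2 * (Gam T + 1)) by rewrite divr_gt0.
  apply: le_trans (main _ q0) _.
  have : e / (2 * (Gam T + 1)) * (2 * (Gam T + 1)) = e by rewrite divfK// gt_eqF.
  by move: q0; set q := e / _; lra.
move=> eta0.
pose f s := `|y s - u| ^+ 2 - 2 * k * s - 2 * eta * Gam s.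
suff : f T <= f a.
  rewrite /f {1 3}/Gam => h.
  have -> : \int[leb]_(t in `[a, T]) gam t = Gam T by [].
  have : \int[leb]_(t in `[a, a]) gam t = 0.
    by rewrite set_itv1 Rintegral_set1.
  move: h; rewrite -/(Gam a) -/(Gam T) => h Ga; move: h; rewrite [Gam a]Ga.
  by move=> h; lra.
apply: locally_nonincreasing => // s /andP[as_ sT].
have [||e e0 he] := within_continuous_delta (s0 := s) cy _ (e := eta / 2).
- exact: le_trans (ltW a0) as_.
- by rewrite divr_gt0.
exists e => // c d ac cd dT sc ds.
have c0 : 0 < c by exact: lt_le_trans ac.
have [_ /(_ (2^-1 *: (y c + y d) - u))[F [iF FE intF]]] := pairing c0 cd.
have sub : (`[c, d] `<=` `[a, T])%classic.
  by apply: subset_itv; rewrite bnd_simp.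
have igcd : leb.-integrable `[c, d] (EFin \o gam).
  by apply: integrableS igam.
have near t : c <= t -> t <= d -> `|y s - y t| < eta / 2.
  move=> ct td; apply: he; first exact: le_trans (ltW c0) ct.
  by rewrite ltr_distl; apply/andP; split; lra.
have icst : leb.-integrable `[c, d] (EFin \o cst k).
  apply: (@bounded_integrable _ _ _ _ _ _ `|k|) => //.
  exact: lebesgue_itv_lty.
have ieg : leb.-integrable `[c, d] (EFin \o (fun t => eta * gam t)).
  exact: (integrableZl _ eta igcd).
have step : \int[leb]_(t in `[c, d]) F t <=
    \int[leb]_(t in `[c, d]) (k + eta * gam t).
  apply: ae_le_Rintegral => //; first exact: (integrableD _ icst ieg).
  apply: (@filterS3 _ _ (@ae_filter_ringOfSetsType _ (measurableTypeR R) R leb) _ _ _ _ _ FE gamE gk) => t + + + cdt; move=> /(_ cdt) -> /(_ (sub _ cdt)) ->.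
  move: cdt; rewrite /= in_itv/= => /andP[ct td].
  move=> /(_ (lt_le_trans c0 ct) (le_trans td dT)) hk.
  rewrite (_ : _ - u = (y t - u) + (2^-1 *: (y c + y d) - y t)); last first.
    by rewrite [RHS]addrC addrA subrK.
  rewrite (dotDr hd) lerD//.
  apply: le_trans (ler_norm _) _; apply: le_trans (dot_cauchy_schwarz hd _ _) _.
  rewrite mulrC ler_wpM2r//.
  rewrite (_ : _ - y t = (y s - y t) - (2^-1 *: (y s - y c) + 2^-1 *: (y s - y d))); last first.
    have half2 : 2^-1 *: y s + 2^-1 *: y s = y s.
      by rewrite -scalerDl -[2^-1]mul1r -splitr scale1r.
    by rewrite !scalerBr addrACA half2 -opprD -scalerDr opprB [RHS]addrC addrA subrK.
  apply: le_trans (ler_normB _ _) _; apply: (@le_trans _ _ (eta / 2 + eta / 2)); last first.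
    by rewrite -splitr.
  rewrite lerD ?(ltW (near _ _ _))//.
  apply: le_trans (ler_normD _ _) _; rewrite !normrZ -mulrDr ger0_norm ?invr_ge0//.
  rewrite mulrC ler_pdivrMr//; have -> : eta / 2 * 2 = eta / 2 + eta / 2 by field.
  by rewrite lerD ?(ltW (near _ _ _)).
have GamE : Gam d - Gam c = \int[leb]_(t in `[c, d]) gam t.
  rewrite /Gam (@Rintegral_itvB _ _ (BLeft a) (BRight d) c) ?bnd_simp//.
    rewrite Rintegral_itv_obnd_cbnd//.
    by apply: integrableS igcd => //; apply: subset_itv; rewrite bnd_simp.
  by apply: integrableS igam => //; apply: subset_itv; rewrite bnd_simp.
have := sqr_norm_diff hd (y c) (y d) u; rewrite -intF => dE.
move: step; rewrite RintegralD// RintegralZl// Rintegral_cst//.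
rewrite -GamE (_ : fine _ = d - c); last by rewrite [X in fine X]lebesgue_itvE.
by rewrite /f; lra.
Qed.

(** The derivative is only locally integrable on (0, oo), hence the estimate
    from a > 0; a tends to 0 by continuity of y. *)
Lemma evolution_inequality : 0 < T ->
  `|y T - u| ^+ 2 - `|y 0 - u| ^+ 2 <= 2 * k * T.
Proof.
move=> T0; apply/ler_addgt0Pr => e e0.
pose K := 2 * `|y 0 - u| + 1; have K0 : 0 < K by have := normr_ge0 (y 0 - u); rewrite /K; lra.
have m0 : 0 < Num.min 1 (e / (2 * K)) by rewrite lt_min ltr01 divr_gt0// mulr_gt0.
have [dl dl0 hdl] := within_continuous_delta cy (lexx 0) m0.
(* The choices of K and L make the loss at time a, namely D (2 B + 1) + 2 |k|
   a in the notation below, at most e. *)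
pose L := 2 * (2 * `|k| + 1); have L0 : 0 < L by have := normr_ge0 k; rewrite /L; lra.
pose a := Num.min T (Num.min (dl / 2) (e / L)).
have a0 : 0 < a by rewrite !lt_min T0 !divr_gt0.
have aT : a <= T by rewrite ge_min lexx.
have adl : a < dl.
  apply: (@le_lt_trans _ _ (dl / 2)); first by rewrite !ge_min lexx orbT.
  by rewrite ltr_pdivrMr// ltr_pMr// ltr1n.
have aL : a * L <= e by rewrite -ler_pdivlMr// !ge_min lexx !orbT.
have := hdl a (ltW a0); rewrite sub0r normrN gtr0_norm// => /(_ adl).
rewrite lt_min => /andP[h1]; rewrite ltr_pdivlMr ?mulr_gt0// => h2.
have := evolution_inequality_pos a0 aT.
have : `|y a - u| <= `|y 0 - u| + `|y 0 - y a|.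
  rewrite (_ : y a - u = (y 0 - u) - (y 0 - y a)) ?ler_normB//.
  by rewrite opprB [RHS]addrC addrA subrK.
have ka : - (k * a) <= `|k| * a by rewrite -mulNr ler_pM2r// -normrN ler_norm.
move: (normr_ge0 (y a - u)) (normr_ge0 (y 0 - u)) (normr_ge0 (y 0 - y a)) h1 h2 aL.
rewrite /K /L; set A := `|y a - u|; set B := `|y 0 - u|; set D := `|y 0 - y a|.
set X := `|y T - u| ^+ 2; set k' := `|k|.
move=> A0 B0 D0 D1 hD hL AB hX; move: ka; rewrite -/k' => ka.
have : A ^+ 2 <= B ^+ 2 + D * (2 * B + 1).
  by apply: (@le_trans _ _ ((B + D) ^+ 2)); [rewrite ler_sqr ?nnegrE ?addr_ge0|nra].
by lra.
Qed.

End evolution_inequality.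

Lemma lte_add_split (R : realType) (A B : \bar R) (L : R) : (0 <= A)%E -> (0 <= B)%E -> (L%:E < A + B)%E ->
  exists c1 c2 : R, [/\ (c1%:E < A)%E, (c2%:E < B)%E & L < c1 + c2].
Proof.
case: A => [a| |] //; case: B => [b| |] //; rewrite ?lee_fin => a0 b0 h.
- move: h; rewrite -EFinD lte_fin => h.
  exists (a - (a + b - L) / 4), (b - (a + b - L) / 4).
  by split; rewrite ?lte_fin; lra.
- by exists (a - 1), (L - a + 2); rewrite lte_fin ltry; split => //; lra.
- by exists (L - b + 2), (b - 1); rewrite lte_fin ltry; split => //; lra.
- by exists (L + 1), 0; rewrite !ltry; split => //; lra.
Qed.

Section flow_comparison.
Context {R : realType} {H : normedModType R}.
Variable dot : H -> H -> R.
Hypothesis hd : is_dot dot.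

(** The subgradient inequality tested at u bounds the pairing in the evolution
    inequality by Phi u - Phi (S s x). By lower semicontinuity Phi (S s x) > c
    for small times. *)
Lemma flow_descent (Phi : H -> \bar R) (S : R -> H -> H) (u x : H) (f c : R) :
  lower_semicontinuous Phi -> generates dot Phi S ->
  Phi u = f%:E -> (c%:E < Phi x)%E ->
  exists2 dl, 0 < dl & forall T, 0 < T -> T < dl ->
    `|S T x - u| ^+ 2 - `|x - u| ^+ 2 <= 2 * (f - c) * T.
Proof.
move=> lsc gen Pu cx; have [S0 cS [g Sg sub]] := gen x.
have [U /nbhs_ballP[e e0 eU] Uc] := lsc x c cx.
have [dl dl0 hdl] := within_continuous_delta cS (lexx 0) e0.
exists dl => // T T0 Tdl.
have := @evolution_inequality _ _ dot hd (S^~ x) g u (f - c) T cS Sg _ T0.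
rewrite S0; apply; apply: (@filterS _ _ (@ae_filter_ringOfSetsType _ (measurableTypeR R) R (@lebesgue_measure R)) _ _ _ sub) => s /= + s0 sT; move=> /(_ s0)[] fin.
have cs : (c%:E < Phi (S s x))%E.
  apply: Uc; apply: eU; rewrite -ball_normE /= -[X in `|X - _|]S0.
  by apply: hdl; [exact: ltW | rewrite sub0r normrN gtr0_norm// (le_lt_trans sT)].
move=> /(_ (u - S s x)); rewrite (dotNl hd) -(dotNr hd) opprB [S s x + _]addrC subrK Pu.
move: fin cs; rewrite /edom/=.
case: (Phi (S s x)) => [r| |] // _; rewrite lte_fin -EFinB lee_fin => cr.
by move=> h; apply: le_trans h _; rewrite lerD2l lerN2 ltW.
Qed.

(** If Phi1 x1 + Phi2 x2 were larger than Phi1 u1 + Phi2 u2, both descent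
    estimates together would say that the pair of flows strictly approaches
    (u1, u2) for short times. *)
Lemma flow_comparison (Phi1 Phi2 : H -> \bar R) (S1 S2 : R -> H -> H)
    (u1 u2 x1 x2 : H) :
  (forall u, 0 <= Phi1 u)%E -> (forall u, 0 <= Phi2 u)%E ->
  lower_semicontinuous Phi1 -> lower_semicontinuous Phi2 ->
  generates dot Phi1 S1 -> generates dot Phi2 S2 ->
  (forall t, 0 <= t -> `|x1 - u1| ^+ 2 + `|x2 - u2| ^+ 2 <=
                       `|S1 t x1 - u1| ^+ 2 + `|S2 t x2 - u2| ^+ 2) ->
  (Phi1 x1 + Phi2 x2 <= Phi1 u1 + Phi2 u2)%E.
Proof.
move=> P1 P2 l1 l2 g1 g2 hS; rewrite leNgt; apply/negP => h.
have h' := lt_le_trans h (leey _).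
have [f1 f1E] : exists r, Phi1 u1 = r%:E.
  by move: (P1 u1) (P2 u2) h'; case: (Phi1 u1) => [r| |] //; [exists r | case: (Phi2 u2)].
have [f2 f2E] : exists r, Phi2 u2 = r%:E.
  by move: (P2 u2) h'; rewrite f1E; case: (Phi2 u2) => [r| |] //; exists r.
move: h; rewrite f1E f2E -EFinD => /(lte_add_split (P1 _) (P2 _))[c1 [c2 [c1x c2x cc]]].
have [d1 d10 h1] := flow_descent l1 g1 f1E c1x.
have [d2 d20 h2] := flow_descent l2 g2 f2E c2x.
pose T := Num.min d1 d2 / 2.
have m0 : 0 < Num.min d1 d2 by rewrite lt_min d10.
have T0 : 0 < T by rewrite divr_gt0.
have Tm : T < Num.min d1 d2 by rewrite ltr_pdivrMr// ltr_pMr// ltr1n.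
have := h1 T T0; have := h2 T T0; have := hS T (ltW T0).
move: Tm; rewrite lt_min => /andP[Td1 Td2] a /(_ Td2) b /(_ Td1) c.
have : (f1 - c1 + (f2 - c2)) * T < 0 by rewrite pmulr_llt0//; lra.
by lra.
Qed.

End flow_comparison.

(** * Functions in L^2 *)

Section L2_calculus.
Context d (T : measurableType d) (R : realType).
Variable mu : {measure set T -> \bar R}.
Implicit Types u v : L2 mu.

Lemma L2_eq u v : {ae mu, forall x, u x = v x} -> u = v.
Proof.
by move=> uv; rewrite -(reprK u) -(reprK v); apply/L2_classP.
Qed.

Lemma L2_addE u v : {ae mu, forall x, (u + v : L2 mu) x = u x + v x}.
Proof.
elim/L2_ind: u => f; elim/L2_ind: v => g; rewrite -L2_classD.
by apply: filterS3 (L2_funK f) (L2_funK g) (L2_funK (f + g)) => x -> -> ->.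
Qed.

Lemma L2_scaleE a u : {ae mu, forall x, (a *: u : L2 mu) x = a * u x}.
Proof.
elim/L2_ind: u => f; rewrite [a *: _]L2_scale_class.
by apply: filterS2 (L2_funK f) (L2_funK (a *: f)) => x -> ->.
Qed.

Lemma L2_oppE u : {ae mu, forall x, (- u : L2 mu) x = - u x}.
Proof. by rewrite -scaleN1r; apply: filterS (L2_scaleE (-1) u) => x ->; rewrite mulN1r. Qed.

Lemma L2_subE u v : {ae mu, forall x, (u - v : L2 mu) x = u x - v x}.
Proof. by apply: filterS2 (L2_addE u (- v)) (L2_oppE v) => x -> ->. Qed.

Lemma L2_zeroE : {ae mu, forall x, (0 : L2 mu) x = 0}.
Proof.
rewrite -(subrr (0 : L2 mu)); apply: filterS (L2_subE 0 0) => x ->.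
by rewrite subrr.
Qed.

Lemma L2_Lfun u : (u : T -> R) \in Lfun mu 2%:E.
Proof. exact: LfunP. Qed.

Lemma L2_measurable u : measurable_fun setT (u : T -> R).
Proof. exact: measurable_funPT. Qed.

Lemma L2_mul_integrable u v : mu.-integrable setT (EFin \o (fun x => u x * v x)).
Proof. by apply/Lfun1_integrable; apply: Lfun2_mul_Lfun1; exact: L2_Lfun. Qed.

Lemma L2_dot_ae u v (f : T -> R) : measurable_fun setT f ->
  {ae mu, forall x, u x * v x = f x} -> L2_dot mu u v = \int[mu]_x f x.
Proof.
move=> mf uvf; congr fine; apply: ae_eq_integral => //; try exact/measurable_EFinP.
  by apply/measurable_EFinP; apply: measurable_funM; exact: L2_measurable.
by apply: filterS uvf => x /= -> _.
Qed.

Lemma L2_is_dot : is_dot (L2_dot mu).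
Proof.
split.
- by move=> u v; congr fine; apply: eq_integral => x _; rewrite mulrC.
- move=> u v w; rewrite -RintegralD//; try exact: L2_mul_integrable.
  apply: L2_dot_ae.
    by apply: measurable_funD; apply: measurable_funM; exact: L2_measurable.
  by apply: filterS (L2_addE u v) => x ->; rewrite mulrDl.
- move=> a u v; rewrite -RintegralZl//; last exact: L2_mul_integrable.
  apply: L2_dot_ae.
    by do 2 apply: measurable_funM => //; exact: L2_measurable.
  by apply: filterS (L2_scaleE a u) => x ->; rewrite mulrA.
- by move=> u; rewrite L2_norm_dot.
Qed.

Lemma L2_sqr_norm_le (a b c e : L2 mu) :
  {ae mu, forall x, a x ^+ 2 + b x ^+ 2 <= c x ^+ 2 + e x ^+ 2} ->
  `|a| ^+ 2 + `|b| ^+ 2 <= `|c| ^+ 2 + `|e| ^+ 2.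
Proof.
move=> h; rewrite !L2_norm_dot -!RintegralD//; try exact: L2_mul_integrable.
apply: ae_le_Rintegral => //; try exact: (integrableD _ (L2_mul_integrable _ _) (L2_mul_integrable _ _)).
by apply: filterS h => x + _; rewrite !expr2.
Qed.

Lemma Lfun2_sqr (f : T -> R) : measurable_fun setT f ->
  (\int[mu]_x (f x ^+ 2)%:E < +oo)%E -> f \in Lfun mu 2%:E.
Proof.
move=> mf fi; rewrite inE; apply/andP; split; first exact: mem_set.
apply: mem_set; rewrite /finite_norm/=.
rewrite unlock; apply: poweR_lty; apply: le_lt_trans fi.
apply: lower_integral_le => x _ /=; first by rewrite lee_fin powR_ge0.
by rewrite powR_mulrn// real_normK ?num_real.
Qed.

Lemma Lfun2_le (f g : T -> R) : measurable_fun setT f -> g \in Lfun mu 2%:E ->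
  (forall x, `|f x| <= `|g x|) -> f \in Lfun mu 2%:E.
Proof.
move=> mf /Lfun2_integrable_sqr/integrableP[_ gi] fg; apply: Lfun2_sqr => //.
apply: le_lt_trans gi; apply: lower_integral_le => x _ /=; rewrite lee_fin ?sqr_ge0//.
by rewrite normrX -(real_normK (num_real (f x))) ler_sqr ?nnegrE.
Qed.

(** Total, with value 0 on functions that are not square integrable, so that
    classes can be formed without carrying a proof. *)
Definition L2_of (f : T -> R) : L2 mu :=
  if pselect (f \in Lfun mu 2%:E) is left Pf then
    L2_class (Lfun_Sub (lee1n 2) Pf) else 0.

Lemma L2_ofE f : f \in Lfun mu 2%:E -> {ae mu, forall x, L2_of f x = f x}.
Proof.
move=> Pf; rewrite /L2_of; case: pselect => // Qf.
exact: (L2_funK (Lfun_Sub (lee1n 2) Qf)).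
Qed.

Lemma L2_pos_part u : exists2 v : L2 mu,
  {ae mu, forall x, v x = Num.max (u x) 0} &
  {ae mu, forall x, (v - u : L2 mu) x = Num.max (- u x) 0}.
Proof.
have up : (fun x => Num.max (u x) 0) \in Lfun mu 2%:E.
  apply: (Lfun2_le _ (L2_Lfun u)).
    by apply: measurable_maxr => //; exact: L2_measurable.
  by move=> x; rewrite maxEge; case: ifP => // _; rewrite normr0.
exists (L2_of (fun x => Num.max (u x) 0)); first exact: L2_ofE.
apply: filterS2 (L2_subE (L2_of (fun x => Num.max (u x) 0)) u) (L2_ofE up) => x -> ->.
by have [h|h] := leP (u x) 0; have [h'|h'] := leP (- u x) 0; lra.
Qed.

End L2_calculus.

Section L2_finite_measure.
Context d (T : measurableType d) (R : realType).
Variable mu : {finite_measure set T -> \bar R}.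

Lemma bounded_Lfun2 (f : T -> R) (M : R) : measurable_fun setT f ->
  (forall x, `|f x| <= M) -> f \in Lfun mu 2%:E.
Proof.
move=> mf fM; apply: (Lfun2_le mf (Lfun_cst mu M 2)) => x.
by rewrite (le_trans (fM x))//= ler_norm.
Qed.

Lemma L2_norm_bounded (u : L2 mu) (M : R) :
  {ae mu, forall x, `|u x| <= M} -> `|u| ^+ 2 <= M ^+ 2 * fine (mu setT).
Proof.
move=> uM; rewrite L2_norm_dot -Rintegral_cst//; apply: ae_le_Rintegral => //.
- exact: L2_mul_integrable.
- apply: (@bounded_integrable _ _ _ _ _ _ `|M ^+ 2|) => //.
  by rewrite fin_num_fun_lty//; exact: fin_num_measure.
apply: filterS uM => x uM _; rewrite -expr2 -(real_normK (num_real (u x))).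
by rewrite ler_sqr ?nnegrE// (le_trans _ uM).
Qed.

End L2_finite_measure.

(** * Domination of semigroups and half steps *)

(** The point (u - w/2, v + w/2) is the projection of (u, v) on the cone of
    the pairs with a <= b. The signs e1 and e2 bring every case back to this
    one, since |a| <= e2 b implies e1 a <= e2 b. *)
Lemma half_step_pointwise (R : realType) (e1 e2 u v w a b : R) :
  e1 \in [:: 1; -1] -> e2 \in [:: 1; -1] ->
  w = Num.max (u - v) 0 -> `|a| <= e2 * b ->
  (- (e1 * (2^-1 * w))) ^+ 2 + (e2 * (2^-1 * w)) ^+ 2 <=
  (a - e1 * u) ^+ 2 + (b - e2 * v) ^+ 2.
Proof.
move=> he1 he2 -> h.
have sq e x y : e \in [:: 1; -1] -> (x - e * y) ^+ 2 = (e * x - y) ^+ 2 :> R.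
  by rewrite !inE => /orP[] /eqP ->; ring.
have sq1 e x : e \in [:: 1; -1] -> (e * x) ^+ 2 = x ^+ 2 :> R.
  by rewrite !inE => /orP[] /eqP ->; ring.
rewrite sqrrN (sq1 e1)// (sq1 e2)// (sq e1)// (sq e2)//.
have {h} : e1 * a <= e2 * b.
  apply: le_trans h; move: he1; rewrite !inE => /orP[] /eqP ->.
    by rewrite mul1r ler_norm.
  by rewrite mulN1r -normrN ler_norm.
move: (e1 * a) (e2 * b) => A B AB.
have [_|uv] := leP (u - v) 0.
  by rewrite mulr0 expr0n/= addr0 addr_ge0 ?sqr_ge0.
have -> : (A - u) ^+ 2 + (B - v) ^+ 2 =
  2^-1 * (u - v + (B - A)) ^+ 2 + 2^-1 * (A - u + (B - v)) ^+ 2 by field.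
have -> : (2^-1 * (u - v)) ^+ 2 + (2^-1 * (u - v)) ^+ 2 = 2^-1 * (u - v) ^+ 2 by field.
apply: ler_wpDr; first by rewrite mulr_ge0 ?sqr_ge0.
by rewrite ler_pM2l ?invr_gt0// ler_sqr ?nnegrE; lra.
Qed.

Section half_step.
Context d (T : measurableType d) (R : realType).
Variable mu : {measure set T -> \bar R}.

(** The projection satisfies |a| <= b because u and v are nonnegative.
    Domination keeps the flow in this set, so that the flow stays at least as
    far from (u, v) as the projection, and [flow_comparison] applies. *)
Lemma half_step (Phi1 Phi2 : L2 mu -> \bar R) (S1 S2 : R -> L2 mu -> L2 mu)
    (e1 e2 : R) (u v w : L2 mu) :
  (forall u, 0 <= Phi1 u)%E -> (forall u, 0 <= Phi2 u)%E ->
  lower_semicontinuous Phi1 -> lower_semicontinuous Phi2 ->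
  generates (L2_dot mu) Phi1 S1 -> generates (L2_dot mu) Phi2 S2 ->
  e1 \in [:: 1; -1] -> e2 \in [:: 1; -1] ->
  (forall t a b, 0 <= t -> L2_abs_le a b ->
     L2_abs_le (S1 t a) (e2 *: S2 t (e2 *: b))) ->
  {ae mu, forall x, 0 <= u x} -> {ae mu, forall x, 0 <= v x} ->
  {ae mu, forall x, w x = Num.max (u x - v x) 0} ->
  (Phi1 (e1 *: (u - 2^-1 *: w)) + Phi2 (e2 *: (v + 2^-1 *: w)) <=
   Phi1 (e1 *: u) + Phi2 (e2 *: v))%E.
Proof.
move=> P1 P2 l1 l2 g1 g2 he1 he2 dom u0 v0 wE.
apply: (flow_comparison (L2_is_dot mu) P1 P2 l1 l2 g1 g2) => t t0.
set x1 := e1 *: (u - 2^-1 *: w); set x2 := v + 2^-1 *: w.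
have dx : L2_abs_le x1 x2.
  near=> x.
  rewrite (near (L2_scaleE e1 (u - 2^-1 *: w)) x)// (near (L2_subE u (2^-1 *: w)) x)//.
  rewrite (near (L2_addE v (2^-1 *: w)) x)// (near (L2_scaleE 2^-1 w) x)//.
  rewrite (near wE x)// normrM (_ : `|e1| = 1); last first.
    by move: he1; rewrite !inE => /orP[] /eqP ->; rewrite ?normrN normr1.
  rewrite mul1r.
  have ux : 0 <= u x by near: x.
  have vx : 0 <= v x by near: x.
  by have [h|h] := leP (u x - v x) 0; rewrite ler_norml; apply/andP; split; lra.
apply: L2_sqr_norm_le; near=> x.
have -> : (x1 - e1 *: u : L2 mu) x = - (e1 * (2^-1 * w x)).
  rewrite (near (L2_subE x1 (e1 *: u)) x)// (near (L2_scaleE e1 (u - 2^-1 *: w)) x)//.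
  rewrite (near (L2_subE u (2^-1 *: w)) x)// (near (L2_scaleE 2^-1 w) x)//.
  by rewrite (near (L2_scaleE e1 u) x)//; ring.
have -> : (e2 *: x2 - e2 *: v : L2 mu) x = e2 * (2^-1 * w x).
  rewrite (near (L2_subE (e2 *: x2) (e2 *: v)) x)// (near (L2_scaleE e2 x2) x)//.
  rewrite (near (L2_addE v (2^-1 *: w)) x)// (near (L2_scaleE 2^-1 w) x)//.
  by rewrite (near (L2_scaleE e2 v) x)//; ring.
rewrite (near (L2_subE (S1 t x1) (e1 *: u)) x)// (near (L2_scaleE e1 u) x)//.
rewrite (near (L2_subE (S2 t (e2 *: x2)) (e2 *: v)) x)// (near (L2_scaleE e2 v) x)//.
apply: half_step_pointwise => //; first by rewrite (near wE x).
rewrite -(near (L2_scaleE e2 (S2 t (e2 *: x2))) x)//.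
by near: x; exact: dom.
Unshelve. all: by end_near. Qed.

End half_step.

(** * Barycentric coordinates and cells of the gasket *)

Lemma cvg_sumr {T : Type} {R : realType} {U : normedModType R} (F : set_system T)
    (I : Type) (r : seq I) (f : I -> T -> U) (l : I -> U) {FF : Filter F} :
  (forall i, f i x @[x --> F] --> l i) ->
  \sum_(i <- r) f i x @[x --> F] --> \sum_(i <- r) l i.
Proof.
move=> fl; elim: r => [|i r IH].
  by under eq_fun do rewrite big_nil; rewrite big_nil; exact: cvg_cst.
by under eq_fun do rewrite big_cons; rewrite big_cons; exact: cvgD.
Qed.

Section barycentric.
Context {R : realType} {N : nat}.
Local Notation E := 'rV[R]_N.-1.
Variable p : 'I_N -> E.

Definition inner (x y : E) : R := \sum_c x 0 c * y 0 c.

Lemma innerC x y : inner x y = inner y x.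
Proof. by apply: eq_bigr => c _; rewrite mulrC. Qed.
Lemma innerDl x y z : inner (x + y) z = inner x z + inner y z.
Proof. by rewrite -big_split; apply: eq_bigr => c _; rewrite !mxE mulrDl. Qed.
Lemma innerZl a x y : inner (a *: x) y = a * inner x y.
Proof. by rewrite mulr_sumr; apply: eq_bigr => c _; rewrite !mxE mulrA. Qed.
Lemma innerBl x y z : inner (x - y) z = inner x z - inner y z.
Proof. by rewrite innerDl -scaleN1r innerZl mulN1r. Qed.
Lemma innerBr x y z : inner x (y - z) = inner x y - inner x z.
Proof. by rewrite innerC innerBl !(innerC x). Qed.

(** The affine function with value 1 at p i and 0 at the other vertices,
    written with inner products: by polarization, <p_j - p_k, p_i - p_l> only
    depends on which indices agree, and the average over k and l of these
    affine functions is the i-th barycentric coordinate up to a factor and a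
    constant. *)
Definition bary (i : 'I_N) (x : E) : R :=
  N%:R^-1 + 2 / N%:R ^+ 2 * \sum_k \sum_l inner (x - p k) (p i - p l).

Hypothesis hN : (2 <= N)%N.
Hypothesis hp : forall i j, i != j -> euclidean_norm (p i - p j) = 1.

Let N0 : N%:R != 0 :> R.
Proof. by rewrite pnatr_eq0 -lt0n; case: N hN. Qed.

Let sqd i j : inner (p i - p j) (p i - p j) = (i != j)%:R.
Proof.
have [->|/hp h] := eqVneq i j.
  by rewrite subrr /inner big1// => c _; rewrite mxE mul0r.
have : euclidean_norm (p i - p j) ^+ 2 = 1 by rewrite h expr1n.
rewrite sqr_sqrtr; last by apply: sumr_ge0 => c _; exact: sqr_ge0.
by move=> <-; apply: eq_bigr => c _; rewrite expr2.
Qed.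

Let sum_neq (i : 'I_N) : \sum_(k < N) (i != k)%:R = N%:R - 1 :> R.
Proof.
rewrite (bigD1 i)//= eqxx add0r.
rewrite (eq_bigr (fun=> 1)); last by move=> k; rewrite eq_sym => ->.
by rewrite sumr_const cardC1 card_ord; case: N hN => // n _; rewrite -natr1 addrK.
Qed.

Let sum_cst (c : R) : \sum_(k < N) c = N%:R * c.
Proof. by rewrite sumr_const card_ord mulr_natl. Qed.

Lemma bary_point i j : bary i (p j) = (i == j)%:R.
Proof.
have polar k l : inner (p j - p k) (p i - p l) =
    2^-1 * ((j != l)%:R + (i != k)%:R - (i != j)%:R - (k != l)%:R).
  rewrite -(sqd j l) -(sqd i k) -(sqd i j) -(sqd k l) !innerBl !innerBr.
  rewrite (innerC (p l) (p j)) (innerC (p j) (p i)).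
  by rewrite (innerC (p l) (p k)) (innerC (p k) (p i)); field.
rewrite /bary.
have -> : \sum_k \sum_l inner (p j - p k) (p i - p l) =
    2^-1 * (N%:R * (N%:R - 1 - N%:R * (i != j)%:R)).
  have inn k : \sum_l inner (p j - p k) (p i - p l) =
      2^-1 * (N%:R * (i != k)%:R - N%:R * (i != j)%:R).
    under eq_bigr => l _ do rewrite polar.
    by rewrite -mulr_sumr !big_split/= !sumrN !sum_neq !sum_cst; congr (_ * _); ring.
  under eq_bigr => k _ do rewrite inn.
  rewrite -mulr_sumr !big_split/= sumrN -mulr_sumr sum_neq sum_cst.
  by congr (_ * _); ring.
by case: eqP => _ /=; field.
Qed.

Lemma bary_sum x : \sum_i bary i x = 1.
Proof.
rewrite big_split/= sum_cst mulfV// -mulr_sumr.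
rewrite exchange_big/= big1 ?mulr0 ?addr0// => k _.
rewrite exchange_big/=.
under eq_bigr => l _ do under eq_bigr => i _ do rewrite innerBr.
under eq_bigr => l _ do rewrite big_split/= sumrN sumr_const.
by rewrite big_split/= sumrN sumr_const sumrMnl subrr.
Qed.

Lemma bary_half i x y : bary i (2^-1 *: x + 2^-1 *: y) = 2^-1 * bary i x + 2^-1 * bary i y.
Proof.
rewrite /bary; set c := 2 / _.
rewrite !mulrDr addrACA -mulrDl (_ : 2^-1 + 2^-1 = 1) ?mul1r; last by field.
congr (_ + _); rewrite ![2^-1 * (c * _)]mulrCA -mulrDr; congr (_ * _).
rewrite !mulr_sumr -big_split; apply: eq_bigr => k _.
rewrite !mulr_sumr -big_split; apply: eq_bigr => l _ /=.
by rewrite !innerBl !innerDl !innerZl; field.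
Qed.

Lemma bary_half_map i j x : bary i (half_map p j x) = 2^-1 * bary i x + 2^-1 * (i == j)%:R.
Proof. by rewrite /half_map bary_half bary_point. Qed.

Lemma bary_cvg i {T : Type} (F : set_system T) {FF : Filter F} (f : T -> E) (x : E) :
  f @ F --> x -> bary i (f t) @[t --> F] --> bary i x.
Proof.
move=> fx; rewrite /bary; apply: cvgD; first exact: cvg_cst.
apply: cvgMr; apply: cvg_sumr => k; apply: cvg_sumr => l; apply: cvg_sumr => c.
apply: cvgMl; under eq_fun do rewrite mxE; rewrite mxE.
apply: cvgD; last exact: cvg_cst.
exact: (cvg_comp _ _ fx (@coord_continuous _ _ _ 0 c x)).
Qed.

End barycentric.

Section cells.
Context {R : realType} {N : nat} {p : 'I_N -> 'rV[R]_N.-1} {V : set 'rV[R]_N.-1}.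
Variable hV : is_gasket p V.
Local Notation G := (gasket_space hV).

Lemma gasket_cover z : V z <-> exists i, exists2 y, V y & half_map p i y = z.
Proof.
have [_ _ VE] := hV; split=> [Vz|[i [y Vy yz]]].
  have : (\bigcup_i (half_map p i @` V)) z by rewrite -VE.
  by move=> [i _ [y Vy yz]]; exists i, y.
by rewrite VE; exists i => //; exists y.
Qed.

Lemma cell_map_subproof (i : 'I_N) (x : G) : V (half_map p i (val x)).
Proof.
apply/gasket_cover; exists i, (val x) => //; exact: set_valP x.
Qed.

Definition cell_map (i : 'I_N) (x : G) : G :=
  exist _ (half_map p i (val x)) (mem_set (cell_map_subproof i x)).

Definition cell_word (w : seq 'I_N) (x : G) : G := foldr cell_map x w.

Lemma gasket_val_inj (x y : G) : val x = val y -> x = y.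
Proof. exact: val_inj. Qed.

Lemma cell_map_surj (x : G) : exists i y, x = cell_map i y.
Proof.
have /gasket_cover[i [y Vy yx]] := set_valP x.
by exists i, (exist _ y (mem_set Vy)); apply: gasket_val_inj.
Qed.

Lemma cell_word_surj m (x : G) : exists w y, size w = m /\ x = cell_word w y.
Proof.
elim: m x => [|m IH] x; first by exists [::], x.
have [i [y ->]] := cell_map_surj x; have [w [z [sw ->]]] := IH y.
by exists (i :: w), z; rewrite /= sw.
Qed.

Lemma gasket_bounded : exists2 M : R, 0 < M & forall x : G, `|val x| <= M.
Proof.
have [_ cV _] := hV; have /= [M [Mr h]] := compact_bounded cV.
exists (`|M| + 1); first by rewrite ltr_wpDl.
by move=> x; apply: h; [rewrite (le_lt_trans (ler_norm M))// ltrDl | exact: set_valP].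
Qed.

Lemma cell_word_dist w (x y : G) :
  `|val (cell_word w x) - val (cell_word w y)| = 2^-1 ^+ size w * `|val x - val y|.
Proof.
elim: w => [|i w IH]; first by rewrite expr0 mul1r.
rewrite /= /half_map opprD addrACA subrr addr0 -scalerBr normrZ IH.
by rewrite ger0_norm ?invr_ge0// exprS mulrA.
Qed.

Lemma cell_map_vertex i : cell_map i (vertex hV i) = vertex hV i.
Proof.
apply: gasket_val_inj; rewrite /= /half_map -scalerDl.
by rewrite -[2^-1]mul1r -splitr scale1r.
Qed.

Lemma cell_map_vertexC i j : cell_map i (vertex hV j) = cell_map j (vertex hV i).
Proof. by apply: gasket_val_inj; rewrite /= /half_map addrC. Qed.

Lemma cell_map_inj i : injective (cell_map i).
Proof.
move=> x y /(congr1 val) /= /addIr /(scalerI _) h; apply: gasket_val_inj; apply: h.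
by rewrite invr_neq0.
Qed.

Lemma cell_word_inj w : injective (cell_word w).
Proof. by elim: w => [|i w IH] x y //= /cell_map_inj /IH. Qed.

Lemma exp_half_small (K e : R) : 0 < e -> exists m, K * 2^-1 ^+ m < e.
Proof.
move=> e0; have : K * 2^-1 ^+ n @[n --> \oo] --> K * 0.
  by apply: cvgMr; apply: cvg_expr; rewrite gtr0_norm// invf_lt1// ltr1n.
rewrite mulr0 => /cvgrPdist_lt /(_ e e0)[m _ /(_ m (leqnn m))].
rewrite sub0r normrN => h; exists m; exact: le_lt_trans (ler_norm _) h.
Qed.

(** Self-similarity improves a lower bound: f >= - M on the gasket implies f
    >= - M / 2 on every cell of level 1, hence everywhere; iterate. *)
Lemma ge0_of_half_bound (f : G -> R) M : (forall x, - M <= f x) ->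
  (forall i x, 2^-1 * f x <= f (cell_map i x)) -> forall x, 0 <= f x.
Proof.
move=> fM fh x; rewrite leNgt; apply/negP => fx.
have bnd m y : - (M * 2^-1 ^+ m) <= f y.
  elim: m y => [|m IH] y; first by rewrite expr0 mulr1.
  have [i [z ->]] := cell_map_surj y; apply: le_trans (fh i z).
  by rewrite exprS mulrCA -mulrN ler_pM2l.
have [|m hm] := @exp_half_small M (- f x); first by rewrite oppr_gt0.
by have := bnd m x; lra.
Qed.

Lemma gasket_nbhsP (x : G) (U : set G) :
  nbhs x U <-> exists2 e : R, 0 < e & forall y : G, `|val x - val y| < e -> U y.
Proof.
split.
  move=> /nbhs_ballP[e /= e0 eU]; exists e => // y xy; apply: eU.
  have : ball (val x) e (val y) by rewrite -ball_normE.
  exact.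
move=> [e e0 eU]; apply/nbhs_ballP; exists e => //= y xy; apply: eU.
have : ball (val x) e (val y) by exact: xy.
by rewrite -ball_normE.
Qed.

(** The vertices of all cells are dense because cells shrink. Estimates proved
    at these vertices, being closed conditions, are propagated to all points
    in this way. *)
Lemma gasket_dense (A : set G) : closed A ->
  (forall w i, A (cell_word w (vertex hV i))) -> (0 < N)%N -> forall x, A x.
Proof.
move=> cA hA N0 x; apply: cA => U /gasket_nbhsP[e e0 eU].
have [M M0 hM] := gasket_bounded.
have [m hm] := @exp_half_small (M + M) e e0.
have [w [y [sw xE]]] := cell_word_surj m x.
exists (cell_word w (vertex hV (Ordinal N0))); split; first exact: hA.
apply: eU; rewrite xE cell_word_dist sw; apply: le_lt_trans hm.
by rewrite mulrC ler_pM2r ?exprn_gt0// (le_trans (ler_normB _ _))// lerD.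
Qed.

Lemma val_continuous : continuous (fun x : G => val x).
Proof.
move=> x U /nbhs_ballP[e /= e0 eU]; apply/gasket_nbhsP; exists e => // y xy.
by apply: eU; rewrite -ball_normE.
Qed.

Lemma gasket_bounded_fun (f : 'rV[R]_N.-1 -> R) : continuous f ->
  exists M : R, forall x : G, `|f (val x)| <= M.
Proof.
move=> cf; have [_ cV _] := hV.
have /compact_bounded[M [Mr h]] : compact (f @` V).
  by apply: continuous_compact => //; exact: continuous_subspaceT.
exists (`|M| + 1) => x; apply: h; first by rewrite (le_lt_trans (ler_norm M))// ltrDl.
by exists (val x) => //; exact: set_valP.
Qed.

Section bary.
Hypothesis hN : (2 <= N)%N.
Hypothesis hp : forall i j, i != j -> euclidean_norm (p i - p j) = 1.

Definition gasket_bary (i : 'I_N) (x : G) := bary p i (val x).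

Lemma gasket_bary_continuous i : continuous (gasket_bary i).
Proof.
move=> x; apply: (@bary_cvg R N p i G (nbhs x) _ (fun x => val x)).
exact: val_continuous.
Qed.

Lemma gasket_bary_cell i j x : gasket_bary i (cell_map j x) = 2^-1 * gasket_bary i x + 2^-1 * (i == j)%:R.
Proof. exact: bary_half_map. Qed.

Lemma gasket_bary_vertex i j : gasket_bary i (vertex hV j) = (i == j)%:R.
Proof. exact: bary_point. Qed.

Lemma gasket_bary_sum x : \sum_i gasket_bary i x = 1.
Proof. exact: bary_sum. Qed.

Lemma gasket_bary_ge0 i x : 0 <= gasket_bary i x.
Proof.
have [M hM] := @gasket_bounded_fun (bary p i) (fun x => @bary_cvg _ _ p i _ _ _ id x (fun U h => h)).
apply: (@ge0_of_half_bound (gasket_bary i) M) => [y|j y].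
  by have := hM y; rewrite ler_norml => /andP[].
by rewrite gasket_bary_cell lerDl mulr_ge0 ?invr_ge0 ?ler0n.
Qed.

Lemma gasket_bary_le1 i x : gasket_bary i x <= 1.
Proof. by rewrite -(gasket_bary_sum x) (bigD1 i)//= lerDl sumr_ge0// => j _; exact: gasket_bary_ge0. Qed.

(** Both sides agree up to a bounded function that is halved by every cell
    map, and a bounded function with this property vanishes by
    [ge0_of_half_bound] applied to it and to its opposite. *)
Lemma gasket_bary_val x : val x = \sum_k gasket_bary k x *: p k.
Proof.
have coord c : forall x : G, 0 <= (val x - \sum_k gasket_bary k x *: p k) 0 c /\
    0 <= - (val x - \sum_k gasket_bary k x *: p k) 0 c.
  pose q (x : G) := (val x - \sum_k gasket_bary k x *: p k) 0 c.
  have qh j y : q (cell_map j y) = 2^-1 * q y.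
    rewrite /q; have -> : \sum_k gasket_bary k (cell_map j y) *: p k =
      2^-1 *: (\sum_k gasket_bary k y *: p k) + 2^-1 *: p j.
      under eq_bigr do rewrite gasket_bary_cell scalerDl.
      rewrite big_split/= scaler_sumr; congr (_ + _).
        by apply: eq_bigr => k _; rewrite scalerA.
      rewrite (bigD1 j)//= eqxx mulr1 big1 ?addr0// => k /negPf ->.
      by rewrite mulr0 scale0r.
    by rewrite /= /half_map opprD addrACA subrr addr0 -scalerBr mxE.
  have [M M0 hM] := gasket_bounded.
  have qM y : `|q y| <= M + \sum_k `|p k|.
    apply: (@le_trans _ _ `|val y - \sum_k gasket_bary k y *: p k|).
      rewrite /q /Num.norm/= mx_normrE.
      exact: (le_trans _ (le_bigmax_cond _ (fun i => `|(val y - \sum_k gasket_bary k y *: p k) i.1 i.2|) (isT : xpredT (0, c)))).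
    apply: le_trans (ler_normB _ _) _; rewrite lerD//.
    apply: le_trans (ler_norm_sum _ _ _) _; apply: ler_sum => k _.
    by rewrite normrZ ger0_norm ?gasket_bary_ge0// ler_piMl// gasket_bary_le1.
  move=> y; split.
    apply: (@ge0_of_half_bound q (M + \sum_k `|p k|)) => [z|j z]; last by rewrite qh.
    by have := qM z; rewrite ler_norml => /andP[].
  apply: (@ge0_of_half_bound (fun z => - q z) (M + \sum_k `|p k|)) => [z|j z].
    by have := qM z; rewrite ler_norml lerN2 => /andP[].
  by rewrite qh mulrN.
apply/eqP; rewrite -subr_eq0; apply/eqP/rowP => c; rewrite [RHS]mxE.
by apply/eqP; rewrite eq_le -oppr_ge0; have [-> ->] := coord c x.
Qed.

Lemma gasket_bary_inj x y : (forall i, gasket_bary i x = gasket_bary i y) -> x = y.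
Proof.
by move=> xy; apply: gasket_val_inj; rewrite !gasket_bary_val; apply: eq_bigr => k _; rewrite xy.
Qed.

Lemma gasket_bary_eq1 i x : gasket_bary i x = 1 -> x = vertex hV i.
Proof.
move=> x1; apply: gasket_bary_inj => j; rewrite gasket_bary_vertex.
have [->//|ji] := eqVneq j i.
have := gasket_bary_sum x; rewrite (bigD1 i)//= x1 => /eqP.
rewrite -subr_eq0 addrAC subrr add0r psumr_eq0; last by move=> k _; exact: gasket_bary_ge0.
by move=> /allP/(_ j); rewrite mem_index_enum ji => /(_ isT) /eqP.
Qed.

Lemma vertex_inj : injective (vertex hV).
Proof.
move=> i j ij; have := gasket_bary_vertex i i; rewrite ij gasket_bary_vertex eqxx.
by case: eqP => // _ /eqP; rewrite eq_sym oner_eq0.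
Qed.

(** The k-th barycentric coordinate is at most 1/2 on the other cells of level
    1, and equals 1 only at the vertex k. *)
Lemma vertex_cell k i x : vertex hV k = cell_map i x -> i = k /\ x = vertex hV k.
Proof.
move=> /(congr1 (gasket_bary k)); rewrite gasket_bary_vertex eqxx gasket_bary_cell.
have [->|_] := eqVneq k i => h; last first.
  by exfalso; have := gasket_bary_le1 k x; move: h; rewrite mulr1n mulr0; lra.
by split => //; apply: gasket_bary_eq1; move: h; rewrite mulr1n; lra.
Qed.

Lemma vertex_cell_word k w x : vertex hV k = cell_word w x -> x = vertex hV k.
Proof. by elim: w => [|i w IH] //= /vertex_cell[_ /esym /IH]. Qed.

(** A common point of the cells i and j has i-th and j-th coordinates at least
    1/2, hence equal to 1/2. *)
Lemma cell_map_meet i j x y : i != j -> cell_map i x = cell_map j y ->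
  x = vertex hV j /\ y = vertex hV i.
Proof.
move=> ij xy; split; apply: gasket_bary_eq1.
  move: (congr1 (gasket_bary j) xy); rewrite !gasket_bary_cell eqxx eq_sym (negPf ij) mulr0n mulr1n.
  by have := gasket_bary_ge0 j y; have := gasket_bary_le1 j x; lra.
move: (congr1 (gasket_bary i) xy); rewrite !gasket_bary_cell eqxx (negPf ij) mulr0n mulr1n.
by have := gasket_bary_ge0 i x; have := gasket_bary_le1 i y; lra.
Qed.

Lemma cell_word_meet w w' x y : size w = size w' -> w != w' ->
  cell_word w x = cell_word w' y -> exists i, x = vertex hV i.
Proof.
elim: w w' => [|i w IH] [|j w']//= [sw]; rewrite eqseq_cons negb_and.
have [<- /= ww' /cell_map_inj|ij _] := eqVneq i j; first exact: IH.
by move=> /(cell_map_meet ij)[/esym /vertex_cell_word -> _]; exists j.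
Qed.

(** Two different cells of the same level share at most one point. Therefore a
    pair of distinct points determines the cell that contains it, and the
    energy can be summed cell by cell without counting a pair twice. *)
Lemma cell_word_meet2 w w' x1 x2 y1 y2 : size w = size w' -> w != w' ->
  cell_word w x1 = cell_word w' y1 -> cell_word w x2 = cell_word w' y2 -> x1 = x2.
Proof.
elim: w w' => [|i w IH] [|j w']//= [sw]; rewrite eqseq_cons negb_and.
have [<- /= ww' /cell_map_inj h1 /cell_map_inj h2|ij _] := eqVneq i j; first exact: IH sw ww' h1 h2.
move=> /(cell_map_meet ij)[h1 _] /(cell_map_meet ij)[h2 _].
by apply: (@cell_word_inj w); rewrite h1 h2.
Qed.

End bary.

End cells.

(** * Discrete energy forms *)

Lemma fsbig_setT_fin (R : Type) (idx : R) (op : Monoid.com_law idx) (T : finType)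
    (f : T -> R) :
  \big[op/idx]_(i \in [set: T]) f i = \big[op/idx]_i f i.
Proof.
rewrite (@fsbigTE _ _ _ _ [fset x in enum T]%fset); last first.
  by move=> i; rewrite !inE mem_enum.
apply: perm_big; apply: uniq_perm; rewrite ?fset_uniq ?index_enum_uniq// => i.
by rewrite mem_index_enum !inE mem_enum.
Qed.

Lemma big_tuple_cons (R : zmodType) (T : finType) m (F : m.+1.-tuple T -> R) :
  \sum_w F w = \sum_i \sum_(w : m.-tuple T) F [tuple of i :: w].
Proof.
rewrite pair_big/= (reindex (fun iw : T * m.-tuple T => [tuple of iw.1 :: iw.2]))//=.
exists (fun w => (thead w, [tuple of behead w])) => [[i w] _|w _] /=.
  by rewrite theadE; congr pair; apply: val_inj.
by rewrite [RHS]tuple_eta.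
Qed.

Section energy_forms.
Context {R : realType} {N : nat} {p : 'I_N -> 'rV[R]_N.-1} {V : set 'rV[R]_N.-1}.
Variable hV : is_gasket p V.
Local Notation G := (gasket_space hV).
Local Notation vtx := (vertex hV).

Definition rho : R := (N + 2)%:R / N%:R.

(** The energy forms are defined by self-similarity rather than as sums over
    pairs of points of level m, since every estimate is an induction that
    peels off one cell map. *)
Fixpoint eform (m : nat) (u v : G -> R) : R :=
  if m is m'.+1 then rho * \sum_i eform m' (u \o cell_map i) (v \o cell_map i)
  else 2^-1 * \sum_i \sum_j (u (vtx i) - u (vtx j)) * (v (vtx i) - v (vtx j)).

Lemma eformE m u v : eform m u v = 2^-1 * rho ^+ m * \sum_(w : m.-tuple 'I_N)
  \sum_i \sum_j (u (cell_word w (vtx i)) - u (cell_word w (vtx j))) *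
                (v (cell_word w (vtx i)) - v (cell_word w (vtx j))).
Proof.
elim: m u v => [|m IH] u v.
  rewrite expr0 mulr1 (big_pred1 [tuple])//.
  by move=> w; apply/esym/eqP; exact: tuple0.
rewrite big_tuple_cons /= exprS mulrCA -[RHS]mulrA; congr (_ * _).
rewrite mulr_sumr; apply: eq_bigr => i _; exact: IH.
Qed.

Hypothesis hN : (2 <= N)%N.
Hypothesis hp : forall i j, i != j -> euclidean_norm (p i - p j) = 1.

Lemma level_word m (x : G) : level p m (val x) ->
  exists (w : m.-tuple 'I_N) i, x = cell_word w (vtx i).
Proof.
elim: m x => [|m IH] x /=.
  by move=> [i _ ix]; exists [tuple], i; apply: gasket_val_inj.
move=> [i _ [y ly yx]].
have Vy : V y.
  elim: m {IH x yx} y ly => [|m IH] y /=.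
    by move=> [j _ <-]; exact: (gasket_vertex_subproof hV).
  move=> [j _ [z lz <-]]; apply/(gasket_cover hV); exists j, z => //; exact: IH.
have [w [k yE]] := IH (exist _ y (mem_set Vy)) ly.
exists [tuple of i :: w], k; apply: gasket_val_inj.
by rewrite /= -yE/=.
Qed.

Lemma word_level m (w : m.-tuple 'I_N) i : level p m (val (cell_word w (vtx i))).
Proof.
elim: m w => [|m IH] w; first by rewrite tuple0; exists i.
rewrite [w]tuple_eta /=; exists (thead w) => //.
by exists (val (cell_word [tuple of behead w] (vtx i))).
Qed.

Lemma cellP w (x : G) : cell p V w (val x) <-> exists y, x = cell_word w y.
Proof.
elim: w x => [|i w IH] x /=; first by split=> [_|_]; [exists x | exact: set_valP].
split=> [[y cy yx]|[y ->]]; last first.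
  by exists (val (cell_word w y)) => //; apply/IH; exists y.
have Vy : V y.
  elim: w {IH x yx} y cy => [|j w IH] y //= [z /IH Vz <-].
  by apply/(gasket_cover hV); exists j, z.
have [z yz] := (IH (exist _ y (mem_set Vy))).1 cy.
by exists z; apply: gasket_val_inj; rewrite /= -yz.
Qed.

(** The pairs of distinct points of V_m in a common cell are in bijection with
    the triples formed by a word and two different vertices: [cell_word_meet2]
    gives injectivity, and [cell_word_meet] shows that points of level m in a
    cell of level m are vertices of that cell. Diagonal pairs contribute 0 on
    both sides. *)
Lemma energy_levelE m u : energy_level m u = eform m u u.
Proof.
rewrite eformE /energy_level -/rho; congr (_ * _).
set A := [set xy | _].
pose A' := A `&` [set xy : G * G | xy.1 <> xy.2].
rewrite -(@fsbig_widen _ _ _ _ A' A); last 2 first.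
- exact: subIsetl.
- move=> [x y] [/= Axy] /not_andP[//|/= /contrapT ->].
  by rewrite subrr expr0n.
pose h (t : m.-tuple 'I_N * ('I_N * 'I_N)) :=
  (cell_word t.1 (vtx t.2.1), cell_word t.1 (vtx t.2.2)).
rewrite (@reindex_fsbig _ _ _ _ _ h [set t | t.2.1 <> t.2.2]); last first.
  split.
  - move=> [w [i j]] /= ij; split; last first.
      by move=> /= /cell_word_inj /(vertex_inj hN hp).
    split=> /=; [exact: word_level|exact: word_level|].
    by exists w; split; apply/cellP; eexists; reflexivity.
  - move=> [w [i j]] [w' [i' j']] /set_mem/= ij /set_mem/= ij' [h1 h2].
    have [ww'|ww'] := eqVneq w w'.
      move: h1 h2; rewrite ww' => /cell_word_inj /(vertex_inj hN hp) ->.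
      by move=> /cell_word_inj /(vertex_inj hN hp) ->.
    have sw : size w = size w' by rewrite !size_tuple.
    exfalso; apply: ij; apply: (@vertex_inj _ _ _ _ hV hN hp).
    exact: (@cell_word_meet2 _ _ _ _ hV hN hp w w' _ _ _ _ sw ww' h1 h2).
  - move=> [x y] [[/= lx ly [w [/cellP[x' xE] /cellP[y' yE]]]] xy].
    (* A point of level m that lies in the cell w is a vertex of it: either it is
       represented by w itself, or it lies in two different cells. *)
    have vert z z' : level p m (val z) -> z = cell_word w z' -> exists i, z' = vtx i.
      move=> /level_word[w' [i zE]] zE'; have [ww'|ww'] := eqVneq w w'.
        by exists i; move: zE; rewrite zE' -ww' => /cell_word_inj.
      apply: (@cell_word_meet _ _ _ _ hV hN hp w w' z' (vtx i)) => //.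
        by rewrite !size_tuple.
      by rewrite -zE' zE.
    have [i x'i] := vert x x' lx xE; have [j y'j] := vert y y' ly yE.
    exists (w, (i, j)); last by rewrite /h/= -x'i -y'j -xE -yE.
    by move=> /= ij; apply: xy; rewrite xE yE x'i y'j ij.
rewrite (@fsbig_widen _ _ _ _ _ setT); last 2 first.
- by [].
- by move=> [w [i j]] [/= _ /contrapT ->]; rewrite subrr expr0n.
rewrite fsbig_setT_fin.
rewrite -(pair_big xpredT xpredT (fun w ij => (u (h (w, ij)).1 - u (h (w, ij)).2) ^+ 2))/=.
apply: eq_bigr => w _.
rewrite -(pair_big xpredT xpredT (fun i j => (u (h (w, (i, j))).1 - u (h (w, (i,j))).2) ^+ 2))/=.
by apply: eq_bigr => i _; apply: eq_bigr => j _; rewrite expr2.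
Qed.

End energy_forms.

Section harmonic_extension.
Context {R : realType} {N : nat}.
Implicit Types (a x y : 'I_N -> R) (b : 'I_N -> 'I_N -> R).

Definition diff_form x y := \sum_i \sum_j (x i - x j) * (y i - y j).

Lemma diff_formE x y :
  diff_form x y = 2 * (N%:R * \sum_i x i * y i - (\sum_i x i) * (\sum_i y i)).
Proof.
have inn i : \sum_j (x i - x j) * (y i - y j) = N%:R * (x i * y i) - x i * (\sum_j y j)
    - (\sum_j x j) * y i + \sum_j x j * y j.
  under eq_bigr => j _ do rewrite mulrBl !mulrBr opprB addrA.
  rewrite !big_split/= sumrN sumr_const card_ord mulr_natl -mulr_sumr.
  by rewrite sumrN -mulr_suml; ring.
rewrite /diff_form; under eq_bigr => i _ do rewrite inn.
rewrite !big_split/= !sumrN -!mulr_sumr -!mulr_suml sumr_const card_ord.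
by rewrite -[X in _ + X]mulr_natl; ring.
Qed.

Let delta_sum (k : 'I_N) (f : 'I_N -> R) : \sum_i (k == i)%:R * f i = f k.
Proof.
rewrite (bigD1 k)//= eqxx mul1r big1 ?addr0// => i.
by rewrite eq_sym => /negPf ->; rewrite mul0r.
Qed.

Hypothesis hN : (2 <= N)%N.

(** The harmonic extension of the boundary values a: the value at the common
    point of the cells k and i. The Kronecker term restores the value a k when
    i = k. *)
Definition midpoint_ext a (k i : 'I_N) : R :=
  (a k + a i + \sum_l a l + (k == i)%:R * (N%:R * a k - \sum_l a l)) / (N + 2)%:R.

Let N20 : (N + 2)%:R != 0 :> R. Proof. by rewrite pnatr_eq0 addn2. Qed.
Let N0 : N%:R != 0 :> R. Proof. by rewrite pnatr_eq0 -lt0n; case: N hN. Qed.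
Let N2E : (N + 2)%:R = N%:R + 2 :> R. Proof. by rewrite natrD. Qed.

Lemma midpoint_extC a k i : midpoint_ext a k i = midpoint_ext a i k.
Proof. by rewrite /midpoint_ext (addrC (a i)) (eq_sym i); case: eqVneq => [->//|_]; rewrite !mul0r. Qed.

Lemma midpoint_ext_diag a k : midpoint_ext a k k = a k.
Proof. by rewrite /midpoint_ext eqxx mulr1n; move: N20; rewrite N2E => n0; field. Qed.

Lemma midpoint_ext_diff_form a k y : y k = a k -> diff_form (midpoint_ext a k) y =
  2 * N%:R / (N + 2)%:R * (\sum_i (a i - a k) * y i + (N%:R * a k - \sum_l a l) * a k).
Proof.
move=> yk; rewrite diff_formE.
have -> : \sum_i midpoint_ext a k i * y i = ((a k + \sum_l a l) * (\sum_i y i) +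
    \sum_i a i * y i + (N%:R * a k - \sum_l a l) * a k) / (N + 2)%:R.
  transitivity (\sum_i (((a k + \sum_l a l) * y i + a i * y i) / (N + 2)%:R +
      (k == i)%:R * ((N%:R * a k - \sum_l a l) * y i / (N + 2)%:R))).
    by apply: eq_bigr => i _; rewrite /midpoint_ext; ring.
  rewrite big_split/= delta_sum -mulr_suml big_split/= -mulr_sumr yk.
  by rewrite -mulrDl.
have -> : \sum_i midpoint_ext a k i = N%:R * (2 * a k + \sum_l a l) / (N + 2)%:R.
  rewrite /midpoint_ext -mulr_suml !big_split/= delta_sum !sumr_const card_ord.
  by rewrite -[a k *+ N]mulr_natl -[(\sum_l a l) *+ N]mulr_natl; congr (_ / _); ring.
have -> : \sum_i (a i - a k) * y i = \sum_i a i * y i - a k * \sum_i y i.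
  by rewrite mulr_sumr -sumrB; apply: eq_bigr => i _; rewrite mulrBl.
by move: N20; rewrite N2E => n0; field.
Qed.

(** Harmonicity: the energy paired with b is the same for all symmetric b with
    the boundary values a. The terms that involve the inner values of b cancel
    by symmetry. *)
Lemma midpoint_ext_energy a b : (forall i j, b i j = b j i) -> (forall i, b i i = a i) ->
  \sum_k diff_form (midpoint_ext a k) (b k) = N%:R / (N + 2)%:R * diff_form a a.
Proof.
move=> bC bd; under eq_bigr => k _ do rewrite midpoint_ext_diff_form//.
rewrite -mulr_sumr big_split/=.
have -> : \sum_k \sum_i (a i - a k) * b k i = 0.
  have E : \sum_k \sum_i a i * b k i = \sum_k \sum_i a k * b k i.
    rewrite exchange_big/=; apply: eq_bigr => k _.
    by apply: eq_bigr => i _; rewrite bC.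
  under eq_bigr => k _.
    under eq_bigr => i _ do rewrite mulrBl.
    rewrite big_split/= sumrN; over.
  by rewrite big_split/= sumrN E subrr.
rewrite add0r diff_formE.
have -> : \sum_k (N%:R * a k - \sum_l a l) * a k =
    N%:R * (\sum_i a i * a i) - (\sum_i a i) * (\sum_i a i).
  rewrite mulr_sumr [X in _ - X]mulr_suml -sumrB.
  by apply: eq_bigr => k _; ring.
by ring.
Qed.

(** Among all extensions, the harmonic one minimizes the energy: expand the
    square of b minus the harmonic extension and use that the cross term is
    known by [midpoint_ext_energy]. The factor (N + 2) / N is exactly the one
    for which the minimum equals the energy of a. *)
Lemma harmonic_minimum a b : (forall i j, b i j = b j i) -> (forall i, b i i = a i) ->
  diff_form a a <= (N + 2)%:R / N%:R * \sum_k diff_form (b k) (b k).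
Proof.
move=> bC bd.
have Npos : 0 < N%:R :> R by rewrite ltr0n; case: N hN.
have c0 : 0 < (N + 2)%:R / N%:R :> R by rewrite divr_gt0// ltr0n addn2.
rewrite -ler_pdivrMl// (_ : ((N + 2)%:R / N%:R)^-1 = N%:R / (N + 2)%:R); last first.
  by rewrite invf_div.
have h1 := midpoint_ext_energy bC bd.
have h2 := midpoint_ext_energy (midpoint_extC a) (midpoint_ext_diag a).
suff : \sum_k (2 * diff_form (midpoint_ext a k) (b k) - diff_form (midpoint_ext a k) (midpoint_ext a k)) <=
    \sum_k diff_form (b k) (b k).
  by rewrite sumrB -mulr_sumr h1 h2; lra.
apply: ler_sum => k _; rewrite -subr_ge0 /diff_form mulr_sumr -!sumrB.
apply: sumr_ge0 => i _; rewrite mulr_sumr -!sumrB; apply: sumr_ge0 => j _.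
set x := midpoint_ext a k i - midpoint_ext a k j; set y := b k i - b k j.
by rewrite (_ : _ - _ = (x - y) ^+ 2) ?sqr_ge0//; ring.
Qed.

End harmonic_extension.

Section energy_form_theory.
Context {R : realType} {N : nat} {p : 'I_N -> 'rV[R]_N.-1} {V : set 'rV[R]_N.-1}.
Variable hV : is_gasket p V.
Local Notation G := (gasket_space hV).
Local Notation vtx := (vertex hV).
Local Notation rho := (@rho R N).
Local Notation eform := (@eform R N p V hV).
Implicit Types u v w f g : G -> R.

Lemma eformC m u v : eform m u v = eform m v u.
Proof.
elim: m u v => [|m IH] u v /=; congr *%R; apply: eq_bigr => i _; last exact: IH.
by apply: eq_bigr => j _; rewrite mulrC.
Qed.

Lemma eformDl m u v w : eform m (fun x => u x + v x) w = eform m u w + eform m v w.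
Proof.
elim: m u v w => [|m IH] u v w /=; rewrite -mulrDr -big_split/=; congr *%R;
  apply: eq_bigr => i _; last exact: IH.
by rewrite -big_split; apply: eq_bigr => j _ /=; ring.
Qed.

Lemma eformZl m a u w : eform m (fun x => a * u x) w = a * eform m u w.
Proof.
elim: m u w => [|m IH] u w /=; rewrite mulrCA [a * _]mulr_sumr; congr *%R;
  apply: eq_bigr => i _; last exact: IH.
by rewrite mulr_sumr; apply: eq_bigr => j _ /=; ring.
Qed.

Lemma eformDr m u v w : eform m w (fun x => u x + v x) = eform m w u + eform m w v.
Proof. by rewrite eformC eformDl !(eformC _ w). Qed.

Lemma eformZr m a u w : eform m w (fun x => a * u x) = a * eform m w u.
Proof. by rewrite eformC eformZl !(eformC _ w). Qed.

Hypothesis hN : (2 <= N)%N.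

Lemma rho_gt1 : 1 < rho.
Proof.
rewrite /rho natrD mulrDl divff ?ltrDl ?divr_gt0// ?ltr0n ?pnatr_eq0 -?lt0n;
  by case: N hN.
Qed.

Lemma rho_gt0 : 0 < rho. Proof. exact: lt_trans rho_gt1. Qed.

Lemma eform_ge0 m u : 0 <= eform m u u.
Proof.
elim: m u => [|m IH] u /=.
  rewrite mulr_ge0 ?invr_ge0// sumr_ge0// => i _.
  by apply: sumr_ge0 => j _; rewrite -expr2 sqr_ge0.
by rewrite mulr_ge0 ?(ltW rho_gt0)// sumr_ge0.
Qed.

(** The Markov property: the form only sees increments. *)
Lemma eform_contraction m u v : (forall x y, `|u x - u y| <= `|v x - v y|) ->
  eform m u u <= eform m v v.
Proof.
elim: m u v => [|m IH] u v uv /=; (rewrite ler_pM2l; last by rewrite ?rho_gt0 ?invr_gt0);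
  apply: ler_sum => i _; last by apply: IH => x y; exact: uv.
apply: ler_sum => j _; rewrite -!expr2 -(real_normK (num_real (u _ - _))).
by rewrite -(real_normK (num_real (v _ - _))) ler_sqr ?nnegrE.
Qed.

Lemma eform_mono m u : eform m u u <= eform m.+1 u u.
Proof.
elim: m u => [|m IH] u; last first.
  by rewrite /= ler_pM2l ?rho_gt0//; apply: ler_sum => i _; exact: IH.
rewrite /= -mulr_sumr mulrCA ler_pM2l ?invr_gt0//.
have := @harmonic_minimum R N hN (fun i => u (vtx i)) (fun i j => u (cell_map i (vtx j))).
apply; first by move=> i j; rewrite cell_map_vertexC.
by move=> i; rewrite cell_map_vertex.
Qed.

Lemma eform_nondecreasing u : nondecreasing_seq (fun m => eform m u u).
Proof. by apply/nondecreasing_seqP => m; exact: eform_mono. Qed.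

(** Zooming into a cell reduces the energy by the factor rho > 1; this is the
    source of the geometric decay of oscillations. *)
Lemma eform_cell m u i : rho * eform m (u \o cell_map i) (u \o cell_map i) <= eform m.+1 u u.
Proof.
rewrite /= ler_pM2l ?rho_gt0// (bigD1 i)//= lerDl.
by apply: sumr_ge0 => j _; exact: eform_ge0.
Qed.

Lemma eform_vertices u i j : (u (vtx i) - u (vtx j)) ^+ 2 <= eform 0 u u.
Proof.
have [<-|ij] := eqVneq i j; first by rewrite subrr expr0n eform_ge0.
pose row k := \sum_l (u (vtx k) - u (vtx l)) * (u (vtx k) - u (vtx l)).
have pos k : 0 <= row k by apply: sumr_ge0 => l _; rewrite -expr2 sqr_ge0.
have one k l : (u (vtx k) - u (vtx l)) ^+ 2 <= row k.
  by rewrite /row (bigD1 l)//= expr2 lerDl sumr_ge0// => n _; rewrite -expr2 sqr_ge0.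
have -> : eform 0 u u = 2^-1 * \sum_k row k by [].
rewrite (bigD1 i)//= (bigD1 j)/=; last by rewrite eq_sym.
have rest : 0 <= \sum_(k | (k != i) && (k != j)) row k by apply: sumr_ge0.
have := one i j; have := one j i.
rewrite (_ : (u (vtx j) - u (vtx i)) ^+ 2 = (u (vtx i) - u (vtx j)) ^+ 2); last by ring.
by lra.
Qed.

(** Locality at level m: u and v need not have disjoint supports near the
    junctions, only every cell of level m must miss one of them. *)
Lemma eform_disjoint m u v :
  (forall w : seq 'I_N, size w = m -> (forall x, u (cell_word w x) = 0) \/ (forall x, v (cell_word w x) = 0)) ->
  eform m u v = 0.
Proof.
elim: m u v => [|m IH] u v h /=.
  rewrite big1 ?mulr0// => i _; rewrite big1// => j _.
  by have [h0|h0] := h [::] erefl; rewrite (h0 (vtx i)) (h0 (vtx j)); ring.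
rewrite big1 ?mulr0// => i _; apply: IH => w sw.
by apply: (h (i :: w)); rewrite /= sw.
Qed.

End energy_form_theory.

(** * Functions of finite energy *)

Lemma max0_dist (R : realType) (a b : R) :
  `|Num.max a 0 - Num.max b 0| <= `|a - b|.
Proof.
have h1 := ler_norm (a - b); have h2 := ler_norm (b - a); move: h2.
rewrite distrC ler_norml => h2.
by have [h3|h3] := leP a 0; have [h4|h4] := leP b 0; apply/andP; split; lra.
Qed.

Section finite_energy.
Context {R : realType} {N : nat} {p : 'I_N -> 'rV[R]_N.-1} {V : set 'rV[R]_N.-1}.
Variable hV : is_gasket p V.
Hypothesis hN : (2 <= N)%N.
Local Notation G := (gasket_space hV).
Local Notation vtx := (vertex hV).
Local Notation rho := (@rho R N).
Local Notation eform := (@eform R N p V hV).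
Implicit Types f g u v z : G -> R.

Definition H1 f := continuous f /\ exists C, forall m, eform m f f <= C.
(** Real valued, and meaningful when H1 f holds, so that it can be expanded as
    a quadratic form by ring manipulations. *)
Definition dirichlet f : R := limn (fun m => eform m f f).
Definition dform f g : R := limn (fun m => eform m f g).

Lemma dirichlet_cvg f : H1 f -> eform m f f @[m --> \oo] --> dirichlet f.
Proof.
move=> [_ [C hC]]; apply: (cvgP (sup (range (fun m => eform m f f)))).
apply: nondecreasing_cvgn; first exact: eform_nondecreasing.
by exists C => _ [m _ <-].
Qed.

Lemma eform_le_dirichlet f m : H1 f -> eform m f f <= dirichlet f.
Proof.
move=> h; apply: (nondecreasing_cvgn_le (eform_nondecreasing hN f) (cvgP _ (dirichlet_cvg h))).
Qed.

Lemma dirichlet_le f C : continuous f -> (forall m, eform m f f <= C) -> H1 f /\ dirichlet f <= C.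
Proof.
move=> cf hC; have h : H1 f by split => //; exists C.
by split => //; apply: (limr_le (cvgP _ (dirichlet_cvg h))); apply: nearW.
Qed.

Lemma dirichlet_ge0 f : H1 f -> 0 <= dirichlet f.
Proof. by move=> h; apply: le_trans (eform_le_dirichlet 0 h); exact: eform_ge0. Qed.

Lemma eform_add m f g : eform m (fun x => f x + g x) (fun x => f x + g x) =
  eform m f f + 2 * eform m f g + eform m g g.
Proof. by rewrite eformDl !eformDr (eformC _ g f); ring. Qed.

Lemma H1D f g : H1 f -> H1 g -> H1 (fun x => f x + g x).
Proof.
move=> [cf [C hC]] [cg [D hD]]; split; first by move=> x; exact: (cvgD (cf x) (cg x)).
exists (2 * C + 2 * D) => m.
have := eform_ge0 hN m (fun x => f x + (-1) * g x).
rewrite (eform_add m f (fun x => -1 * g x)) eform_add eformZr eformZr eformZl.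
by have := hC m; have := hD m; lra.
Qed.

Lemma H1Z a f : H1 f -> H1 (fun x => a * f x).
Proof.
move=> [cf [C hC]]; split; first by move=> x; exact: (cvgMr (cf x)).
exists (a ^+ 2 * C) => m; rewrite eformZl eformZr mulrA -expr2.
by rewrite ler_wpM2l// sqr_ge0.
Qed.

Lemma H1_ext f g : f =1 g -> H1 f -> H1 g. Proof. by move=> /funext ->. Qed.

Lemma H1B f g : H1 f -> H1 g -> H1 (fun x => f x - g x).
Proof.
move=> hf hg; apply: H1_ext (H1D hf (H1Z (-1) hg)) => x.
by rewrite mulN1r.
Qed.

(** Normal contractions operate: truncations stay in H1 and do not increase
    the energy. *)
Lemma H1_contraction f g : H1 f -> continuous g ->
  (forall x y, `|g x - g y| <= `|f x - f y|) -> H1 g /\ dirichlet g <= dirichlet f.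
Proof.
move=> hf cg gf; apply: dirichlet_le => // m.
by apply: le_trans (eform_le_dirichlet m hf); exact: eform_contraction.
Qed.

Lemma H1_cst c : H1 (fun=> c) /\ dirichlet (fun=> c) = 0.
Proof.
have [|h h0] := @dirichlet_le (fun=> c) 0 (@cst_continuous _ _ c).
  move=> m; rewrite (_ : eform m _ _ = eform m (fun x => 0 * c) (fun x => 0 * c)).
    by rewrite eformZl mul0r.
  apply: le_anti; rewrite !eform_contraction// => x y; rewrite !subrr//.
by split => //; apply/eqP; rewrite eq_le h0 dirichlet_ge0.
Qed.

Lemma H1_pos f : H1 f -> H1 (fun x => Num.max (f x) 0) /\ dirichlet (fun x => Num.max (f x) 0) <= dirichlet f.
Proof.
move=> hf; apply: H1_contraction => //.
  move=> x; apply: (@continuous_max _ _ f (fun=> 0)); [exact: hf.1|exact: cst_continuous].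
by move=> x y; exact: max0_dist.
Qed.

Lemma dform_cvg f g : H1 f -> H1 g -> eform m f g @[m --> \oo] --> dform f g.
Proof.
move=> hf hg; apply: (cvgP (2^-1 * (dirichlet (fun x => f x + g x) - dirichlet f - dirichlet g))).
have -> : (fun m => eform m f g) = (fun m => 2^-1 *
    (eform m (fun x => f x + g x) (fun x => f x + g x) - eform m f f - eform m g g)).
  by apply/funext => m; rewrite eform_add; field.
apply: cvgMr; apply: cvgB; last exact: dirichlet_cvg.
by apply: cvgB; apply: dirichlet_cvg => //; exact: H1D.
Qed.

Lemma dformC f g : dform f g = dform g f.
Proof. by rewrite /dform; congr (limn _); apply/funext => m; exact: eformC. Qed.

Lemma dformDl f g u : H1 f -> H1 g -> H1 u -> dform (fun x => f x + g x) u = dform f u + dform g u.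
Proof.
move=> hf hg hu; apply/cvg_lim => //; under eq_fun do rewrite eformDl.
by apply: cvgD; exact: dform_cvg.
Qed.

Lemma dformZl a f u : H1 f -> H1 u -> dform (fun x => a * f x) u = a * dform f u.
Proof.
move=> hf hu; apply/cvg_lim => //; under eq_fun do rewrite eformZl.
by apply: cvgMr; exact: dform_cvg.
Qed.

Lemma dirichletD f g : H1 f -> H1 g -> dirichlet (fun x => f x + g x) = dirichlet f + 2 * dform f g + dirichlet g.
Proof.
move=> hf hg; apply/cvg_lim => //; under eq_fun do rewrite eform_add.
apply: cvgD; last exact: dirichlet_cvg.
by apply: cvgD; [exact: dirichlet_cvg | apply: cvgMr; exact: dform_cvg].
Qed.

Lemma dirichletZ a f : H1 f -> dirichlet (fun x => a * f x) = a ^+ 2 * dirichlet f.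
Proof.
move=> hf; apply/cvg_lim => //; under eq_fun do rewrite eformZl eformZr mulrA -expr2.
by apply: cvgMr; exact: dirichlet_cvg.
Qed.

Lemma dirichletDZ a f g : H1 f -> H1 g ->
  dirichlet (fun x => f x + a * g x) = dirichlet f + 2 * a * dform f g + a ^+ 2 * dirichlet g.
Proof.
move=> hf hg; rewrite (dirichletD hf (H1Z a hg)) dirichletZ// dformC dformZl// (dformC g).
by rewrite mulrA.
Qed.

Lemma dform_cauchy_schwarz f g : H1 f -> H1 g -> dform f g ^+ 2 <= dirichlet f * dirichlet g.
Proof.
move=> hf hg.
have W0 : 0 <= dirichlet g by exact: dirichlet_ge0.
have h a : 0 <= dirichlet f + 2 * a * dform f g + a ^+ 2 * dirichlet g.
  by rewrite -dirichletDZ//; apply: dirichlet_ge0; apply: H1D => //; exact: H1Z.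
have [g0|g0] := eqVneq (dirichlet g) 0.
  have [->|E0] := eqVneq (dform f g) 0; first by rewrite g0 mulr0 expr0n.
  have := h (- (dirichlet f + 1) / (2 * dform f g)); rewrite g0 mulr0 addr0.
  rewrite (_ : 2 * _ * _ = - (dirichlet f + 1)); first by lra.
  by field; rewrite E0.
have gp : 0 < dirichlet g by rewrite lt_def g0.
have := h (- dform f g / dirichlet g).
rewrite (_ : _ + _ = (dirichlet f * dirichlet g - dform f g ^+ 2) / dirichlet g); last by field.
by rewrite pmulr_lge0 ?invr_gt0// subr_ge0.
Qed.

Lemma eform_pointwise m (F : nat -> G -> R) f : (forall x, F n x @[n --> \oo] --> f x) ->
  eform m (F n) (F n) @[n --> \oo] --> eform m f f.
Proof.
elim: m F f => [|m IH] F f Ff /=; apply: cvgMr; apply: cvg_sumr => i; last by apply: IH => x; exact: Ff.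
by apply: cvg_sumr => j; apply: cvgM; apply: cvgB; exact: Ff.
Qed.

(** At each level the energy involves finitely many points, so bounds on it
    pass to pointwise limits; taking the supremum over the levels, the energy
    is lower semicontinuous for pointwise convergence. *)
Lemma eform_pointwise_le m (F : nat -> G -> R) f C : (forall x, F n x @[n --> \oo] --> f x) ->
  (forall n, eform m (F n) (F n) <= C) -> eform m f f <= C.
Proof.
move=> Ff hC; apply: (cvgr_to_le (@eform_pointwise m F f Ff)).
exact: nearW.
Qed.

End finite_energy.

(** * Oscillation on cells and strong locality *)

Section oscillation.
Context {R : realType} {N : nat} {p : 'I_N -> 'rV[R]_N.-1} {V : set 'rV[R]_N.-1}.
Variable hV : is_gasket p V.
Hypothesis hN : (2 <= N)%N.
Local Notation G := (gasket_space hV).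
Local Notation vtx := (vertex hV).
Local Notation rho := (@rho R N).
Local Notation eform := (@eform R N p V hV).
Implicit Types f g u v z : G -> R.

(** Restricting to a subcell multiplies the energy by at most 1 / rho, hence
    the oscillation, which is controlled by the square root of the energy, by
    the square root of it. *)
Definition decay : R := Num.sqrt (rho^-1).

Lemma decay_sqr : decay ^+ 2 = rho^-1.
Proof. by rewrite sqr_sqrtr// invr_ge0 ltW// rho_gt0. Qed.

Lemma decay_ge0 : 0 <= decay. Proof. exact: sqrtr_ge0. Qed.

Lemma decay_lt1 : decay < 1.
Proof. by rewrite -(@expr_lt1 _ 2)// ?decay_ge0// decay_sqr invf_lt1 ?rho_gt1 ?rho_gt0. Qed.

Lemma eform_subcell u c i : (forall m, eform m u u <= c ^+ 2) ->
  forall m, eform m (u \o cell_map i) (u \o cell_map i) <= (decay * c) ^+ 2.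
Proof.
move=> h m; rewrite exprMn decay_sqr ler_pdivlMl ?rho_gt0//.
by apply: le_trans (h m.+1); exact: eform_cell.
Qed.

(** Walk from a vertex of the whole gasket to a vertex of the cell w through
    the vertices of the intermediate cells: the successive increments are at
    most c, decay c, decay^2 c, and so on, and the geometric series sums to c
    / (1 - decay). *)
Lemma oscillation_word w u c i k : 0 <= c -> (forall m, eform m u u <= c ^+ 2) ->
  `|u (cell_word w (vtx k)) - u (vtx i)| <= c / (1 - decay).
Proof.
have r1 : 0 < 1 - decay by rewrite subr_gt0 decay_lt1.
elim: w u c i => [|j w IH] u c i c0 hc.
  have : `|u (vtx k) - u (vtx i)| <= c.
    rewrite -ler_sqr ?nnegrE// real_normK ?num_real//.
    by apply: le_trans (hc 0%N); exact: eform_vertices.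
  move=> /le_trans; apply; rewrite ler_pdivlMr// ler_piMr// lerBlDr lerDl.
  exact: decay_ge0.
have h1 : `|u (vtx j) - u (vtx i)| <= c.
  rewrite -ler_sqr ?nnegrE// real_normK ?num_real//.
  by apply: le_trans (hc 0%N); exact: eform_vertices.
have := IH (u \o cell_map j) (decay * c) j (mulr_ge0 decay_ge0 c0) (eform_subcell j hc).
rewrite /= cell_map_vertex => h2.
have -> : u (cell_map j (cell_word w (vtx k))) - u (vtx i) =
  (u (cell_map j (cell_word w (vtx k))) - u (vtx j)) + (u (vtx j) - u (vtx i)).
  by rewrite addrA subrK.
apply: le_trans (ler_normD _ _) _; apply: le_trans (lerD h2 h1) _.
by rewrite le_eqVlt; apply/orP; left; apply/eqP; field; rewrite gt_eqF.
Qed.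

Lemma oscillation_vertex u c i x : continuous u -> 0 <= c ->
  (forall m, eform m u u <= c ^+ 2) -> `|u x - u (vtx i)| <= c / (1 - decay).
Proof.
move=> cu c0 hc.
have cl : closed [set x : G | `|u x - u (vtx i)| <= c / (1 - decay)].
  have cn : continuous (fun x : G => `|u x - u (vtx i)|).
    by move=> y; exact: (cvg_norm (cvgB (cu y) (@cst_continuous _ _ (u (vtx i)) y))).
  exact: (@closed_comp _ _ _ [set r | r <= c / (1 - decay)] (fun y _ => cn y) (@closed_le _ _)).
apply: (gasket_dense cl _ _ x); last by case: N hN.
by move=> w k /=; exact: oscillation_word.
Qed.

Lemma continuous_cell_word w : continuous (@cell_word R N p V hV w).
Proof.
move=> x U /gasket_nbhsP[e e0 eU]; apply/gasket_nbhsP; exists e => // y xy.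
apply: eU; rewrite cell_word_dist; apply: le_lt_trans xy.
by rewrite ler_piMl// exprn_ile1 ?invr_ge0// invf_le1// ler1n.
Qed.

Lemma eform_subword w u c : (forall m, eform m u u <= c ^+ 2) ->
  forall m, eform m (u \o cell_word w) (u \o cell_word w) <= (decay ^+ size w * c) ^+ 2.
Proof.
elim: w u c => [|i w IH] u c hc m; first by rewrite expr0 mul1r; exact: hc.
by have := IH _ _ (eform_subcell i hc) m; rewrite mulrA -exprSr.
Qed.

(** The energy of u on the cell w is smaller by decay^2 per letter, so its
    oscillation there is at most a constant times decay^|w|. *)
Lemma oscillation_cell w u c x y : continuous u -> 0 <= c ->
  (forall m, eform m u u <= c ^+ 2) ->
  `|u (cell_word w x) - u (cell_word w y)| <= 2 * (decay ^+ size w * c / (1 - decay)).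
Proof.
move=> cu c0 hc; have N0 : (0 < N)%N by case: N hN.
have cuw : continuous (u \o cell_word w).
  by move=> z; apply: continuous_comp; [exact: continuous_cell_word | exact: cu].
have c1 : 0 <= decay ^+ size w * c by rewrite mulr_ge0// exprn_ge0// decay_ge0.
have h (z : G) := oscillation_vertex (Ordinal N0) z cuw c1 (eform_subword w hc).
have := h y; rewrite distrC => hy; have hx := h x.
rewrite mulr_natl mulr2n; apply: le_trans (lerD hx hy).
apply: le_trans (ler_normD _ _); rewrite /= addrA subrK//.
Qed.

Lemma decay_small K e : 0 < e -> exists m, 2 * (decay ^+ m * K) < e.
Proof.
move=> e0; have : 2 * (decay ^+ n * K) @[n --> \oo] --> 2 * (0 * K).
  by apply: cvgMr; apply: cvgMl; apply: cvg_expr; rewrite ger0_norm ?decay_ge0// decay_lt1.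
rewrite mul0r mulr0 => /cvgrPdist_lt /(_ e e0)[m _ /(_ m (leqnn m))].
rewrite sub0r normrN => h; exists m; exact: le_lt_trans (ler_norm _) h.
Qed.

Lemma H1_oscillation f : H1 f -> exists2 c, 0 <= c & forall m, eform m f f <= c ^+ 2.
Proof.
move=> hf; exists (Num.sqrt (dirichlet f)); first exact: sqrtr_ge0.
by move=> m; rewrite sqr_sqrtr ?dirichlet_ge0//; exact: eform_le_dirichlet.
Qed.

Lemma H1_bounded f : H1 f -> exists M, forall x, `|f x| <= M.
Proof.
move=> hf; have [c c0 hc] := H1_oscillation hf; have N0 : (0 < N)%N by case: N hN.
pose o := Ordinal N0.
exists (c / (1 - decay) + `|f (vtx o)|) => x.
rewrite -[f x](subrK (f (vtx o))); apply: le_trans (ler_normD _ _) _.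
by rewrite lerD2r; exact: oscillation_vertex hf.1 c0 hc.
Qed.

Lemma cut_cvg (a : R) : 0 <= a ->
  Num.max (a - n.+1%:R^-1) 0 @[n --> \oo] --> a.
Proof.
move=> a0; apply/cvgrPdist_lt => e e0.
have /cvgrPdist_lt/(_ e e0) := @cvg_harmonic R.
apply: filterS => n; rewrite sub0r normrN ger0_norm ?harmonic_ge0//= => h.
have h' : n.+1%:R^-1 < e by exact: h.
move: h' => {}h.
have e1 : 0 < n.+1%:R^-1 :> R by rewrite invr_gt0 ltr0n.
move: e1 h; move: (n.+1%:R^-1) => q e1 h.
by rewrite ltr_distl; have [h3|h3] := leP (a - q) 0; apply/andP; split; lra.
Qed.

Lemma H1_cut f e : H1 f -> H1 (fun x => Num.max (f x - e) 0) /\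
  dirichlet (fun x => Num.max (f x - e) 0) <= dirichlet f.
Proof.
move=> hf; have [he We] := H1_cst hV hN e.
have hfe := H1B hN hf he; have [h1 h2] := H1_pos hN hfe.
apply: H1_contraction => //; first exact: h1.1.
move=> x y; apply: le_trans (max0_dist _ _) _.
by rewrite opprB addrA subrK.
Qed.

(** The cut function f_n = (f - n)^+ is positive only where f > n, so on cells
    so small that f oscillates by less than n, either f_n or g vanishes
    identically, and the mixed term disappears at fine levels. Then let n tend
    to 0, using lower semicontinuity. *)
Lemma local_bound (f g : G -> R) s : H1 f -> H1 g -> (forall x, 0 <= f x) ->
  (forall x, 0 < f x -> g x = 0) ->
  dirichlet f + 2 * s * dform f g + s ^+ 2 * dirichlet g <= dirichlet f + s ^+ 2 * dirichlet g.
Proof.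
move=> hf hg f0 fg.
have [c c0 hc] := H1_oscillation hf.
pose fe (q : R) x := Num.max (f x - q) 0.
have hfe n : H1 (fe n) by have [] := H1_cut n hf.
have sum_bnd n m : 0 < n -> eform m (fun x => fe n x + s * g x) (fun x => fe n x + s * g x) <=
    dirichlet f + s ^+ 2 * dirichlet g.
  move=> e0.
  have [m0 hm0] := decay_small (c / (1 - decay)) e0.
  have z k : (m0 <= k)%N -> eform k (fe n) g = 0.
    move=> mk; apply: eform_disjoint => w sw.
    have [[x fx]|nx] := pselect (exists x, n < f (cell_word w x)); last first.
      left=> x; rewrite /fe max_r// subr_le0 leNgt; apply/negP => h.
      by apply: nx; exists x.
    right=> y; apply: fg.
    have := oscillation_cell w x y hf.1 c0 hc; rewrite sw => osc.
    have : 2 * (decay ^+ k * c / (1 - decay)) < n.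
      apply: le_lt_trans hm0; rewrite ler_pM2l// mulrA ler_wpM2r//.
        by rewrite invr_ge0 subr_ge0 ltW// decay_lt1.
      rewrite ler_wpM2r//; apply: ler_wiXn2l => //; [exact: decay_ge0|].
      exact: ltW decay_lt1.
    by have := ler_norm (f (cell_word w x) - f (cell_word w y)); lra.
  apply: (@le_trans _ _ (eform (maxn m0 m) (fun x => fe n x + s * g x) (fun x => fe n x + s * g x))).
    exact: (eform_nondecreasing hN _ (leq_maxr m0 m)).
  rewrite eform_add !eformZr eformZl z ?leq_maxl//.
  have := eform_le_dirichlet hN (maxn m0 m) (hfe n); have [_] := H1_cut n hf.
  have := eform_le_dirichlet hN (maxn m0 m) hg.
  have s0 := sqr_ge0 s; move=> h1 h2 h3.
  have : s ^+ 2 * eform (maxn m0 m) g g <= s ^+ 2 * dirichlet g by rewrite ler_wpM2l.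
  move: h2 h3; rewrite -/(fe n) => h2 h3.
  by rewrite expr2 -mulrA; lra.
rewrite -dirichletDZ//.
have hfg : H1 (fun x => f x + s * g x) by apply: H1D => //; exact: H1Z.
apply: (dirichlet_le hN hfg.1 _).2 => m.
apply: (@eform_pointwise_le _ _ _ _ hV m (fun n x => fe n.+1%:R^-1 x + s * g x)) => [x|n].
  by apply: cvgD; [exact: cut_cvg | exact: cvg_cst].
by apply: sum_bnd; rewrite invr_gt0 ltr0n.
Qed.

(** The bound [local_bound] has the same right-hand side for s = 1 and s = -1,
    which forces the mixed term to vanish. *)
Lemma dform_local (f g : G -> R) : H1 f -> H1 g -> (forall x, 0 <= f x) ->
  (forall x, 0 < f x -> g x = 0) -> dform f g = 0.
Proof.
move=> hf hg f0 fg; have := local_bound 1 hf hg f0 fg; have := local_bound (-1) hf hg f0 fg.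
by move=> h1 h2; apply/eqP; rewrite eq_le; apply/andP; split; lra.
Qed.

Lemma dform_cst f c : H1 f -> dform f (fun=> c) = 0.
Proof.
move=> hf; have [hc Wc] := H1_cst hV hN c.
have := dform_cauchy_schwarz hN hf hc; rewrite Wc mulr0 => h.
by apply/eqP; rewrite -sqrf_eq0 eq_le h sqr_ge0.
Qed.

Lemma dform_pos f : H1 f -> dform f (fun x => Num.max (f x) 0) = dirichlet (fun x => Num.max (f x) 0).
Proof.
move=> hf; have [hp _] := H1_pos hN hf.
have [hm _] := H1_pos hN (H1Z (-1) hf).
have E x : f x = Num.max (f x) 0 + -1 * Num.max (-1 * f x) 0.
  by have [h1|h1] := leP (f x) 0; have [h2|h2] := leP (-1 * f x) 0; lra.
rewrite {1}(_ : f = fun x => Num.max (f x) 0 + -1 * Num.max (-1 * f x) 0); last exact/funext.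
rewrite dformDl//; last exact: H1Z.
have E0 : dform (fun x => Num.max (f x) 0) (fun x => Num.max (-1 * f x) 0) = 0.
  apply: dform_local => // x; first by rewrite le_max lexx orbT.
  by have [h1|h1] := leP (f x) 0; have [h2|h2] := leP (-1 * f x) 0 => h3 //; lra.
by rewrite dformZl// (dformC (fun x => Num.max (-1 * f x) 0)) E0 mulr0 addr0.
Qed.

Lemma H1_min_cst f e : H1 f -> H1 (fun x => Num.min (f x) e).
Proof.
move=> hf; have [h _] := H1_cut e hf.
apply: H1_ext (H1B hN hf h) => x.
by have [h1|h1] := leP (f x) e; have [h2|h2] := leP (f x - e) 0; lra.
Qed.

(** The energy splits over z = (z - e)^+ + min z e by strong locality, and the
    energy of (z - e)^+ recovers that of z as e tends to 0 by lower
    semicontinuity. Hence low truncations have small energy. *)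
Lemma dirichlet_min_small z eta : H1 z -> (forall x, 0 <= z x) -> 0 < eta ->
  exists2 e, 0 < e & e <= eta /\ dirichlet (fun x => Num.min (z x) e) <= eta.
Proof.
move=> hz z0 eta0.
have [m hm] : exists m, dirichlet z - eta / 2 <= eform m z z.
  have /cvgrPdist_lt/(_ (eta / 2)) := dirichlet_cvg hN hz.
  rewrite divr_gt0// => /(_ isT)[m _ /(_ m (leqnn m))].
  by rewrite ltr_distl => /andP[h1 h2]; exists m; lra.
pose ze (n : R) x := Num.max (z x - n) 0.
have zc : forall x, ze n.+1%:R^-1 x @[n --> \oo] --> z x by move=> x; exact: cut_cvg.
have /cvgrPdist_lt/(_ (eta / 2)) := @eform_pointwise _ _ _ _ hV m (fun n => ze n.+1%:R^-1) z zc.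
rewrite divr_gt0// => /(_ isT) near1.
have /cvgrPdist_lt/(_ eta eta0) near2 := @cvg_harmonic R.
have [n [e0 hn1 hn2]] : exists n : R, [/\ 0 < n,
    `|eform m z z - eform m (ze n) (ze n)| < eta / 2 & n < eta].
  near \oo => n; exists n.+1%:R^-1; split; first by rewrite invr_gt0 ltr0n.
    by near: n.
  have : `|0 - n.+1%:R^-1| < eta by near: n.
  by rewrite sub0r normrN gtr0_norm// invr_gt0 ltr0n.
exists n => //; split; first exact: ltW.
have [hze _] := H1_cut n hz; rewrite -/(ze n) in hze.
set b := fun x => Num.min (z x) n.
have hb : H1 b by exact: H1_min_cst.
have [hc _] := H1_cst hV hN (n).
have [hd _] := H1_cut 0 (H1B hN hc hz).
(* Here b = n - (n - z)^+, and (z - n)^+ and (n - z)^+ are never positive at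
   the same point. *)
have Ezb : dform (ze n) b = 0.
  rewrite dformC (_ : b = fun x => n + -1 * Num.max (n - z x - 0) 0).
    rewrite dformDl//; last exact: H1Z.
    rewrite dformZl// dformC dform_cst// add0r dformC dform_local ?mulr0// => x.
      by rewrite le_max lexx orbT.
    by rewrite /ze; have [h1|h1] := leP (z x - n) 0;
      have [h2|h2] := leP (n - z x - 0) 0 => h3; lra.
  apply/funext => x; rewrite /b; have [h1|h1] := leP (z x) n;
    have [h2|h2] := leP (n - z x - 0) 0; lra.
have WE : dirichlet z = dirichlet (ze n) + dirichlet b.
  rewrite (_ : z = fun x => ze n x + b x).
    by rewrite {1}dirichletD// Ezb mulr0 addr0; congr (dirichlet _ + dirichlet _); apply/funext => x;
      rewrite /ze /b; have [h1|h1] := leP (z x - n) 0; have [h2|h2] := leP (z x) n; lra.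
  apply/funext => x; rewrite /ze /b; have [h1|h1] := leP (z x - n) 0; have [h2|h2] := leP (z x) n; lra.
have := eform_le_dirichlet hN m hze; have := ler_norm (eform m z z - eform m (ze n) (ze n)).
by lra.
Unshelve. all: by end_near. Qed.

End oscillation.

(** * The energy on L^2 *)

Section energy_L2.
Context {R : realType} {N : nat} {p : 'I_N -> 'rV[R]_N.-1} {V : set 'rV[R]_N.-1}.
Context {hV : is_gasket p V}.
Hypothesis hN : (2 <= N)%N.
Hypothesis hp : forall i j, i != j -> euclidean_norm (p i - p j) = 1.
Local Notation G := (gasket_space hV).
Local Notation T := (borel_gasket hV).
Local Notation vtx := (vertex hV).
Local Notation eform := (@eform R N p V hV).
Variable mu : {finite_measure set T -> \bar R}.
Hypothesis mu_supp : forall U : set G, open U -> U !=set0 -> (0 < mu U)%E.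
Implicit Types (f g h : G -> R) (u v : L2 mu).
Local Notation cls := (L2_of mu).

Lemma open_measurable_gasket (U : set G) : open U -> measurable (U : set T).
Proof. by move=> oU; apply: sub_sigma_algebra. Qed.

Lemma continuous_measurable_gasket f : continuous f -> measurable_fun [set: T] (f : T -> R).
Proof.
move=> cf; apply: (measurability _ (RGenOInfty.measurableE R)) => _ [_ [x ->] <-].
rewrite setTI; apply: open_measurable_gasket.
by apply: open_comp; [move=> y _; exact: cf | exact: interval_open].
Qed.

Lemma H1_Lfun f : H1 f -> (f : T -> R) \in Lfun mu 2%:E.
Proof.
move=> hf; have [M hM] := H1_bounded hN hf.
exact: bounded_Lfun2 (continuous_measurable_gasket hf.1) hM.
Qed.

Lemma clsE f : H1 f -> {ae mu, forall x, cls f x = f x}.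
Proof. by move=> hf; apply: L2_ofE; exact: H1_Lfun. Qed.

(** Two continuous functions that differ at a point differ on an open set,
    which is charged by mu. *)
Lemma continuous_ae_eq f g : continuous f -> continuous g ->
  {ae mu, forall x : T, f x = g x} -> f = g.
Proof.
move=> cf cg [Z [mZ Z0 hZ]]; apply/funext => x; apply: contrapT => fgx.
pose U := [set y : G | f y - g y != 0].
have cfg : continuous (fun y => f y - g y) by move=> y; exact: (cvgB (cf y) (cg y)).
have oU : open U.
  apply: (@open_comp _ _ (fun y => f y - g y) [set r | r != 0]).
    by move=> y _; exact: cfg.
  exact: open_neq.
have := mu_supp oU; rewrite lt_neqAle => /(_ _)/andP[]; last first.
  move=> /negP + _; apply; rewrite eq_sym -measure_le0 -Z0 le_measure//.
  - by apply/mem_set; exact: (open_measurable_gasket oU).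
  - exact/mem_set.
  move=> y /= /eqP Uy; apply: hZ => /= fgy; apply: Uy; apply/eqP.
  by rewrite subr_eq0 fgy.
by exists x; rewrite /U/= subr_eq0; apply/eqP.
Qed.

Lemma cont_rep_unique u f g : cont_rep u f -> cont_rep u g -> f = g.
Proof.
move=> [cf uf] [cg ug]; apply: continuous_ae_eq => //.
by apply: filterS2 uf ug => x -> ->.
Qed.

Lemma cont_rep_cls f : H1 f -> cont_rep (cls f) f.
Proof. by move=> hf; split; [exact: hf.1 | exact: clsE]. Qed.

Lemma crep_eq u f : cont_rep u f -> crep u = f.
Proof.
move=> uf; have h : cont_rep u (crep u) by exact: (@xgetI _ (cst 0) (cont_rep u) f uf).
exact: cont_rep_unique h uf.
Qed.

Lemma crep_cls f : H1 f -> crep (cls f) = f.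
Proof. by move=> hf; apply: crep_eq; exact: cont_rep_cls. Qed.

Let ecE f : energy_cont f = limn (fun m => (eform m f f)%:E).
Proof. by rewrite /energy_cont; congr (limn _); apply/funext => m; rewrite energy_levelE. Qed.

Lemma energy_cont_H1 f : H1 f -> energy_cont f = (dirichlet f)%:E.
Proof.
move=> hf; rewrite ecE; apply/cvg_lim => //; apply: cvg_EFin; first exact: nearW.
exact: dirichlet_cvg.
Qed.

Lemma energy_cont_lty f : continuous f -> (energy_cont f < +oo)%E -> H1 f.
Proof.
move=> cf; rewrite ecE => fy; split => //.
have nd : nondecreasing_seq (fun m => (eform m f f)%:E).
  by apply/nondecreasing_seqP => m; rewrite lee_fin eform_mono.
have limE := cvg_lim (@ereal_hausdorff R) (ereal_nondecreasing_cvgn nd).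
have le m : ((eform m f f)%:E <= limn (fun m => (eform m f f)%:E))%E.
  by rewrite limE; apply: ereal_sup_ubound; exists m.
exists (fine (limn (fun m => (eform m f f)%:E))) => m.
rewrite -lee_fin fineK//; rewrite fin_real// fy andbT.
by apply: lt_le_trans (le 0%N); rewrite ltNyr.
Qed.

Lemma H1_L2P u : H1_L2 mu u <-> exists2 f, H1 f & u = cls f.
Proof.
split=> [[f [cf uf] fy]|[f hf ->]].
  have hf := energy_cont_lty cf fy; exists f => //.
  by apply: L2_eq; apply: filterS2 uf (clsE hf) => x -> ->.
by exists f; [exact: cont_rep_cls | rewrite energy_cont_H1// ltry].
Qed.

Lemma energy_cls f : H1 f -> energy mu (cls f) = (dirichlet f)%:E.
Proof.
move=> hf; rewrite /energy ifT; last by apply/mem_set/H1_L2P; exists f.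
by rewrite crep_cls// energy_cont_H1.
Qed.

Lemma energy_lty u : (energy mu u < +oo)%E -> exists2 f, H1 f & u = cls f.
Proof.
by rewrite /energy; case: ifPn => [/set_mem /H1_L2P//|]; rewrite ltxx.
Qed.

Lemma energy_infty_cls f : H1 f -> (forall i, f (vtx i) = 0) ->
  energy_infty mu (cls f) = (dirichlet f)%:E.
Proof.
move=> hf f0; rewrite /energy_infty ifT ?energy_cls//; apply/mem_set; split.
  by apply/H1_L2P; exists f.
by move=> i; rewrite crep_cls.
Qed.

Lemma energy_infty_lty u : (energy_infty mu u < +oo)%E ->
  exists2 f, H1 f & (forall i, f (vtx i) = 0) /\ u = cls f.
Proof.
rewrite /energy_infty; case: ifPn => [/set_mem [/H1_L2P[f hf ->] f0] _|]; last by rewrite ltxx.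
by exists f => //; split => // i; have := f0 i; rewrite crep_cls.
Qed.

Lemma energy_ge0 u : (0 <= energy mu u)%E.
Proof.
rewrite leNgt; apply/negP => h; have [f hf uE] := energy_lty (lt_trans h (ltry 0)).
by move: h; rewrite uE energy_cls// lte_fin ltNge dirichlet_ge0.
Qed.

Lemma energy_infty_ge0 u : (0 <= energy_infty mu u)%E.
Proof. by rewrite /energy_infty; case: ifP => _; rewrite ?leey// energy_ge0. Qed.

End energy_L2.

(** * Lower semicontinuity of the energy *)

Lemma cvg_sqr (R : realType) (u : nat -> R) (l : R) :
  u n @[n --> \oo] --> l -> u n ^+ 2 @[n --> \oo] --> l ^+ 2.
Proof. by move=> ul; under eq_fun do rewrite expr2; rewrite expr2; exact: cvgM. Qed.

Section semicontinuity.
Context {R : realType} {N : nat} {p : 'I_N -> 'rV[R]_N.-1} {V : set 'rV[R]_N.-1}.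
Context {hV : is_gasket p V}.
Hypothesis hN : (2 <= N)%N.
Hypothesis hp : forall i j, i != j -> euclidean_norm (p i - p j) = 1.
Local Notation G := (gasket_space hV).
Local Notation T := (borel_gasket hV).
Local Notation vtx := (vertex hV).
Local Notation eform := (@eform R N p V hV).
Local Notation decay := (@decay R N).
Implicit Types (f g h : G -> R).

Lemma cell_compact w : compact (cell p V w).
Proof.
elim: w => [|i w IH] /=; first by case: hV.
apply: continuous_compact => //; apply: continuous_subspaceT => x.
exact: (cvgD (@scaler_continuous _ _ 2^-1 x) (@cst_continuous _ _ (2^-1 *: p i) x)).
Qed.

(** There are finitely many cells of level m, and each of those that avoid x
    is closed, so that points close to x lie only in cells that contain x. In
    general no single cell is a neighbourhood of x. *)
Lemma near_cells m (x : G) : \forall y \near x, forall w : m.-tuple 'I_N,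
  (exists z, y = cell_word w z) -> exists z, x = cell_word w z.
Proof.
suff H (w : m.-tuple 'I_N) : \forall y \near x,
    (exists z, y = cell_word w z) -> exists z, x = cell_word w z.
  exact: (@filter_forall _ _ _ (nbhs x) _ H).
have [xw|xw] := pselect (exists z, x = cell_word w z); first by apply/gasket_nbhsP; exists 1.
have cl : closed (cell p V w).
  by apply: compact_closed; [exact: norm_hausdorff | exact: cell_compact].
have : \forall y \near (val x), ~ cell p V w y.
  apply: (open_nbhs_nbhs _); split; first by move: cl; rewrite -openC.
  by move=> /(@cellP _ _ _ _ hV).
move=> /nbhs_ballP[e /= e0 he]; apply/gasket_nbhsP; exists e => // y xy yw.
exfalso; apply: (he (val y)); first by rewrite -ball_normE.
by apply/(@cellP _ _ _ _ hV).
Qed.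

(** A point y near x shares a cell of level m with x, on which all functions
    of bounded energy oscillate little. *)
Lemma energy_equicontinuous c (x : G) e : 0 <= c -> 0 < e ->
  \forall y \near x, forall f, continuous f -> (forall m, eform m f f <= c ^+ 2) ->
    `|f x - f y| <= e.
Proof.
move=> c0 e0; have [m hm] := decay_small hN (c / (1 - decay)) e0.
apply: filterS (near_cells m x) => y hy f cf hc.
have [w [z [sw yE]]] := cell_word_surj m y.
have sw' : size w == m by rewrite sw.
have [|z' xE] := hy (Tuple sw'); first by exists z.
rewrite xE yE /=; apply: le_trans (oscillation_cell hN w z' z cf c0 hc) _.
by rewrite sw -mulrA ltW.
Qed.

Lemma gasket_ball_open (x : G) r : open [set y : G | `|val x - val y| < r].
Proof.
have cn : continuous (fun y : G => `|val x - val y|).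
  move=> y.
  exact: (cvg_norm (cvgB (@cst_continuous _ _ (val x) y) (@val_continuous _ _ _ _ hV y))).
exact: (@open_comp _ _ _ [set t | t < r] (fun y _ => cn y) (@open_lt _ _)).
Qed.

Variable mu : {finite_measure set T -> \bar R}.
Hypothesis mu_supp : forall U : set G, open U -> U !=set0 -> (0 < mu U)%E.
Local Notation cls := (L2_of mu).

(** If f and g are far apart at x, by equicontinuity they are far apart on a
    neighbourhood of x that depends only on the energy bound. This
    neighbourhood has positive measure, so f and g are far apart in L^2. Thus
    L^2 convergence with bounded energy implies pointwise convergence. *)
Lemma L2_close_point c (x : G) e : 0 <= c -> 0 < e ->
  exists2 dl, 0 < dl & forall f g, continuous f -> continuous g ->
    (forall m, eform m f f <= c ^+ 2) -> (forall m, eform m g g <= c ^+ 2) ->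
    `|cls f - cls g| < dl -> `|f x - g x| < e.
Proof.
move=> c0 e0; have e3 : 0 < e / 3 by rewrite divr_gt0.
have /gasket_nbhsP[r r0 hr] := energy_equicontinuous x c0 e3.
pose U := [set y : G | `|val x - val y| < r].
have oU : open U by exact: gasket_ball_open.
have Ux : U x by rewrite /U/= subrr normr0.
have muO : (0 < mu U)%E by apply: mu_supp => //; exists x.
have mU := open_measurable_gasket oU.
have muOf : (mu U < +oo)%E by rewrite ltey_eq fin_num_measure.
have fO : 0 < fine (mu U) by rewrite fine_gt0// muO.
exists (e / 3 * Num.sqrt (fine (mu U))); first by rewrite mulr_gt0// sqrtr_gt0.
move=> f g cf cg hf hg; apply: contraTT; rewrite -!leNgt => efg.
have Hf : H1 f by split => //; exists (c ^+ 2).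
have Hg : H1 g by split => //; exists (c ^+ 2).
have nn : 0 <= e / 3 * Num.sqrt (fine (mu U)) by rewrite mulr_ge0 ?sqrtr_ge0// ltW.
rewrite -ler_sqr ?nnegrE// exprMn sqr_sqrtr ?(ltW fO)// L2_norm_dot.
have iU : mu.-integrable [set: T] (EFin \o (fun x : T => (e / 3) ^+ 2 * \1_U x)).
  apply: (@bounded_integrable _ _ _ _ _ _ ((e / 3) ^+ 2)) => //.
  - by rewrite ltey_eq fin_num_measure.
  - by apply: measurable_funM => //; exact: measurable_indic.
  have q0 : 0 <= (e / 3) ^+ 2 by exact: sqr_ge0.
  move=> s _; rewrite indicE.
  by case: (s \in U); rewrite ?mulr1 ?mulr0 ?normr0// (ger0_norm q0).
have i1 : mu.-integrable [set: T] (EFin \o (\1_U : T -> R)).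
  apply: (@bounded_integrable _ _ _ _ _ _ 1) => //.
  - by rewrite ltey_eq fin_num_measure.
  - by move=> s _; rewrite indicE; case: (_ \in _); rewrite ?normr1 ?normr0.
have -> : (e / 3) ^+ 2 * fine (mu U) = \int[mu]_y ((e / 3) ^+ 2 * \1_U y).
  by rewrite RintegralZl// /Rintegral integral_indic// setIT.
apply: ae_le_Rintegral => //; first exact: L2_mul_integrable.
have aF := clsE hN mu Hf; have aG := clsE hN mu Hg.
apply: filterS3 (L2_subE (cls f) (cls g)) aF aG => y -> -> -> _.
rewrite indicE -expr2; case: (boolP (y \in U)) => [/set_mem Uy|_]; last by rewrite mulr0 sqr_ge0.
rewrite mulr1 -(real_normK (num_real (f y - g y))) ler_sqr ?nnegrE ?(ltW e3)//.
have := hr y Uy f cf hf; have := hr y Uy g cg hg => hgy hfy.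
have : `|f x - g x| <= `|f x - f y| + `|f y - g y| + `|g x - g y|.
  rewrite (_ : f x - g x = (f x - f y) + (f y - g y) - (g x - g y)); last by ring.
  by apply: le_trans (ler_normB _ _) _; rewrite lerD2r ler_normD.
by lra.
Qed.

(** Balls of the energy are closed in L^2, together with any condition P that
    is stable under pointwise limits (such as vanishing on the boundary). The
    approximants converge pointwise by [L2_close_point], the limit inherits
    the modulus of continuity and the energy bound, and Fatou identifies it
    with u. *)
Lemma finite_energy_closed (u : L2 mu) (a : R) (P : (G -> R) -> Prop) :
  (forall (F : nat -> G -> R) f, (forall n, P (F n)) ->
     (forall x, F n x @[n --> \oo] --> f x) -> P f) ->
  (forall e, 0 < e -> exists f, [/\ H1 f, dirichlet f <= a, P f & `|u - cls f| < e]) ->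
  exists h, [/\ H1 h, dirichlet h <= a, P h & u = cls h].
Proof.
move=> Pc approx.
have /choice[F hF] : forall n : nat, exists f,
    [/\ H1 f, dirichlet f <= a, P f & `|u - cls f| < n.+1%:R^-1].
  by move=> n; apply: approx; rewrite invr_gt0 ltr0n.
have a0 : 0 <= a.
  by have [h1 h2 _ _] := hF 0%N; apply: le_trans h2; exact: dirichlet_ge0.
pose c := Num.sqrt a.
have c0 : 0 <= c by exact: sqrtr_ge0.
have Fc n m : eform m (F n) (F n) <= c ^+ 2.
  have [h1 h2 _ _] := hF n.
  by rewrite sqr_sqrtr//; apply: le_trans h2; exact: eform_le_dirichlet.
have Fcont n : continuous (F n) by have [[]] := hF n.
have Fcvg x : cvgn (fun n => F n x).
  apply/cauchy_cvgP/cauchy_exP => e e0.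
  have [dl dl0 hdl] := L2_close_point x c0 e0.
  have /cvgrPdist_lt/(_ (dl / 2)) := @cvg_harmonic R.
  rewrite divr_gt0// => /(_ isT)[n0 _ hn0].
  have close n : (n0 <= n)%N -> `|u - cls (F n)| < dl / 2.
    move=> n0n; have [_ _ _ h] := hF n; apply: lt_trans h _.
    have := hn0 n n0n; rewrite /= sub0r normrN ger0_norm//.
  exists (F n0 x); exists n0 => // n /= n0n; rewrite -ball_normE /=.
  apply: hdl => //.
  rewrite (_ : cls (F n0) - cls (F n) = (u - cls (F n)) - (u - cls (F n0))).
    rewrite [ltRHS]splitr; apply: le_lt_trans (ler_normB _ _) _.
    by rewrite ltrD// close.
  by rewrite opprB [RHS]addrC addrA subrK.
pose h x := limn (fun n => F n x).
have hlim x : F n x @[n --> \oo] --> h x by exact: Fcvg.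
have ch : continuous h.
  move=> x A /nbhs_ballP[e /= e0 eA]; apply/gasket_nbhsP.
  have e2 : 0 < e / 2 by rewrite divr_gt0.
  have /gasket_nbhsP[r r0 hr] := energy_equicontinuous x c0 e2.
  exists r => // y /hr hy; apply: eA; rewrite -ball_normE /=.
  apply: (@le_lt_trans _ _ (e / 2)); last by rewrite ltr_pdivrMr// ltr_pMr// ltr1n.
  have : `|F n x - F n y| @[n --> \oo] --> `|h x - h y|.
    by apply: cvg_norm; apply: cvgB; exact: hlim.
  move=> /cvgr_to_le; apply; apply: nearW => n; exact: hy.
have [Hh Wh] : H1 h /\ dirichlet h <= a.
  apply: dirichlet_le => // m; apply: (eform_pointwise_le hlim) => n.
  by have [h1 h2 _ _] := hF n; apply: le_trans h2; exact: eform_le_dirichlet.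
exists h; split => //; first by apply: Pc hlim => n; have [] := hF n.
have mu_ := L2_measurable u.
have mh := continuous_measurable_gasket ch.
have mF n := continuous_measurable_gasket (Fcont n).
pose fn n (y : T) := ((u y - F n y) ^+ 2)%:E.
have fat := @fatou _ T R mu setT measurableT fn _ _.
have {fat} : (\int[mu]_y ((u y - h y) ^+ 2)%:E <= 0)%E.
  have lim0 : (fun n => \int[mu]_y fn n y)%E @ \oo --> 0%E.
    have E n : (\int[mu]_y fn n y = (`|u - cls (F n)| ^+ 2)%:E)%E.
      have [HF _ _ _] := hF n.
      rewrite L2_norm_dot /L2_dot /Rintegral fineK; last first.
        exact: (integrable_fin_num measurableT (L2_mul_integrable _ _)).
      apply: ae_eq_integral => //.
      - by apply/measurable_EFinP; apply: measurable_funX; exact: measurable_funB.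
      - exact: (measurable_int mu (L2_mul_integrable _ _)).
      apply: filterS2 (L2_subE u (cls (F n))) (clsE hN mu HF) => y + e _.
      by move=> ->; rewrite e /fn -expr2.
    under eq_fun do rewrite E.
    apply: cvg_EFin; first exact: nearW.
    have : `|u - cls (F n)| @[n --> \oo] --> (0 : R).
      apply: (@squeeze_cvgr _ _ _ _ (fun=> 0) (fun n => n.+1%:R^-1)).
      - by apply: nearW => n; have [_ _ _ /ltW ->] := hF n; rewrite normr_ge0.
      - exact: cvg_cst.
      - exact: cvg_harmonic.
    move=> h0; have -> : (0 : R) = 0 ^+ 2 by rewrite expr0n.
    exact: (cvg_sqr h0).
  have : (\int[mu]_y ((u y - h y) ^+ 2)%:E <= limn_einf (fun n => \int[mu]_y fn n y))%E.
    rewrite (_ : (\int[mu]_y ((u y - h y) ^+ 2)%:E)%E = (\int[mu]_y limn_einf (fn^~ y))%E).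
      apply: fatou => // n; last by move=> y _; rewrite lee_fin sqr_ge0.
      by apply/measurable_EFinP; apply: measurable_funX; exact: measurable_funB.
    apply: eq_integral => y _.
    have cy : fn n y @[n --> \oo] --> ((u y - h y) ^+ 2)%:E.
      apply: cvg_EFin; first exact: nearW.
      by apply: cvg_sqr; apply: cvgB; [exact: cvg_cst|exact: hlim].
    by rewrite is_cvg_limn_einfE; [exact/esym/cvg_lim | exact: cvgP cy].
  by rewrite (is_cvg_limn_einfE (cvgP _ lim0)) (cvg_lim _ lim0).
move=> int0.
have mm : measurable_fun [set: T] (fun y => ((u y - h y) ^+ 2)%:E).
  by apply/measurable_EFinP; apply: measurable_funX; exact: measurable_funB.
have /(ae_eq_integral_abs mu measurableT mm) ae0 : (\int[mu]_y `|((u y - h y) ^+ 2)%:E| = 0)%E.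
  apply/eqP; rewrite eq_le; apply/andP; split; last exact: integral_ge0.
  apply: le_trans int0; apply: lower_integral_le => y _ //.
  by rewrite gee0_abs// lee_fin sqr_ge0.
apply: L2_eq; apply: filterS2 ae0 (clsE hN mu Hh).
move=> y /= /(_ I) [] /eqP; rewrite sqrf_eq0 subr_eq0 => /eqP -> ->.
by [].
Qed.

Lemma energy_lsc : lower_semicontinuous (energy mu).
Proof.
move=> u a au; apply: contrapT => no.
have [|e e0|h [hh Wh _ uE]] := @finite_energy_closed u a (fun=> True) => //; last first.
  by move: au; rewrite uE energy_cls// lte_fin ltNge Wh.
apply: contrapT => nf; apply: no; exists (ball u e); first exact: nbhsx_ballx.
move=> v; rewrite -ball_normE /= => uv; rewrite ltNge; apply/negP => va.
have [f hf vE] : exists2 f, H1 f & v = cls f.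
  by apply: energy_lty => //; exact: le_lt_trans va (ltry _).
apply: nf; exists f; split => //; last by rewrite -vE.
by move: va; rewrite vE energy_cls// lee_fin.
Qed.

Lemma energy_infty_lsc : lower_semicontinuous (energy_infty mu).
Proof.
move=> u a au; apply: contrapT => no.
have [||h [hh Wh h0 uE]] := @finite_energy_closed u a (fun f => forall i, f (vtx i) = 0).
- move=> F f F0 Ff i; have := Ff (vtx i); under eq_fun do rewrite F0.
  by move=> /(cvg_unique (@Rhausdorff R) (cvg_cst _)) <-.
- move=> e e0; apply: contrapT => nf; apply: no; exists (ball u e); first exact: nbhsx_ballx.
  move=> v; rewrite -ball_normE /= => uv; rewrite ltNge; apply/negP => va.
  have [f hf [f0 vE]] : exists2 f, H1 f & (forall i, f (vtx i) = 0) /\ v = cls f.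
    by apply: energy_infty_lty => //; exact: le_lt_trans va (ltry _).
  apply: nf; exists f; split => //; last by rewrite -vE.
  by move: va; rewrite vE energy_infty_cls// lee_fin.
by move: au; rewrite uE energy_infty_cls// lte_fin ltNge Wh.
Qed.

End semicontinuity.

(** * Symmetries and bump functions *)

Section symmetry.
Context {R : realType} {N : nat} {p : 'I_N -> 'rV[R]_N.-1} {V : set 'rV[R]_N.-1}.
Context {hV : is_gasket p V}.
Hypothesis hN : (2 <= N)%N.
Hypothesis hp : forall i j, i != j -> euclidean_norm (p i - p j) = 1.
Local Notation G := (gasket_space hV).
Local Notation vtx := (vertex hV).
Local Notation eform := (@eform R N p V hV).
Local Notation gasket_bary := (@gasket_bary R N p V hV).

Section permutation.
Variable s : {perm 'I_N}.

(** Permuting barycentric coordinates realizes a permutation of the vertices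
    as an affine symmetry of the gasket. *)
Definition perm_point (x : G) : 'rV[R]_N.-1 := \sum_k gasket_bary k x *: p (s k).

Lemma perm_point_vertex i : perm_point (vtx i) = p (s i).
Proof.
rewrite /perm_point (bigD1 i)//= gasket_bary_vertex// eqxx scale1r big1 ?addr0// => k.
by move=> /negPf ki; rewrite gasket_bary_vertex// ki scale0r.
Qed.

Lemma perm_point_cell j x : perm_point (cell_map j x) = half_map p (s j) (perm_point x).
Proof.
rewrite /perm_point /half_map; under eq_bigr do rewrite gasket_bary_cell// scalerDl.
rewrite big_split/= scaler_sumr; congr (_ + _).
  by apply: eq_bigr => k _; rewrite scalerA.
rewrite (bigD1 j)//= eqxx mulr1 big1 ?addr0// => k /negPf ->.
by rewrite mulr0 scale0r.
Qed.

Lemma perm_point_continuous : continuous perm_point.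
Proof.
move=> x.
have h k : gasket_bary k y *: p (s k) @[y --> x] --> gasket_bary k x *: p (s k).
  exact: (cvgZr_tmp (@gasket_bary_continuous _ _ _ _ hV k x)).
exact: (@cvg_sumr _ _ _ (nbhs x) _ _ _ _ _ h).
Qed.

Lemma perm_point_subproof x : V (perm_point x).
Proof.
have [_ cV _] := hV.
have clV : closed V by apply: compact_closed => //; exact: norm_hausdorff.
have cl : closed [set x | V (perm_point x)].
  exact: (@closed_comp _ _ _ V (fun y _ => @perm_point_continuous y) clV).
apply: (gasket_dense cl _ _ x); last by case: N hN.
move=> w i /=; elim: w => [|j w IH] /=.
  by rewrite perm_point_vertex; exact: (gasket_vertex_subproof hV).
by rewrite perm_point_cell; apply/(gasket_cover hV); exists (s j), (perm_point (cell_word w (vtx i))).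
Qed.

Definition perm_map (x : G) : G := exist _ (perm_point x) (mem_set (perm_point_subproof x)).

Lemma perm_map_vertex i : perm_map (vtx i) = vtx (s i).
Proof. by apply: gasket_val_inj; rewrite /= perm_point_vertex. Qed.

Lemma perm_map_cell j x : perm_map (cell_map j x) = cell_map (s j) (perm_map x).
Proof. by apply: gasket_val_inj; rewrite /= perm_point_cell. Qed.

Lemma perm_map_continuous : continuous perm_map.
Proof.
move=> x U /gasket_nbhsP[e e0 eU]; apply/gasket_nbhsP.
have : nbhs (perm_point x) (ball (perm_point x) e) by exact: nbhsx_ballx.
move=> /(perm_point_continuous (x:=x)) /gasket_nbhsP[r r0 hr].
exists r => // y /hr; rewrite -ball_normE /= => h; exact: eU.
Qed.

Lemma eform_perm m u : eform m (u \o perm_map) (u \o perm_map) = eform m u u.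
Proof.
elim: m u => [|m IH] u /=; congr *%R.
  rewrite [RHS](reindex_inj (@perm_inj _ s))/=; apply: eq_bigr => i _.
  rewrite [RHS](reindex_inj (@perm_inj _ s))/=; apply: eq_bigr => j _.
  by rewrite !perm_map_vertex.
rewrite [RHS](reindex_inj (@perm_inj _ s))/=; apply: eq_bigr => i _.
have E : (u \o perm_map) \o cell_map i = (u \o cell_map (s i)) \o perm_map.
  by apply/funext => x; rewrite /= perm_map_cell.
by rewrite E IH.
Qed.

Lemma H1_perm u : H1 u -> H1 (u \o perm_map).
Proof.
move=> [cu [C hC]]; split; last by exists C => m; rewrite eform_perm.
by move=> x; apply: continuous_comp; [exact: perm_map_continuous | exact: cu].
Qed.

End permutation.

Lemma eform_const m u : (forall w i j, u (cell_word w (vtx i)) = u (cell_word w (vtx j))) ->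
  eform m u u = 0.
Proof.
elim: m u => [|m IH] u h /=.
  by rewrite big1 ?mulr0// => i _; rewrite big1// => j _; rewrite (h [::] i j) subrr mul0r.
by rewrite big1 ?mulr0// => i _; apply: IH => w; exact: (h (i :: w)).
Qed.

Lemma H1_word (u : G -> R) w : H1 u -> H1 (u \o cell_word w).
Proof.
move=> hu; have [c c0 hc] := H1_oscillation hN hu.
split; last by exists ((@decay R N ^+ size w * c) ^+ 2); exact: eform_subword.
by move=> x; apply: continuous_comp; [exact: continuous_cell_word | exact: hu.1].
Qed.

Variable mu : {finite_measure set (borel_gasket hV) -> \bar R}.
Hypothesis mu_supp : forall U : set G, open U -> U !=set0 -> (0 < mu U)%E.
Hypothesis dense_dom : forall (u : L2 mu) (e : R), 0 < e ->
  exists2 v, (energy mu v < +oo)%E & `|u - v| < e.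

(** If all functions of finite energy were constant on the boundary, then by
    restriction they would be constant on the vertices of each cell, and their
    energies would all be 0. The sublevel set of energy 0 is closed and dense,
    hence everything; but it does not contain a barycentric coordinate. *)
Lemma H1_nonconstant : exists (u : G -> R) i j, [/\ H1 u, i != j & u (vtx i) != u (vtx j)].
Proof.
apply: contrapT => no.
have const (u : G -> R) i j : H1 u -> u (vtx i) = u (vtx j).
  move=> hu; have [->//|ij] := eqVneq i j; apply/eqP; apply: contrapT => /negP uij.
  by apply: no; exists u, i, j.
have N0 : (0 < N)%N by exact: ltn_trans hN.
pose o : 'I_N := Ordinal N0; pose o' : 'I_N := Ordinal hN.
have cb := @gasket_bary_continuous _ _ _ _ hV o.
have Lb : (gasket_bary o : borel_gasket hV -> R) \in Lfun mu 2%:E.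
  apply: (@bounded_Lfun2 _ _ _ _ _ 1) => [|x]; first exact: continuous_measurable_gasket.
  by rewrite ger0_norm ?gasket_bary_ge0// gasket_bary_le1.
(* The test function is the class of a barycentric coordinate, which separates
   two vertices and is continuous. *)
pose b := L2_of mu (gasket_bary o).
have [bpos|b0] := ltP 0%E (energy mu b).
  have [U /nbhs_ballP[e /= e0 eU] hU] := energy_lsc hN hp mu_supp bpos.
  have [v vfin vb] := dense_dom b e0.
  have [f hf vE] : exists2 f, H1 f & v = L2_of mu f by exact: energy_lty vfin.
  have := hU v; rewrite vE energy_cls// => /(_ _)/wrap[].
    by rewrite -vE; apply: eU; rewrite -ball_normE.
  rewrite lte_fin ltNge => /negP; apply.
  apply: (dirichlet_le hN hf.1 _).2 => m; rewrite eform_const// => w i j.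
  exact: (const _ i j (H1_word w hf)).
have [f hf bE] : exists2 f, H1 f & b = L2_of mu f.
  by apply: energy_lty => //; exact: le_lt_trans b0 (ltry _).
have fb : gasket_bary o = f.
  apply: (continuous_ae_eq mu_supp cb hf.1).
  by apply: filterS2 (L2_ofE Lb) (clsE hN mu hf) => x; rewrite -/b bE => <- <-.
have := const f o o' hf; rewrite -fb !gasket_bary_vertex// eqxx => /eqP.
by rewrite (_ : (o == o') = false)// oner_eq0.
Qed.

(** A symmetry of the gasket moves the two vertices at which [H1_nonconstant]
    finds different values to any two given vertices. *)
Lemma H1_separating i j : i != j -> exists2 h : G -> R, H1 h & h (vtx i) = 1 /\ h (vtx j) = 0.
Proof.
move=> ij; have [u [a [b [hu ab uab]]]] := H1_nonconstant.
(* This permutation maps i to a and j to b. *)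
pose s : {perm 'I_N} := (tperm i a * tperm (tperm i a j) b)%g.
have ja : tperm i a j != a.
  by rewrite -[X in _ != X](tpermL i a) (inj_eq perm_inj) eq_sym.
have ba : b != a by rewrite eq_sym.
have si : s i = a by rewrite permM tpermL; exact: tpermD.
have sj : s j = b by rewrite permM tpermL.
have hs := H1_perm s hu.
have d0 : u (vtx a) - u (vtx b) != 0 by rewrite subr_eq0.
exists (fun x => (u (vtx a) - u (vtx b))^-1 * ((u \o perm_map s) x - u (vtx b))).
  apply: (H1Z _ (H1B hN hs _)).
  by have [] := H1_cst hV hN (u (vtx b)).
by rewrite /= !perm_map_vertex si sj subrr mulr0 mulVf.
Qed.

Lemma H1_sum (I : Type) (r : seq I) (P : pred I) (f : I -> G -> R) :
  (forall i, P i -> H1 (f i)) -> H1 (fun x => \sum_(i <- r | P i) f i x).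
Proof.
move=> hf; elim: r => [|i r IH].
  apply: H1_ext (H1_cst hV hN 0).1 => x; by rewrite big_nil.
have [Pi|nPi] := boolP (P i).
  by apply: H1_ext (H1D hN (hf i Pi) IH) => x; rewrite big_cons Pi.
by apply: H1_ext IH => x; rewrite big_cons (negPf nPi).
Qed.

(** With k j equal to 1 at vertex i and to 0 at vertex j, the function 1 -
    (the sum over j of |1 - k j|) is 1 at vertex i and nonpositive at the
    others; take its positive part. *)
Lemma H1_peak i : exists2 h : G -> R, H1 h & forall j, h (vtx j) = (i == j)%:R.
Proof.
have /choice[k hk] : forall j, exists h : G -> R, H1 h /\ (i != j -> h (vtx i) = 1 /\ h (vtx j) = 0).
  move=> j; have [->|ij] := eqVneq i j; last by have [h hh ?] := H1_separating ij; exists h.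
  by exists (fun=> 0); split => //; exact: (H1_cst hV hN 0).1.
have [h1 _] := H1_cst hV hN (1 : R).
(* A j is the absolute value of 1 - k j, as a sum of two positive parts. *)
pose A j x := Num.max (1 - k j x) 0 + Num.max (k j x - 1) 0.
have hA j : H1 (A j).
  have hk1 := (hk j).1.
  by apply: (H1D hN); apply: (H1_pos hN _).1; exact: H1B.
have A0 j x : 0 <= A j x by rewrite addr_ge0// le_max lexx orbT.
exists (fun x => Num.max (1 - \sum_(j | j != i) A j x) 0).
  by apply: (H1_pos hN _).1; apply: H1B => //; apply: H1_sum.
move=> j; have [<-|ij] := eqVneq i j.
  rewrite big1 ?subr0 ?max_l// => l; rewrite eq_sym => /((hk l).2)[ki _].
  by rewrite /A ki subrr maxxx addr0.
rewrite max_r// (bigD1 j)/=; last by rewrite eq_sym.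
have [_ kj] := (hk j).2 ij; rewrite {1}/A kj subr0 sub0r.
rewrite (max_l (@ler01 R)) max_r ?oppr_le0// addr0 opprD addrA subrr sub0r oppr_le0.
by apply: sumr_ge0.
Qed.

(** Subtracting from each peak all the others and taking the positive part
    makes the supports disjoint: at each point at most one peak exceeds the
    sum of the others. *)
Lemma H1_bumps : exists psi : 'I_N -> G -> R, forall i,
  [/\ H1 (psi i), forall x, 0 <= psi i x, forall j, psi i (vtx j) = (i == j)%:R &
      forall j x, i != j -> 0 < psi i x -> psi j x = 0].
Proof.
have /choice[k hk] : forall i, exists h : G -> R, H1 h /\ forall j, h (vtx j) = (i == j)%:R.
  by move=> i; have [h] := H1_peak i; exists h.
pose g i x := Num.max (k i x) 0.
have g0 i x : 0 <= g i x by rewrite le_max lexx orbT.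
have hg i : H1 (g i) by apply: (H1_pos hN _).1; exact: (hk i).1.
have gv i j : g i (vtx j) = (i == j)%:R.
  by rewrite /g (hk i).2 max_l// ler0n.
exists (fun i x => Num.max (g i x - \sum_(j | j != i) g j x) 0) => i; split.
- apply: (H1_pos hN _).1; apply: H1B => //; exact: H1_sum.
- by move=> x; rewrite le_max lexx orbT.
- move=> j; rewrite gv; have [<-|ij] := eqVneq i j.
    rewrite big1 ?subr0 ?max_l// => l li; by rewrite gv (negPf li).
  rewrite (bigD1 j)/=; last by rewrite eq_sym.
  rewrite gv eqxx max_r// sub0r oppr_le0 addr_ge0//; exact: sumr_ge0.
move=> j x ij; have s1 : g j x <= \sum_(l | l != i) g l x.
  by rewrite (bigD1 j)/= 1?eq_sym// lerDl; exact: sumr_ge0.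
have s2 : g i x <= \sum_(l | l != j) g l x.
  by rewrite (bigD1 i)//= lerDl; exact: sumr_ge0.
rewrite lt_max ltxx orbF subr_gt0 => h; rewrite max_r// subr_le0.
by apply: le_trans s2; apply: ltW; exact: le_lt_trans s1 h.
Qed.

End symmetry.

(** * The excess over the energy on the positive cone *)

(** Bookkeeping in the extended reals: a half step inequality whose real terms
    a and b are energies turns a bound on B into a bound on A. *)
Lemma excess_budget (R : realType) (A B : \bar R) (a b k l : R) :
  (0 <= A)%E -> (A + a%:E <= B + b%:E)%E -> (B <= k%:E)%E -> k + b - a = l ->
  (A <= l%:E)%E.
Proof.
move=> A0 + Bk <-; move=> /le_trans/(_ (leeD2r b%:E Bk)).
by case: A A0 => [r| |] // _; rewrite -!EFinD !lee_fin; lra.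
Qed.

Section cone.
Context {R : realType} {N : nat} {p : 'I_N -> 'rV[R]_N.-1} {V : set 'rV[R]_N.-1}.
Context {hV : is_gasket p V}.
Hypothesis hN : (2 <= N)%N.
Local Notation G := (gasket_space hV).
Local Notation T := (borel_gasket hV).
Local Notation vtx := (vertex hV).
Variable mu : {finite_measure set T -> \bar R}.
Local Notation cls := (L2_of mu).
Implicit Types (u v w x y z : G -> R) (c s h : R).

Variable Phi : L2 mu -> \bar R.
Hypothesis Phi_lsc : lower_semicontinuous Phi.

(** The energy is on the right so that no subtraction occurs in the extended
    reals. *)
Definition excess_le x c := (Phi (cls x) <= (dirichlet x + c)%:E)%E.

Lemma excess_le_ext x y c : x =1 y -> excess_le x c -> excess_le y c.
Proof. by move=> /funext ->. Qed.

(** Expand 0 <= the energy of b + s x. *)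
Lemma dform_young x b s : H1 x -> H1 b -> 0 < s -> - (2 * dform x b) <= s * dirichlet x + dirichlet b / s.
Proof.
move=> hx hb s0; have := dirichlet_ge0 hN (H1D hN hb (H1Z s hx)).
rewrite dirichletDZ// dformC => h.
have : 0 <= (dirichlet b + 2 * s * dform x b + s ^+ 2 * dirichlet x) / s by rewrite divr_ge0// ltW.
rewrite (_ : _ / s = dirichlet b / s + 2 * dform x b + s * dirichlet x); first by lra.
by field; rewrite gt_eqF.
Qed.

(** If x can be perturbed by functions that are small uniformly and in energy,
    then Phi is lower semicontinuous along the perturbation and the energy of
    x - b tends to that of x; the excess bound survives. *)
Lemma excess_le_closed x c : H1 x ->
  (forall eta, 0 < eta -> exists b : G -> R, [/\ H1 b, forall t, `|b t| <= eta, dirichlet b <= eta &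
     excess_le (fun t => x t - b t) (c + eta)]) -> excess_le x c.
Proof.
move=> hx approx; rewrite /excess_le leNgt; apply/negP => lt.
have [a ca aPhi] : exists2 a : R, dirichlet x + c < a & (a%:E < Phi (cls x))%E.
  move: lt; case: (Phi (cls x)) => [r| |] //.
    by rewrite lte_fin => lt; exists ((dirichlet x + c + r) / 2); rewrite ?lte_fin; lra.
  by move=> _; exists (dirichlet x + c + 1); rewrite ?ltry//; lra.
have [U /nbhs_ballP[dl /= dl0 dlU] hU] := Phi_lsc aPhi.
pose g := a - dirichlet x - c; have g0 : 0 < g by rewrite /g; lra.
have Wx := dirichlet_ge0 hN hx.
(* g is the gap to be contradicted. The three bounds on eta make - 2 dform x b
   at most g / 2, the slack eta at most g / 8, and the L^2 distance less than
   dl. *)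
pose s := g / (4 * (dirichlet x + 1)).
have s0 : 0 < s by rewrite divr_gt0// mulr_gt0//; lra.
pose M := fine (mu setT) + 1.
have M1 : 1 <= M by rewrite /M lerDr fine_ge0.
have M0 : 0 < M by exact: lt_le_trans M1.
pose eta := Num.min (Num.min (s * g / 4) (g / 8)) (dl / (2 * M)).
have eta0 : 0 < eta.
  by rewrite !lt_min !divr_gt0// mulr_gt0.
have [b [hb bM Wb Pb]] := approx eta eta0.
have e1 : eta <= s * g / 4 by rewrite /eta !ge_min lexx.
have e2 : eta <= g / 8 by rewrite /eta !ge_min lexx orbT.
have e3 : eta <= dl / (2 * M) by rewrite /eta !ge_min lexx !orbT.
have hxb := H1B hN hx hb.
have close : `|cls x - cls (fun t => x t - b t)| < dl.
  have h : `|cls x - cls (fun t => x t - b t)| ^+ 2 <= eta ^+ 2 * fine (mu setT).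
    apply: L2_norm_bounded.
    apply: filterS3 (L2_subE (cls x) (cls (fun t => x t - b t))) (clsE hN mu hx)
      (clsE hN mu hxb) => t -> -> ->.
    by rewrite (_ : x t - (x t - b t) = b t)//; ring.
  rewrite -ltr_sqr ?nnegrE ?(ltW dl0)//; apply: le_lt_trans h _.
  have e3' : eta * M <= dl / 2.
    rewrite -ler_pdivlMr//.
    by rewrite -mulrA -invfM.
  apply: (@le_lt_trans _ _ ((eta * M) ^+ 2)).
    rewrite exprMn ler_wpM2l ?sqr_ge0//.
    have : fine (mu setT) <= M by rewrite lerDl.
    by move: M1; set q := fine _; nra.
  apply: (@le_lt_trans _ _ ((dl / 2) ^+ 2)).
    by rewrite ler_sqr ?nnegrE ?mulr_ge0 ?(ltW eta0)//; lra.
  by rewrite ltr_sqr ?nnegrE; lra.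
have aP : (a%:E < Phi (cls (fun t => (x t - b t)%R)))%E.
  by apply: hU; apply: dlU; rewrite -ball_normE.
move: (lt_le_trans aP Pb); rewrite lte_fin.
have -> : dirichlet (fun t => x t - b t) = dirichlet x - 2 * dform x b + dirichlet b.
  have -> : (fun t : G => x t - b t) = (fun t : G => x t + -1 * b t).
    by apply/funext => t; rewrite mulN1r.
  by rewrite dirichletDZ//; ring.
have yg := dform_young hx hb s0.
have sW : s * dirichlet x <= g / 4.
  rewrite /s mulrAC ler_pdivrMr; last by lra.
  rewrite (_ : g / 4 * _ = g * (dirichlet x + 1)); last by field.
  by rewrite ler_pM2l//; lra.
have bs : dirichlet b / s <= g / 4.
  by rewrite ler_pdivrMr//; apply: le_trans Wb _; rewrite mulrC mulrA.
by rewrite /g in sW bs e2 *; lra.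
Qed.

(** Divide the way from x to x + b into steps of length q = 1 / (n + 1). Each
    costs 2 q^2 times the energy of b, so n of them cost O(q). The steps look
    ahead by 2 h, which is why the last one is replaced by [excess_le_closed]
    with the remainder q b. *)
Lemma excess_path x b c : H1 x -> H1 b ->
  (forall s h, 0 <= s -> 0 < h -> s + 2 * h <= 1 -> forall c',
     excess_le (fun t => x t + s * b t) c' ->
     excess_le (fun t => x t + (s + h) * b t) (c' + 2 * h ^+ 2 * dirichlet b)) ->
  excess_le x c -> excess_le (fun t => x t + b t) c.
Proof.
move=> hx hb step Px.
have Wb := dirichlet_ge0 hN hb; have [M hM] := H1_bounded hN hb.
apply: excess_le_closed; first exact: H1D.
move=> eta eta0.
pose K := `|M| + 2 * dirichlet b + 1.
have K0 : 0 < K by rewrite /K; have := normr_ge0 M; lra.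
have [n hn] : exists n : nat, n.+1%:R^-1 * K <= eta.
  have /cvgrPdist_lt/(_ (eta / K)) := @cvg_harmonic R.
  rewrite divr_gt0// => /(_ isT)[n _ /(_ n (leqnn n))] /=.
  by rewrite sub0r normrN ger0_norm// ltr_pdivlMr// => /ltW; exists n.
have [q qE] : exists q : R, q = n.+1%:R^-1 by eexists.
have q0 : 0 < q by rewrite qE invr_gt0.
have q1 : q <= 1 by rewrite qE invf_le1// ler1n.
have qn : n.+1%:R * q = 1 by rewrite qE mulfV.
have iter k : (k <= n)%N ->
    excess_le (fun t => x t + (k%:R * q) * b t) (c + k%:R * (2 * q ^+ 2 * dirichlet b)).
  elim: k => [_|k IH kn].
    by apply: excess_le_ext (_ : excess_le x _) => [t|]; rewrite !mul0r ?addr0.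
  have kq : k%:R * q + 2 * q <= 1.
    rewrite -mulrDl -natrD; apply: (@le_trans _ _ (n.+1%:R * q)); last by rewrite qn.
    by rewrite ler_pM2r// ler_nat addn2 ltnS.
  have := step _ q (mulr_ge0 (ler0n _ k) (ltW q0)) q0 kq _ (IH (ltnW kn)).
  rewrite (_ : k%:R * q + q = k.+1%:R * q); last by rewrite -natr1 mulrDl mul1r.
  rewrite (_ : c + _ + _ = c + k.+1%:R * (2 * q ^+ 2 * dirichlet b))//.
  by rewrite -[k.+1%:R]natr1; ring.
exists (fun t => q * b t); split; first exact: H1Z.
- move=> t; apply: le_trans hn; rewrite -qE normrM gtr0_norm// ler_pM2l//.
  by apply: le_trans (hM t) _; rewrite /K; have := ler_norm M; lra.
- rewrite dirichletZ//; apply: le_trans hn; rewrite -qE expr2 -mulrA ler_pM2l//.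
  apply: (@le_trans _ _ (dirichlet b)); first by rewrite ler_piMl.
  by rewrite /K; have := normr_ge0 M; lra.
have := iter n (leqnn n).
have nq : n%:R * q = 1 - q.
  by move: qn; rewrite -natr1 mulrDl mul1r => nq1; rewrite -[X in _ = X - _]nq1 addrK.
rewrite nq => h; rewrite /excess_le in h *.
rewrite (_ : (fun t => x t + b t - q * b t) = (fun t => x t + (1 - q) * b t)); last first.
  by apply/funext => t; ring.
apply: le_trans h _; rewrite lee_fin lerD2l lerD2l.
rewrite (_ : n%:R * _ = (n%:R * q) * (q * (2 * dirichlet b))); last by ring.
rewrite nq; apply: le_trans hn; rewrite -qE.
apply: (@le_trans _ _ (q * (2 * dirichlet b))).
  by rewrite ler_piMl ?mulr_ge0// ?ltW//; lra.
by rewrite ler_pM2l// /K; have := normr_ge0 M; lra.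
Qed.

(** The half step between Phi and the energy for v <= u, where both arguments
    move to the average. *)
Hypothesis average_step : forall u v, H1 u -> H1 v -> (forall t, 0 <= v t) -> (forall t, v t <= u t) ->
  (Phi (cls (fun t => (2^-1 * (u t + v t))%R)) + (dirichlet (fun t => (2^-1 * (u t + v t))%R))%:E <=
   Phi (cls u) + (dirichlet v)%:E)%E.

(** The half step between the energy with boundary condition and Phi. *)
Hypothesis join_step : forall u v, H1 u -> H1 v -> (forall i, u (vtx i) = 0) ->
  (forall t, 0 <= u t) -> (forall t, 0 <= v t) ->
  ((dirichlet (fun t => (u t - 2^-1 * Num.max (u t - v t) 0)%R))%:E +
     Phi (cls (fun t => (v t + 2^-1 * Num.max (u t - v t) 0)%R)) <=
   (dirichlet u)%:E + Phi (cls v))%E.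

Hypothesis Phi_ge0 : forall f : L2 mu, (0 <= Phi f)%E.

(** The path from u down to v. To advance from s to s + h apply the half step
    to the points s and s + 2 h of the path, whose average is the point s + h.
    The first order terms in h cancel and only the second difference of the
    energy remains. *)
Lemma excess_antitone_step u v c : H1 u -> H1 v -> (forall t, 0 <= v t) ->
  (forall t, v t <= u t) -> excess_le u c -> excess_le v c.
Proof.
move=> hu hv v0 vu Pu; have hb := H1B hN hv hu.
apply: (@excess_le_ext (fun t => u t + (v t - u t))); first by move=> t; ring.
apply: excess_path => // s h s0 h0 sh c' Ps.
set b := fun t => v t - u t in hb *.
have hx : H1 (fun t => u t + s * b t) by apply: H1D => //; exact: H1Z.
have hy : H1 (fun t => u t + (s + 2 * h) * b t) by apply: H1D => //; exact: H1Z.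
have := average_step hx hy _ _.
rewrite (_ : (fun t => 2^-1 * _) = (fun t => u t + (s + h) * b t)); last first.
  by apply/funext => t; field.
have b0 t : b t <= 0 by rewrite /b subr_le0.
move=> /(_ _ _)/wrap[].
- move=> t; have := v0 t; have := b0 t; rewrite (_ : v t = u t + b t); last by rewrite /b; ring.
  by move=> h1 h2; nra.
- by move=> t; have := b0 t; nra.
move=> hh; apply: (excess_budget _ hh Ps) => //.
by rewrite !dirichletDZ//; ring.
Qed.

(** The path from v to v + w, where w = (u - v)^+, is driven by half steps
    against u_s = u - (1 - s - 2 h) w, which vanishes on the boundary and
    satisfies (u_s - v_s)^+ = 2 h w. The first order terms cancel because the
    mixed energy of u - v and w is the energy of w. *)
Lemma excess_join u v c : H1 u -> H1 v -> (forall i, u (vtx i) = 0) ->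
  (forall t, 0 <= u t) -> (forall t, 0 <= v t) -> excess_le v c ->
  excess_le (fun t => v t + Num.max (u t - v t) 0) c.
Proof.
move=> hu hv uV u0 v0 Pv.
have huv := H1B hN hu hv; have [hw _] := H1_pos hN huv.
set w := fun t => Num.max (u t - v t) 0 in hw *.
have wE t : w t = Num.max (u t - v t) 0 by [].
have w0 t : 0 <= w t by rewrite wE le_max lexx orbT.
have wu t : w t <= u t by rewrite wE ge_max u0 lerBlDr lerDl v0.
apply: excess_path => // s h s0 h0 sh c' Ps.
pose us t := u t + - (1 - (s + 2 * h)) * w t.
pose vs t := v t + s * w t.
have hus : H1 us by apply: H1D => //; exact: H1Z.
have hvs : H1 vs by apply: H1D => //; exact: H1Z.
have wsE t : Num.max (us t - vs t) 0 = 2 * h * w t.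
  rewrite /us /vs wE; have [le|lt] := leP (u t - v t) 0.
    by rewrite !mulr0 !addr0 max_r.
  rewrite (_ : _ - _ = 2 * h * (u t - v t)); last by ring.
  by rewrite max_l// !mulr_ge0// ltW.
have := join_step hus hvs _ _ _.
rewrite (_ : (fun t => vs t + 2^-1 * Num.max (us t - vs t) 0) =
   (fun t => v t + (s + h) * w t)); last first.
  by apply/funext => t; rewrite wsE /vs; field.
rewrite (_ : (fun t => us t - 2^-1 * Num.max (us t - vs t) 0) =
   (fun t => us t + - h * w t)); last first.
  by apply/funext => t; rewrite wsE; field.
move=> /(_ _ _ _)/wrap[].
- by move=> i; rewrite /us wE uV sub0r max_r ?mulr0 ?addr0// oppr_le0.
- by move=> t; rewrite /us; have := wu t; have := w0 t; nra.
- by move=> t; rewrite /vs addr_ge0// mulr_ge0.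
rewrite addeC [X in (_ <= X)%E]addeC => hh; apply: (excess_budget _ hh Ps) => //.
have E1 : dform u w = dform v w + dirichlet w.
  have E : dform (fun t => u t - v t) w = dirichlet w by exact: dform_pos.
  rewrite -E -dformDl//; congr (dform _ w); apply/funext => t; by rewrite addrC subrK.
have E2 : dform us w = dform u w - (1 - (s + 2 * h)) * dirichlet w.
  by rewrite /us dformDl//; [rewrite dformZl// mulNr | exact: H1Z].
by rewrite !dirichletDZ// E2 E1; ring.
Qed.

(** Let z = (x - v)^+, which vanishes on the boundary. Joining v with M / e
    times z, where M bounds v + z, gives a function above v + z - min z e:
    where z <= e because the latter is v, elsewhere because the join is at
    least M. As min z e is small uniformly and in energy, the excess of v + z
    is at most that of v, and x <= v + z. *)
Lemma excess_boundary x v c : H1 x -> H1 v -> (forall t, 0 <= x t) ->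
  (forall t, 0 <= v t) -> (forall i, x (vtx i) <= v (vtx i)) ->
  excess_le v c -> excess_le x c.
Proof.
move=> hx hv x0 v0 xv Pv.
have [hz _] := H1_pos hN (H1B hN hx hv).
pose z t := Num.max (x t - v t) 0.
have z0 t : 0 <= z t by rewrite /z le_max lexx orbT.
have zV i : z (vtx i) = 0 by rewrite /z max_r// subr_le0.
have hvz : H1 (fun t => v t + z t) by exact: H1D.
apply: (@excess_antitone_step (fun t => v t + z t)) => //.
  by move=> t; rewrite /z -lerBlDl le_max lexx.
apply: excess_le_closed => // eta eta0.
have [e e0 [eeta We]] := dirichlet_min_small hN hz z0 eta0.
have hb : H1 (fun t => Num.min (z t) e) by exact: H1_min_cst.
exists (fun t => Num.min (z t) e); split => //.
  move=> t; rewrite ger0_norm; last by rewrite le_min z0 ltW.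
  by apply: le_trans eeta; rewrite ge_min lexx orbT.
have [M hM] := H1_bounded hN hvz.
have M0 : 0 <= M by apply: le_trans (hM (gasket_point hV)); exact: normr_ge0.
have hu : H1 (fun t => M / e * z t) by exact: H1Z.
have Me : 0 <= M / e by rewrite divr_ge0// ltW.
have Pj := excess_join hu hv _ _ v0 Pv.
apply: (@excess_antitone_step (fun t => v t + Num.max (M / e * z t - v t) 0)).
- apply: H1D => //; have [] := H1_pos hN (H1B hN hu hv) => //.
- exact: H1B.
- by move=> t; rewrite -addrA addr_ge0// subr_ge0 ge_min lexx.
- move=> t; have [ze|ze] := leP (z t) e.
    by rewrite addrK lerDl le_max lexx orbT.
  have h1 : M <= M / e * z t.
    by rewrite -mulrA ler_peMr// ler_pdivlMl// mulr1 ltW.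
  have h2 := le_trans (ler_norm _) (hM t).
  by rewrite -lerBlDl le_max; apply/orP; left; lra.
apply: le_trans (_ : (dirichlet (fun t => v t + Num.max (M / e * z t - v t) 0) + c)%:E <= _)%E.
  apply: Pj => [i|t] /=; first by rewrite zV mulr0.
  exact: mulr_ge0.
by rewrite lee_fin; lra.
Qed.

End cone.

(** * Decomposition of the intermediate functional *)

(** The flow starts at any point u, is continuous, and lies in the domain at
    almost all positive times. *)
Lemma generates_dense (R : realType) (H : normedModType R) (dot : H -> H -> R)
    (Phi : H -> \bar R) (S : R -> H -> H) : generates dot Phi S ->
  forall u e, 0 < e -> exists2 v, (Phi v < +oo)%E & `|u - v| < e.
Proof.
move=> gen u e e0; have [S0 cS [g _ [Z [mZ Z0 hZ]]]] := gen u.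
have [dl dl0 hdl] := within_continuous_delta cS (lexx 0) e0.
apply: contrapT => no.
have sub : `]0, dl[%classic `<=` Z.
  move=> t; rewrite /= in_itv/= => /andP[t0 tdl]; apply: hZ => /= /(_ t0)[fin _].
  apply: no; exists (S t u) => //.
  by have := hdl t (ltW t0); rewrite S0 sub0r normrN gtr0_norm//; apply.
have : (lebesgue_measure `]0%R, dl[%classic <= 0)%E.
  have mI : measurable (`]0, dl[%classic : set (measurableTypeR R)) by exact: measurable_itv.
  have := @le_measure _ _ _ (@lebesgue_measure R) _ _ (mem_set mI) (mem_set mZ) sub.
  by move=> /le_trans; apply; rewrite le_eqVlt; apply/orP; left; apply/eqP.
by rewrite lebesgue_measure_itv/= lte_fin dl0 -EFinB subr0 lee_fin leNgt dl0.
Qed.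

Lemma lower_semicontinuous_comp (R : realType) (X Y : topologicalType) (f : Y -> \bar R)
    (g : X -> Y) : lower_semicontinuous f -> continuous g -> lower_semicontinuous (f \o g).
Proof.
by move=> lf cg x a /lf[U nU hU]; exists (g @^-1` U); [exact: cg|move=> y; exact: hU].
Qed.

Lemma lower_semicontinuous_add (R : realType) (X : topologicalType) (f g : X -> \bar R) :
  (forall x, 0 <= f x)%E -> (forall x, 0 <= g x)%E ->
  lower_semicontinuous f -> lower_semicontinuous g ->
  lower_semicontinuous (fun x => (f x + g x)%E).
Proof.
move=> f0 g0 lf lg x a /(lte_add_split (f0 x) (g0 x))[c1 [c2 [h1 h2 ac]]].
have [U nU hU] := lf x _ h1; have [U' nU' hU'] := lg x _ h2.
exists (U `&` U'); first exact: filterI.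
move=> y [/hU fy /hU' gy]; apply: lt_le_trans (leeD (ltW fy) (ltW gy)).
by rewrite -EFinD lte_fin.
Qed.

Section intermediate.
Context {R : realType} {N : nat} {p : 'I_N -> 'rV[R]_N.-1} {V : set 'rV[R]_N.-1}.
Context {hV : is_gasket p V}.
Hypothesis hN : (2 <= N)%N.
Hypothesis hp : forall i j, i != j -> euclidean_norm (p i - p j) = 1.
Local Notation G := (gasket_space hV).
Local Notation T := (borel_gasket hV).
Local Notation vtx := (vertex hV).
Variable mu : {finite_measure set T -> \bar R}.
Hypothesis mu_supp : forall U : set G, open U -> U !=set0 -> (0 < mu U)%E.
Local Notation cls := (L2_of mu).
Implicit Types (f g x y : G -> R) (u v w : L2 mu) (a e : R).

Lemma cls_add f g : H1 f -> H1 g -> cls (fun t => f t + g t) = cls f + cls g.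
Proof.
move=> hf hg; have hfg := H1D hN hf hg; apply: L2_eq.
apply: filterS3 (clsE hN mu hfg) (L2_addE (cls f) (cls g)) (filterI (clsE hN mu hf) (clsE hN mu hg)).
by move=> t -> -> [-> ->].
Qed.

Lemma cls_scale a f : H1 f -> cls (fun t => a * f t) = a *: cls f.
Proof.
move=> hf; apply: L2_eq.
by apply: filterS3 (clsE hN mu (H1Z a hf)) (L2_scaleE a (cls f)) (clsE hN mu hf) => t -> -> ->.
Qed.

Lemma cls_comb a f g : H1 f -> H1 g -> cls (fun t => f t + a * g t) = cls f + a *: cls g.
Proof. by move=> hf hg; rewrite cls_add ?cls_scale//; exact: H1Z. Qed.

Lemma cls_ext f g : f =1 g -> cls f = cls g. Proof. by move=> /funext ->. Qed.

Lemma cls0 : cls (fun=> 0) = 0.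
Proof.
by rewrite (cls_ext (g := fun t => 0 * 0)) ?(cls_scale 0 (H1_cst hV hN 0).1) ?scale0r// => t; rewrite mul0r.
Qed.

Variables (S Sinfty St : R -> L2 mu -> L2 mu) (Wt : L2 mu -> \bar R).
Hypothesis hS : generates (L2_dot mu) (energy mu) S.
Hypothesis hSinfty : generates (L2_dot mu) (energy_infty mu) Sinfty.
Hypothesis Wt_ge0 : forall u, (0 <= Wt u)%E.
Hypothesis Wt_lsc : lower_semicontinuous Wt.
Hypothesis Wt_local : local_functional Wt.
Hypothesis Wt0 : Wt 0 = 0%E.
Hypothesis hSt : generates (L2_dot mu) Wt St.
Hypothesis dom_lo : totally_dominated Sinfty St.
Hypothesis dom_hi : totally_dominated St S.

Local Notation sign := [:: 1; -1].
(** For e = 1 and e = -1 the two restrictions of Wt to the positive and to the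
    negative cone, both regarded as functionals on the positive cone. *)
Definition signed e u := Wt (e *: u).

Lemma signed_lsc e : lower_semicontinuous (signed e).
Proof. by apply: lower_semicontinuous_comp => // u; exact: scaler_continuous. Qed.

Lemma dominated_lo e t u v : e \in sign -> 0 <= t -> L2_abs_le u v ->
  L2_abs_le (Sinfty t u) (e *: St t (e *: v)).
Proof.
have [[_ h1] [_ h2]] := dom_lo.
rewrite !inE => /orP[] /eqP -> t0 uv; first by rewrite !scale1r; exact: h1.
by rewrite !scaleN1r; exact: h2.
Qed.

Lemma dominated_hi t u v : 0 <= t -> L2_abs_le u v ->
  L2_abs_le (St t u) (1 *: S t (1 *: v)).
Proof. by have [[_ h1] _] := dom_hi; rewrite !scale1r; exact: h1. Qed.

(** Total domination is what provides both signs e here. As f vanishes on the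
    boundary, so does the half step f - w/2, and its energy with boundary
    condition is its energy. *)
Lemma half_step_lo e f g : e \in sign -> H1 f -> H1 g -> (forall i, f (vtx i) = 0) ->
  (forall t, 0 <= f t) -> (forall t, 0 <= g t) ->
  ((dirichlet (fun t => (f t - 2^-1 * Num.max (f t - g t) 0)%R))%:E +
     signed e (cls (fun t => (g t + 2^-1 * Num.max (f t - g t) 0)%R)) <=
   (dirichlet f)%:E + signed e (cls g))%E.
Proof.
move=> he hf hg fV f0 g0; have [hw _] := H1_pos hN (H1B hN hf hg).
set w := fun t => Num.max (f t - g t) 0 in hw *.
have hfw : H1 (fun t => f t + - 2^-1 * w t) by apply: H1D => //; exact: H1Z.
have fwE : (fun t => f t - 2^-1 * w t) = (fun t => f t + - 2^-1 * w t).
  by apply/funext => t; rewrite mulNr.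
have fwV i : f (vtx i) + - 2^-1 * w (vtx i) = 0.
  by rewrite /w fV sub0r max_r ?oppr_le0// mulr0 addr0.
have aw : {ae mu, forall t, cls w t = Num.max (cls f t - cls g t) 0}.
  by apply: filterS3 (clsE hN mu hw) (clsE hN mu hf) (clsE hN mu hg) => t -> -> ->.
have af : {ae mu, forall t, 0 <= cls f t} by apply: filterS (clsE hN mu hf) => t ->.
have ag : {ae mu, forall t, 0 <= cls g t} by apply: filterS (clsE hN mu hg) => t ->.
have := half_step (energy_infty_ge0 hN hp mu_supp) Wt_ge0 (energy_infty_lsc hN hp mu_supp) Wt_lsc
  hSinfty hSt (mem_head _ _ : 1 \in sign) he (fun t u v => @dominated_lo e t u v he) af ag aw.
rewrite !scale1r -cls_comb// fwE -scaleNr -cls_comb//.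
by rewrite !energy_infty_cls.
Qed.

(** Domination bounds the absolute value of St, so that the sign e can be put
    on the first argument. *)
Lemma half_step_hi e f g : e \in sign -> H1 f -> H1 g -> (forall t, 0 <= g t) ->
  (forall t, g t <= f t) ->
  (signed e (cls (fun t => (2^-1 * (f t + g t))%R)) + (dirichlet (fun t => (2^-1 * (f t + g t))%R))%:E <=
   signed e (cls f) + (dirichlet g)%:E)%E.
Proof.
move=> he hf hg g0 gf; have hw := H1B hN hf hg.
set w := fun t => f t - g t in hw *.
have hgw : H1 (fun t => g t + 2^-1 * w t) by apply: H1D => //; exact: H1Z.
have E1 : (fun t => 2^-1 * (f t + g t)) = (fun t => g t + 2^-1 * w t).
  by apply/funext => t; rewrite /w; field.
have E2 : (fun t => g t + 2^-1 * w t) = (fun t => f t + - 2^-1 * w t).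
  by apply/funext => t; rewrite /w; field.
have aw : {ae mu, forall t, cls w t = Num.max (cls f t - cls g t) 0}.
  apply: filterS3 (clsE hN mu hw) (clsE hN mu hf) (clsE hN mu hg) => t -> -> ->.
  by rewrite max_l// subr_ge0.
have af : {ae mu, forall t, 0 <= cls f t}.
  by apply: filterS (clsE hN mu hf) => t ->; exact: le_trans (g0 t) (gf t).
have ag : {ae mu, forall t, 0 <= cls g t} by apply: filterS (clsE hN mu hg) => t ->.
have := half_step Wt_ge0 (energy_ge0 hN hp mu_supp) Wt_lsc (energy_lsc hN hp mu_supp)
  hSt hS he (mem_head _ _ : 1 \in sign) dominated_hi af ag aw.
rewrite !scale1r -cls_comb// -scaleNr -cls_comb// -E2 -E1.
by rewrite !energy_cls// E1.
Qed.

(** The half step from (u, 0) lands on (u/2, u/2), so that finiteness of Wt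
    forces finiteness of the energy. *)
Lemma signed_finite_H1 e u : e \in sign -> {ae mu, forall t, 0 <= u t} ->
  (signed e u < +oo)%E -> exists2 f, H1 f & u = cls f.
Proof.
move=> he u0 fin; have h0 : H1 (fun _ : G => 0 : R) by exact: (H1_cst hV hN 0).1.
have a0 : {ae mu, forall t, 0 <= (0 : L2 mu) t} by apply: filterS (L2_zeroE mu) => t ->.
have aw : {ae mu, forall t, u t = Num.max (u t - (0 : L2 mu) t) 0}.
  by apply: filterS2 u0 (L2_zeroE mu) => t ut ->; rewrite subr0 max_l.
have := half_step Wt_ge0 (energy_ge0 hN hp mu_supp) Wt_lsc (energy_lsc hN hp mu_supp)
  hSt hS he (mem_head _ _ : 1 \in sign) dominated_hi u0 a0 aw.
rewrite !scale1r add0r -cls0 energy_cls// (H1_cst hV hN 0).2 adde0 => h.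
have : (energy mu (2^-1 *: u) < +oo)%E.
  by apply: le_lt_trans (le_lt_trans h fin); rewrite leeDr// Wt_ge0.
move=> /(energy_lty hN hp)[f hf uE]; exists (fun t => 2 * f t); first exact: H1Z.
by rewrite cls_scale// -uE scalerA mulfV ?scale1r// pnatr_eq0.
Qed.

Lemma Wt_disjoint u v : {ae mu, forall t, u t = 0 \/ v t = 0} ->
  Wt (u + v) = (Wt u + Wt v)%E.
Proof.
move=> uv; apply: Wt_local; apply: filterS uv => t [->|->]; rewrite normr0.
  by rewrite min_l.
by rewrite min_r.
Qed.

(** By locality Wt is finite at the positive and at the negative part of u
    separately. *)
Lemma Wt_dom u : (Wt u < +oo)%E -> exists2 f, H1 f & u = cls f.
Proof.
move=> fin; have [v vE nE] := L2_pos_part u.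
set w := v - u in nE.
have uE : u = v + (-1) *: w by rewrite scaleN1r /w opprB addrC subrK.
have : (signed 1 v + signed (-1) w < +oo)%E.
  rewrite /signed scale1r -Wt_disjoint -?uE//.
  apply: filterS3 vE nE (L2_scaleE (-1) w) => t -> h ->; rewrite {}h.
  have [h1|h1] := leP (u t) 0; first by left.
  by right; rewrite max_r ?mulr0// oppr_le0 ltW.
have pos e z : (0 <= signed e z)%E by exact: Wt_ge0.
move=> fin2.
have f1 : (signed 1 v < +oo)%E by apply: le_lt_trans fin2; rewrite leeDl.
have f2 : (signed (-1) w < +oo)%E by apply: le_lt_trans fin2; rewrite leeDr.
have [||f hf fE] := signed_finite_H1 _ _ f1; first by rewrite inE eqxx.
  by apply: filterS vE => t ->; rewrite le_max lexx orbT.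
have [||g hg gE] := signed_finite_H1 _ _ f2; first by rewrite !inE eqxx orbT.
  by apply: filterS nE => t ->; rewrite le_max lexx orbT.
exists (fun t => f t + -1 * g t); first by apply: H1D => //; exact: H1Z.
by rewrite cls_comb// -fE -gE.
Qed.

(** Of interest only for f in H1, where the energy that is subtracted is
    finite. *)
Definition excess e f : \bar R := (signed e (cls f) - (dirichlet f)%:E)%E.

Lemma excessK e f : signed e (cls f) = ((dirichlet f)%:E + excess e f)%E.
Proof. by rewrite /excess addeC subeK. Qed.

Lemma excess_leP e f c : (excess e f <= c%:E)%E <-> excess_le (signed e) f c.
Proof. by rewrite /excess /excess_le leeBlDr// -EFinD addrC. Qed.

(** The conclusion is restricted to real bounds, to which [excess_boundary]
    applies; negative ones are included, which yields nonnegativity of the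
    excess by comparison with 0. *)
Lemma excess_mono_le e f g : e \in sign -> H1 f -> H1 g -> (forall t, 0 <= f t) ->
  (forall t, 0 <= g t) -> (forall i, f (vtx i) <= g (vtx i)) ->
  forall c : R, (excess e g <= c%:E)%E -> (excess e f <= c%:E)%E.
Proof.
move=> he hf hg f0 g0 fg c /excess_leP gc; apply/excess_leP.
apply: (excess_boundary hN (@signed_lsc e) _ _ _ hf hg f0 g0 fg gc).
- by move=> x y hx hy y0 yx; exact: half_step_hi.
- by move=> x y hx hy xV x0 y0; exact: half_step_lo.
- by move=> z; exact: Wt_ge0.
Qed.

Lemma excess0 e : excess e (fun=> 0) = 0%E.
Proof. by rewrite /excess cls0 /signed scaler0 Wt0 (H1_cst hV hN 0).2 sube0. Qed.

Lemma excess_ge0 e f : e \in sign -> H1 f -> (forall t, 0 <= f t) -> (0 <= excess e f)%E.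
Proof.
move=> he hf f0; rewrite leNgt; apply/negP => lt.
have [c ec c0] : exists2 c : R, (excess e f <= c%:E)%E & c < 0.
  move: lt; case: (excess e f) => [r| |] //; first by rewrite lte_fin => r0; exists r.
  by move=> _; exists (-1); rewrite ?leNye.
have := @excess_mono_le e (fun=> 0) f he (H1_cst hV hN 0).1 hf (fun=> lexx 0) f0 (fun i => f0 _) c ec.
by rewrite excess0 lee_fin leNgt c0.
Qed.

Lemma excess_mono e f g : e \in sign -> H1 f -> H1 g -> (forall t, 0 <= f t) ->
  (forall t, 0 <= g t) -> (forall i, f (vtx i) <= g (vtx i)) ->
  (excess e f <= excess e g)%E.
Proof.
move=> he hf hg f0 g0 fg; have := excess_mono_le he hf hg f0 g0 fg.
have := excess_ge0 he hg g0.
by case: (excess e g) => [r| |] // _ h; [exact: h|rewrite leey].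
Qed.

(** Both Wt, by assumption, and the energy, by strong locality, are additive
    on functions with disjoint supports. *)
Lemma excess_disjoint e f g : e \in sign -> H1 f -> H1 g -> (forall t, 0 <= f t) ->
  (forall t, 0 <= g t) -> (forall t, 0 < f t -> g t = 0) ->
  excess e (fun t => f t + g t) = (excess e f + excess e g)%E.
Proof.
move=> he hf hg f0 g0 fg.
have sE : signed e (cls (fun t => f t + g t)) = (signed e (cls f) + signed e (cls g))%E.
  rewrite /signed cls_add// scalerDr Wt_disjoint//.
  have aF : {ae mu, forall t, cls f t = f t /\ (e *: cls f : L2 mu) t = e * cls f t}.
    by apply: filterS2 (clsE hN mu hf) (L2_scaleE e (cls f)).
  apply: filterS3 aF (clsE hN mu hg) (L2_scaleE e (cls g)) => t [h ->] h' ->.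
  rewrite h h'; have := f0 t; rewrite le_eqVlt => /orP[/eqP <-|/fg ->]; rewrite mulr0; by [left|right].
rewrite /excess sE dirichletD// (dform_local hN hf hg f0 fg) mulr0 addr0.
have := Wt_ge0 (e *: cls f); have := Wt_ge0 (e *: cls g); rewrite /signed.
case: (Wt (e *: cls f)) => [r| |] //; case: (Wt (e *: cls g)) => [q| |] // _ _.
by congr EFin; ring.
Qed.

(** The energy along the path is the continuous function s^2 times that of f,
    so that subtracting it preserves lower semicontinuity. *)
Lemma excess_lsc_path e f : H1 f -> lower_semicontinuous (fun s : R => excess e (fun t => s * f t)).
Proof.
move=> hf s a; rewrite /excess dirichletZ// lteBrDr// -EFinD => lt.
have cpath : continuous (fun s : R => s *: cls f).
  by move=> x; apply: cvgZr_tmp; exact: cvg_id.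
have [b ab bs] : exists2 b : R, a + s ^+ 2 * dirichlet f < b & (b%:E < signed e (s *: cls f))%E.
  move: lt; rewrite cls_scale//; case: (signed e _) => [r| |] //.
    by rewrite lte_fin => lt; exists ((a + s ^+ 2 * dirichlet f + r) / 2); rewrite ?lte_fin; lra.
  by move=> _; exists (a + s ^+ 2 * dirichlet f + 1); rewrite ?ltry//; lra.
have [U nU hU] := lower_semicontinuous_comp (@signed_lsc e) cpath bs.
have csq : x ^+ 2 * dirichlet f @[x --> s] --> s ^+ 2 * dirichlet f.
  by apply: cvgMl; exact: exprn_continuous.
have nlt : \forall x \near s, x ^+ 2 * dirichlet f < b - a.
  by apply: (cvgr_lt _ csq); rewrite ltrBrDl.
exists (U `&` [set x | x ^+ 2 * dirichlet f < b - a]); first exact: filterI.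
move=> x [/hU bx xlt]; rewrite /excess dirichletZ// lteBrDr// -EFinD cls_scale//.
by apply: (lt_trans _ bx); rewrite lte_fin -ltrBrDl.
Qed.

(** B_i s is the excess of the bump psi_i with height s, computed on the cone
    of the sign of s. Bi-monotonicity, normalization and semicontinuity are
    inherited from the excess; the formula follows by replacing the positive
    and negative parts of f by combinations of bumps with the same boundary
    values. *)
Theorem intermediate_decomposition : exists B : 'I_N -> R -> \bar R,
    (forall i, [/\ forall s, (0 <= B i s)%E, lower_semicontinuous (B i),
                   bimonotone (B i) & normalised (B i)]) /\
    forall u : L2 mu,
      Wt u = if u \in H1_L2 mu
             then (energy mu u + \sum_(i < N) B i (crep u (vtx i)))%E
             else +oo%E.
Proof.
have [psi hpsi] := H1_bumps hN hp mu_supp (generates_dense hS).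
have s1 : (1 : R) \in sign by rewrite inE eqxx.
have sN1 : (-1 : R) \in sign by rewrite !inE eqxx orbT.
pose D e i (s : R) := excess e (fun t => Num.max s 0 * psi i t).
have hscale i s : H1 (fun t => Num.max s 0 * psi i t).
  by apply: H1Z; have [] := hpsi i.
have scale0 i s t : 0 <= Num.max s 0 * psi i t.
  by have [_ h _ _] := hpsi i; rewrite mulr_ge0// le_max lexx orbT.
have D0 e i s : e \in sign -> (0 <= D e i s)%E by move=> he; exact: excess_ge0.
have Dmono e i s s' : e \in sign -> s <= s' -> (D e i s <= D e i s')%E.
  move=> he ss; apply: excess_mono => // j; have [_ h _ _] := hpsi i.
  by rewrite ler_wpM2r// ge_max !le_max ss lexx !orbT.
have Dneg e i s : s <= 0 -> D e i s = 0%E.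
  move=> s0; rewrite /D max_r// -(excess0 e); congr (excess e _).
  by apply/funext => t; rewrite mul0r.
have Dlsc e i : lower_semicontinuous (D e i).
  have [h _ _ _] := hpsi i.
  have cm : continuous (fun s : R => Num.max s 0).
    by move=> s; apply: (@continuous_max _ _ id (fun=> 0)); [exact: cvg_id|exact: cst_continuous].
  exact: (lower_semicontinuous_comp (@excess_lsc_path e _ h) cm).
pose B (i : 'I_N) (s : R) := (D 1%R i s + D (-1)%R i (- s)%R)%E.
exists B; split=> [i|u].
  split.
  - by move=> s; rewrite /B adde_ge0// D0.
  - apply: lower_semicontinuous_add; [by move=> s; exact: D0|by move=> s; exact: D0|exact: Dlsc|].
    by apply: (lower_semicontinuous_comp (@Dlsc (-1) i)) => s; exact: opp_continuous.
  - split=> s s' h1 h2; rewrite /B.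
      by rewrite !(Dneg 1) ?add0e ?Dmono ?lerN2//; exact: le_trans h1 h2.
    by rewrite !(Dneg (-1)) ?adde0 ?Dmono ?oppr_le0//; exact: le_trans h1 h2.
  - by rewrite /normalised /B oppr0 !Dneg// adde0.
case: ifPn => [/set_mem /(H1_L2P hN hp)[f hf ->]|nu]; last first.
  apply/eqP; rewrite eq_le leey/= leNgt; apply/negP => /Wt_dom[f hf uE].
  by move/negP: nu; apply; apply/mem_set/(H1_L2P hN hp); exists f.
rewrite energy_cls// (crep_cls hN mu_supp hf).
pose part e t := Num.max (e * f t) 0.
have hpart e : H1 (part e) by apply: (H1_pos hN _).1; exact: H1Z.
have part0 e t : 0 <= part e t by rewrite le_max lexx orbT.
have Dsum e : e \in sign -> excess e (part e) = (\sum_i D e i (e * f (vtx i))%R)%E.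
  move=> he.
  (* Induction on the set of vertices, with disjointness of the bumps at each
     step. *)
  have sumE (r : seq 'I_N) : uniq r ->
      excess e (fun t => \sum_(i <- r) Num.max (e * f (vtx i)) 0 * psi i t) =
      (\sum_(i <- r) D e i (e * f (vtx i))%R)%E.
    elim: r => [_|i r IH /= /andP[ir ur]].
      rewrite big_nil -(excess0 e); congr (excess e _).
      by apply/funext => t; rewrite big_nil.
    rewrite big_cons -IH//.
    rewrite (_ : (fun t => \sum_(j <- i :: r) _) = (fun t => Num.max (e * f (vtx i)) 0 * psi i t +
       \sum_(j <- r) Num.max (e * f (vtx j)) 0 * psi j t)); last first.
      by apply/funext => t; rewrite big_cons.
    apply: excess_disjoint => //.
    - by apply: H1_sum.
    - by move=> t; apply: sumr_ge0.
    move=> t pos; rewrite big_seq big1// => j jr.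
    have [_ p0 _ dis] := hpsi i.
    have pi0 : 0 < psi i t.
      rewrite lt_neqAle p0 andbT eq_sym; apply/eqP => pz.
      by move: pos; rewrite pz mulr0 ltxx.
    rewrite (dis j t _ pi0) ?mulr0//; apply/eqP => ij.
    by move: ir; rewrite ij jr.
  rewrite -(sumE (index_enum 'I_N) (index_enum_uniq _)).
  have hs : H1 (fun t => \sum_(i <- index_enum 'I_N) Num.max (e * f (vtx i)) 0 * psi i t).
    by apply: H1_sum.
  have s0 t : 0 <= \sum_(i <- index_enum 'I_N) Num.max (e * f (vtx i)) 0 * psi i t.
    by apply: sumr_ge0.
  have sV j : \sum_(i <- index_enum 'I_N) Num.max (e * f (vtx i)) 0 * psi i (vtx j) = part e (vtx j).
    have hv i : psi i (vtx j) = (i == j)%:R by have [_ _ ->] := hpsi i.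
    rewrite (bigD1 j)//= hv eqxx mulr1 big1 ?addr0// => i ij.
    by rewrite hv (negPf ij) mulr0.
  by apply/eqP; rewrite eq_le !excess_mono// => j; rewrite sV.
have fE : f = fun t => part 1 t + -1 * part (-1) t.
  apply/funext => t; rewrite /part mul1r !mulN1r.
  by have [h1|h1] := leP (f t) 0; have [h2|h2] := leP (- f t) 0; lra.
have disj t : 0 < part 1 t -> part (-1) t = 0.
  by rewrite /part mul1r mulN1r lt_max ltxx orbF => h; rewrite max_r// oppr_le0 ltW.
have -> : Wt (cls f) = (signed 1%R (cls (part 1%R)) + signed (-1)%R (cls (part (-1)%R)))%E.
  rewrite {1}fE cls_comb// Wt_disjoint ?/signed ?scale1r//.
  apply: filterS3 (clsE hN mu (hpart 1)) (L2_scaleE (-1) (cls (part (-1)))) (clsE hN mu (hpart (-1))).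
  move=> t h -> h'; rewrite h h'; have := part0 1 t.
  by rewrite le_eqVlt => /orP[/eqP <-|/disj ->]; rewrite ?mulr0; [left|right].
have -> : dirichlet f = dirichlet (part 1) + dirichlet (part (-1)).
  by rewrite {1}fE dirichletDZ// (dform_local hN (hpart 1) (hpart (-1)) (part0 1) disj) mulr0 addr0
    sqrrN expr1n mul1r.
rewrite !excessK !Dsum// EFinD addeACA -big_split; congr (_ + _)%E.
by apply: eq_bigr => i _; rewrite /B mul1r mulN1r.
Qed.

End intermediate.

Theorem theorem4p3 (R : realType) (N : nat) (hN : (2 <= N)%N)
    (p : 'I_N -> 'rV[R]_N.-1)
    (hp : forall i j, i != j -> euclidean_norm (p i - p j) = 1)
    (V : set 'rV[R]_N.-1) (hV : is_gasket p V)
    (mu : {finite_measure set (borel_gasket hV) -> \bar R})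
    (mu_neq0 : mu setT <> 0%E)
    (mu_supp : forall U : set (gasket_space hV),
      open U -> U !=set0 -> (0 < mu U)%E)
    (mu_V0 : mu (range (vertex hV)) = 0%E)
    (S Sinfty : R -> L2 mu -> L2 mu)
    (hS : generates (L2_dot mu) (energy mu) S)
    (hSinfty : generates (L2_dot mu) (energy_infty mu) Sinfty)
    (St : R -> L2 mu -> L2 mu)
    (St_contr : contraction_semigroup St)
    (St_order : order_preserving St)
    (Wt : L2 mu -> \bar R)
    (Wt_ge0 : forall u, (0 <= Wt u)%E)
    (Wt_convex : econvex Wt)
    (Wt_proper : eproper Wt)
    (Wt_lsc : lower_semicontinuous Wt)
    (Wt_local : local_functional Wt)
    (Wt0 : Wt 0 = 0%E)
    (hSt : generates (L2_dot mu) Wt St)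
    (dom_lo : totally_dominated Sinfty St)
    (dom_hi : totally_dominated St S) :
  exists B : 'I_N -> R -> \bar R,
    (forall i, [/\ forall x, (0 <= B i x)%E, lower_semicontinuous (B i),
                   bimonotone (B i) & normalised (B i)]) /\
    forall u : L2 mu,
      Wt u = if u \in H1_L2 mu
             then (energy mu u + \sum_(i < N) B i (crep u (vertex hV i)))%E
             else +oo%E.
Proof.
exact: (intermediate_decomposition hN hp mu_supp hS hSinfty Wt_ge0 Wt_lsc Wt_local Wt0
  hSt dom_lo dom_hi).
Qed.
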